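(* A random sup-measure $X$ on $E$ is a CRSM with extremal coefficient functional $\theta$ if and only if $$\{X(K)\}_{K\in\mathcal K}\overset{d}{=}\Big\{\bigvee_{i\ge1}t_i^{-1}\mathbf 1_{F_i\cap K\neq\emptyset}\Big\}_{K\in\mathcal K},$$ where $\{(t_i,F_i)\}_{i\ge1}$ is a Poisson process on $(0,\infty)\times\mathcal F'$ with intensity measure $\lambda\otimes\nu$, $\lambda$ the Lebesgue measure and $\nu$ a locally finite measure on $\mathcal F'$ satisfying $\nu(\mathcal F_K)=\theta(K)$ for all $K\in\mathcal K$.
   Context: $E$ is a locally compact Hausdorff second countable space; $\mathcal K$, $\mathcal F$ its compact and closed subsets; $\mathcal F'=\mathcal F\setminus\{\emptyset\}$ with the $\sigma$-algebra generated by $\mathcal F_K=\{F:F\cap K\ne\emptyset\}$, $K\in\mathcal K$; a measure $\nu$ on $\mathcal F'$ is locally finite if $\nu(\mathcal F_K)<\infty$ for all $K\in\mathcal K$. A sup-measure on $E$ is a Choquet capacity $\varphi$ (non-decreasing, $\varphi(\emptyset)=0$, $\varphi(A_n)\uparrow\varphi(A)$ if $A_n\uparrow A$, $\varphi(K_n)\downarrow\varphi(K)$ for compact $K_n\downarrow K$), finite on compacts, with $\varphi(\bigcup_j G_j)=\sup_j\varphi(G_j)$ for all families of open sets; a random sup-measure is a random element of the space of sup-measures (Borel $\sigma$-algebra of the sup-vague topology). $\mathrm{USC}$: bounded non-negative upper semicontinuous functions on $E$ with relatively compact support. Extremal integral $\int^e f\,d\varphi=\sup\{\varphi(K)\inf_{x\in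 K}f(x):K\in\mathcal K\}$. Unit Fréchet with scale $a\ge0$: distribution function $\exp(-a/t)$, $t>0$. $X$ is max-stable if $\bigvee_iu_iX(K_i)$ is unit Fréchet for all $K_i\in\mathcal K$, $u_i\ge0$; tail dependence functional $\ell(f)$ = scale of $\int^e f\,dX$; extremal coefficient functional $\theta(K)=\ell(\mathbf 1_K)$. $f,g$ are comonotonic if $(f(x)-f(y))(g(x)-g(y))\ge0$ for all $x,y$. $X$ is a CRSM if it is max-stable and $\ell(f+g)=\ell(f)+\ell(g)$ for all comonotonic $f,g\in\mathrm{USC}$. *)

(* Defs.v *)
From HB Require Import structures.
From mathcomp Require Import all_boot all_order all_algebra.
From mathcomp Require Import all_classical all_reals all_analysis.
Set Implicit Arguments. Unset Strict Implicit. Unset Printing Implicit Defensive.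
Import Order.TTheory GRing.Theory Num.Theory.
Local Open Scope classical_set_scope.
Local Open Scope ring_scope.

Section Defs.
Context {R : realType} {E : topologicalType}.

(** Sup-measures: Choquet capacities, finite on compacts, commuting with
    arbitrary suprema of open sets (sup of an empty family is 0). *)
Definition sup_measure (phi : set E -> \bar R) : Prop :=
  [/\ (forall A B, A `<=` B -> (phi A <= phi B)%E),
      phi set0 = 0%E,
      (forall A : (set E)^nat, (forall n m, (n <= m)%N -> A n `<=` A m) ->
          (phi \o A) @ \oo --> phi (\bigcup_n A n)),
      (forall K : (set E)^nat, (forall n, compact (K n)) ->
          (forall n m, (n <= m)%N -> K m `<=` K n) ->
          (phi \o K) @ \oo --> phi (\bigcap_n K n)) &
      ((forall K, compact K -> (phi K < +oo)%E) /\
      (forall (I : Type) (G : I -> set E), (forall i, open (G i)) ->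
          phi (\bigcup_i G i) = ereal_sup ([set 0%E] `|` range (phi \o G))))].

(** Random sup-measure: pointwise a sup-measure, and measurable w.r.t. the
    Borel sigma-algebra of the sup-vague topology, expressed through the
    preimages of the subbasic open sets {phi | phi K < x} (K compact) and
    {phi | phi G > x} (G open). *)
Definition random_sup_measure d (Omega : measurableType d)
  (X : Omega -> set E -> \bar R) : Prop :=
  [/\ (forall w, sup_measure (X w)),
      (forall K (x : R), compact K -> measurable [set w | (X w K < x%:E)%E]) &
      (forall G (x : R), open G -> measurable [set w | (x%:E < X w G)%E])].

Definition USC (f : E -> R) : Prop :=
  [/\ (forall x, 0 <= f x), (exists M, forall x, f x <= M),
      (forall c, open [set x | f x < c]) &
      compact (closure [set x | 0 < f x])].

Definition comonotonic (f g : E -> R) : Prop :=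
  forall x y, 0 <= (f x - f y) * (g x - g y).

Definition ext_int (phi : set E -> \bar R) (f : E -> R) : \bar R :=
  ereal_sup [set (phi K * (inf (f @` K))%:E)%E | K in compact].

Definition unit_frechet d (Omega : measurableType d) (P : probability Omega R)
  (Y : Omega -> \bar R) (a : R) : Prop :=
  0 <= a /\ forall t : R, 0 < t ->
    measurable [set w | (Y w <= t%:E)%E] /\
    P [set w | (Y w <= t%:E)%E] = (expR (- a / t))%:E.

Definition max_stable d (Omega : measurableType d) (P : probability Omega R)
  (X : Omega -> set E -> \bar R) : Prop :=
  forall n (K : 'I_n -> set E) (u : 'I_n -> R),
    (forall i, compact (K i)) -> (forall i, 0 <= u i) ->
    exists a, unit_frechet P
      (fun w => \big[Order.max/0%E]_(i < n) ((u i)%:E * X w (K i))%E) a.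

(** CRSM: max-stable and the tail dependence functional l(f) (the scale of
    the extremal integral) is additive on comonotonic USC functions. *)
Definition CRSM d (Omega : measurableType d) (P : probability Omega R)
  (X : Omega -> set E -> \bar R) : Prop :=
  max_stable P X /\
  forall f g, USC f -> USC g -> comonotonic f g ->
    exists a b,
      [/\ unit_frechet P (fun w => ext_int (X w) f) a,
          unit_frechet P (fun w => ext_int (X w) g) b &
          unit_frechet P (fun w => ext_int (X w) (f \+ g)) (a + b)].

Definition ext_coeff d (Omega : measurableType d) (P : probability Omega R)
  (X : Omega -> set E -> \bar R) (theta : set E -> R) : Prop :=
  forall K, compact K -> unit_frechet P (fun w => ext_int (X w) \1_K) (theta K).

Definition Fprime : set (set E) := [set F | closed F /\ F !=set0].
Definition hit (K : set E) : set (set E) := [set F | Fprime F /\ F `&` K !=set0].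
Definition Fsigma : set (set (set E)) := <<s Fprime, [set hit K | K in compact] >>.

Definition measure_on T (S : set (set T)) (m : set T -> \bar R) : Prop :=
  [/\ m set0 = 0%E, (forall A, S A -> (0 <= m A)%E) &
      (forall F : (set T)^nat, (forall n, S (F n)) -> trivIset setT F ->
         S (\bigcup_n F n) ->
         (fun n => \sum_(0 <= k < n) m (F k))%E @ \oo --> m (\bigcup_n F n))].

Definition locally_finite (nu : set (set E) -> \bar R) : Prop :=
  forall K, compact K -> (nu (hit K) < +oo)%E.

Definition Dom : set (R * set E) := [set p | 0 < p.1 /\ Fprime p.2].
Definition rects : set (set (R * set E)) :=
  [set B | exists (I : set (measurableTypeR R)) (C : set (set E)),
     [/\ measurable I, I `<=` [set t | 0 < t], Fsigma C & B = I `*` C]].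
Definition ProdSigma : set (set (R * set E)) := <<s Dom, rects >>.

Definition is_product_intensity (nu : set (set E) -> \bar R)
  (mu : set (R * set E) -> \bar R) : Prop :=
  measure_on ProdSigma mu /\
  forall (I : set (measurableTypeR R)) (C : set (set E)),
    measurable I -> I `<=` [set t | 0 < t] -> Fsigma C ->
    mu (I `*` C) = (lebesgue_measure I * nu C)%E.

(** number of points of a (countable, possibly finite) family in B *)
Definition count (pts : nat -> option (R * set E)) (B : set (R * set E)) : \bar R :=
  (\sum_(0 <= i <oo)
     match pts i with Some p => (\1_B p : R)%:E | None => 0%E end)%E.

Definition poisson_pmf' (m : R) (k : nat) : R := m ^+ k / k`!%:R * expR (- m).

Definition poisson_process d (Omega : measurableType d) (P : probability Omega R)
  (pts : Omega -> nat -> option (R * set E)) (mu : set (R * set E) -> \bar R) : Prop :=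
  [/\ (forall w i p, pts w i = Some p -> Dom p),
      (forall B (k : nat), ProdSigma B -> (mu B < +oo)%E ->
          measurable [set w | count (pts w) B = k%:R%:E]) &
      (forall n (B : 'I_n -> set (R * set E)) (k : 'I_n -> nat),
          (forall j, ProdSigma (B j)) -> (forall j, (mu (B j) < +oo)%E) ->
          (forall i j, i != j -> B i `&` B j = set0) ->
          P (\bigcap_j [set w | count (pts w) (B j) = (k j)%:R%:E]) =
          (\prod_(j < n) poisson_pmf' (fine (mu (B j))) (k j))%:E)].

Definition rep (pts : nat -> option (R * set E)) (K : set E) : \bar R :=
  ereal_sup (range (fun i => match pts i with
     | Some p => (p.1^-1 * (\1_[set F : set E | F `&` K !=set0] p.2 : R))%:E
     | None => 0%E end)).

Definition same_fidi d1 (Omega1 : measurableType d1) (P1 : probability Omega1 R)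
  (Y1 : Omega1 -> set E -> \bar R)
  d2 (Omega2 : measurableType d2) (P2 : probability Omega2 R)
  (Y2 : Omega2 -> set E -> \bar R) : Prop :=
  forall n (K : 'I_n -> set E) (x : 'I_n -> R), (forall j, compact (K j)) ->
    P1 (\bigcap_j [set w | (Y1 w (K j) <= (x j)%:E)%E]) =
    P2 (\bigcap_j [set w | (Y2 w (K j) <= (x j)%:E)%E]).

End Defs.

(* Main.v *)
Require Import Defs.
From HB Require Import structures.
From mathcomp Require Import all_boot all_order all_algebra.
From mathcomp Require Import all_classical all_reals all_analysis.
From mathcomp Require Import measurable_realfun ring lra zify.
Import Order.TTheory GRing.Theory Num.Theory.
Import numFieldNormedType.Exports.
Set Implicit Arguments. Unset Strict Implicit. Unset Printing Implicit Defensive.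
Local Open Scope classical_set_scope.
Local Open Scope ring_scope.

(** On a chain K_0 <= K_1 <= ... of compact sets with weights v_0 >= v_1 >= ...
    decreasing to 0, the weighted maximum of the v_i X(K_i) is the extremal
    integral of the step function with jumps v_i - v_(i+1) on K_i, a sum of
    pairwise comonotonic indicators. For a CRSM it is therefore Frechet with scale
    \sum_i (v_i - v_(i+1)) theta(K_i) ([chain_law]). Ordering the weights reduces
    every finite-dimensional event of a maxitive functional to an event on a chain,
    so theta determines the law. The Poisson functional obeys the same chain law,
    which for it is a void probability. Conversely the chain law yields comonotonic
    additivity: the scale of the integral of f is a limit of sums of theta over the
    level sets of f, and the level sets of two comonotonic functions together form
    a chain.

    The measure nu comes from the tails of X. For a countable base B_i of
    relatively compact open sets, n times the probability that the closures of
    B_0, ..., B_k are exceeded at level n in a given nonzero pattern converges;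
    the limits are consistent masses on the binary tree, realised by Lebesgue
    measure on [0, +oo[ through nested intervals. Sending v to the closed set of
    the points x such that bit i of v is 1 whenever x is in B_i transports
    Lebesgue measure to nu. The Poisson process itself is a deterministic function
    of one uniform variable on [0, 1[. *)

(** A measure on closed sets is usually obtained from a completely alternating capacity by Choquet's
    theorem. Here complete alternation is never stated: a pattern mass is a limit of n times a
    probability, so it is nonnegative for free, and inclusion-exclusion only shows that the limit
    exists, starting from n (1 - exp(- a / n)) --> a. The pattern without exceedance has infinite
    limiting mass; this is why the tree occupies a half-line and not a bounded interval.

    The limiting bits respect inclusions between basic sets only almost everywhere. The coded closed
    set hits a compact K exactly when every finite basic cover of K contains an index with bit 1,
    and matching the mass of this event with theta(K) requires outer continuity of theta, which is
    itself extracted from the laws of X.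

    The measure nu is an image of Lebesgue measure on the half-line, and lambda times nu one of
    Lebesgue measure on a quadrant. Cutting the quadrant into unit squares makes the process a
    superposition of countably many cells, each with a Poisson(1) number of uniform points, so an
    infinite nu causes no difficulty. *)

Lemma probability_cvg d (T : measurableType d) (R : realType)
    (P : probability T R) (A : (set T)^nat) (B : set T) :
  (forall n, measurable (A n)) -> measurable B ->
  (forall w, \forall n \near \oo, A n w <-> B w) ->
  P (A n) @[n --> \oo] --> P B.
Proof.
move=> mA mB AB.
have H C : measurable C -> (\int[P]_x (\1_C x)%:E = P C)%E.
  by move=> mC; rewrite integral_indic// setIT.
rewrite -H//.
under eq_fun do rewrite -H//.
apply: (@dominated_cvg _ _ _ P setT measurableT _ _ (fun=> 1%E)) => //.
- by move=> n; apply/measurable_EFinP; exact: measurable_indic.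
- move=> w _; apply: cvg_near_cst.
  have := AB w; apply: filterS => n ABn; congr EFin.
  by rewrite !indicE; congr (nat_of_bool _)%:R; apply/idP/idP; rewrite !inE => /ABn.
- apply/integrableP; split => //.
  under eq_integral do rewrite abse1.
  rewrite integral_cst// mul1e; exact: (le_lt_trans (probability_le1 _ measurableT) (ltry _)).
- by move=> n w _ /=; rewrite lee_fin indicE; case: (_ \in _); rewrite ?normr0 ?normr1.
Qed.

Lemma countType_bigcup_measurable d (T : measurableType d) (U : countType)
    (P : set U) (F : U -> set T) :
  (forall i, P i -> measurable (F i)) -> measurable (\bigcup_(i in P) F i).
Proof.
move=> mF; rewrite bigcup_mkcond; apply: countable_bigcupT_measurable => [|i].
  exact: countableP.
by case: ifP => //; rewrite inE; exact: mF.
Qed.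

Lemma countType_bigcap_measurable d (T : measurableType d) (U : countType)
    (P : set U) (F : U -> set T) :
  (forall i, P i -> measurable (F i)) -> measurable (\bigcap_(i in P) F i).
Proof.
move=> mF; rewrite -[X in measurable X]setCK setC_bigcap; apply: measurableC.
by apply: countType_bigcup_measurable => i Pi; exact/measurableC/mF.
Qed.

(** * Binary trees of intervals *)

Lemma measure_fibers d (T : measurableType d) (R : realType)
    (mu : {measure set T -> \bar R}) (I : finType) (Q : pred I) (F : I -> set T) :
  (forall i, Q i -> measurable (F i)) ->
  (forall i j w, Q i -> Q j -> F i w -> F j w -> i = j) ->
  mu [set w | exists2 i, Q i & F i w] = (\sum_(i | Q i) mu (F i))%E.
Proof.
move=> mF FI; rewrite [RHS](_ : _ = (\sum_(i <- enum I | Q i) mu (F i))%E); last by rewrite big_enum_cond.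
have -> : [set w | exists2 i, Q i & F i w] =
    \bigcup_(i in [set i | i \in [seq i <- enum I | Q i]]) F i.
  apply/seteqP; split => w /= [i Qi Fi]; exists i => //=.
    by rewrite mem_filter Qi mem_enum.
  by move: Qi; rewrite /= mem_filter => /andP[].
rewrite -big_filter; have : uniq [seq i <- enum I | Q i] by rewrite filter_uniq ?enum_uniq.
have : all Q [seq i <- enum I | Q i] by exact: filter_all.
elim: [seq i <- enum I | Q i] => [_ _|i r IH /= /andP[Qi Qr] /andP[ir ur]].
  by rewrite big_nil (_ : \bigcup_(_ in _) _ = set0) ?measure0// -subset0 => w [].
rewrite big_cons -IH// -measureU//; first 1 last.
- exact: mF.
- apply: fin_bigcup_measurable => [|j /= jr]; first exact: finite_seq.
  by apply: mF; move/allP : Qr => /(_ j jr).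
- rewrite -subset0 => w [Fi [j /= jr Fj]].
  move: ir; rewrite (FI i j w)//; first by rewrite jr.
  by move/allP : Qr => /(_ j jr).
- congr (mu _); apply/seteqP; split => w /=.
    move=> [j /=]; rewrite inE => /orP[/eqP->|jr] Fj; [by left|right; by exists j].
  by move=> [Fi|[j /= jr Fj]]; [exists i|exists j] => //=; rewrite inE ?eqxx ?jr ?orbT.
Qed.

Lemma probability_fibers d (T : measurableType d) (R : realType)
    (P : probability T R) (I : finType) (Q : pred I) (F : I -> set T) :
  (forall i, Q i -> measurable (F i)) ->
  (forall i j w, Q i -> Q j -> F i w -> F j w -> i = j) ->
  P [set w | exists2 i, Q i & F i w] = (\sum_(i | Q i) P (F i))%E.
Proof. exact: measure_fibers. Qed.

Section tree.
Context {R : realType} (m : seq bool -> R).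
Implicit Types (s : seq bool) (v : R) (n : nat).

(* A binary tree of nested subintervals of [0, +oo[: the cell of s starts at
   [tree_left s] and has length [m s], the child with bit [true] coming first.
   The all-[false] cells are unbounded, so [m s] is meaningful only when
   [has id s]. *)
Fixpoint tree_left s : R :=
  match s with
  | [::] => 0
  | b :: s' => tree_left s' + (if b then 0 else m (true :: s'))
  end.

(* Prefixes are stored in reverse, so that the first entry is the last bit. *)
Fixpoint tree_path v n : seq bool :=
  if n is n'.+1 then
    let s := tree_path v n' in (v < tree_left s + m (true :: s)) :: s
  else [::].

Definition tree_bit n v : bool :=
  v < tree_left (tree_path v n) + m (true :: tree_path v n).

Definition tree_cell s : set R :=
  [set v | tree_left s <= v /\ (has id s -> v < tree_left s + m s)].

Lemma size_tree_path v n : size (tree_path v n) = n.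
Proof. by elim: n => //= n ->. Qed.

Lemma nth_tree_path v n i : (i < n)%N ->
  nth false (tree_path v n) (n - i.+1) = tree_bit i v.
Proof.
elim: n => // n IH; rewrite ltnS leq_eqVlt => /orP[/eqP->|iltn].
  by rewrite subnn.
by rewrite -(IH iltn) subSS -(subnSK iltn).
Qed.

Hypothesis m_ge0 : forall s, has id s -> 0 <= m s.
Hypothesis m_split : forall s, has id s -> m s = m (true :: s) + m (false :: s).

Lemma tree_left_ge0 s : 0 <= tree_left s.
Proof. by elim: s => //= -[] s IH; rewrite addr_ge0// m_ge0. Qed.

(** The two children of a cell meet at [tree_left s + m (true :: s)]. Under an unbounded parent the
    [false] child is unbounded too, so its upper bound never has to be known; under a bounded one
    [m_split] provides it. *)
Lemma tree_pathP v s : 0 <= v -> tree_path v (size s) = s <-> tree_cell s v.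
Proof.
move=> v0; elim: s => [|b s IH]; first by split => // _; split.
have m1 : 0 <= m (true :: s) by exact: m_ge0.
have ms : has id s -> m s = m (true :: s) + m (false :: s) /\ 0 <= m (false :: s).
  by move=> hs; split; [exact: m_split|exact: m_ge0].
rewrite /=; split.
  move=> [bE sE]; move/IH : (sE) => [sv vs]; rewrite sE in bE; subst b.
  split; rewrite /= ; case: ltP => // ?; rewrite ?addr0//= => hs.
  by have [] := ms hs; have := vs hs; lra.
move=> []; rewrite /=; case: b => /= h1 h2.
  have sE : tree_path v (size s) = s.
    apply/IH; split; first by move: h1; rewrite addr0.
    by move=> hs; have := h2 isT; have [] := ms hs; lra.
  by rewrite sE; congr (_ :: _); apply/idP; have := h2 isT; lra.
have sE : tree_path v (size s) = s.
  apply/IH; split; first by apply: le_trans h1; rewrite lerDl.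
  by move=> hs; have := h2 hs; have [] := ms hs; lra.
by rewrite sE; congr (_ :: _); apply/negbTE; rewrite -leNgt.
Qed.

Lemma measurable_tree_cell s : measurable (tree_cell s : set R).
Proof.
have -> : tree_cell s = if has id s then `[tree_left s, tree_left s + m s[%classic
    else `[tree_left s, +oo[%classic.
  apply/seteqP; split => v; rewrite /tree_cell; case: (has id s); rewrite /= in_itv/= ?andbT.
  - by move=> [-> /(_ isT)].
  - by move=> [].
  - by move=> /andP[].
  - by [].
by case: ifP.
Qed.

Lemma measurable_tree_path n (Q : set (seq bool)) :
  measurable ([set v | 0 <= v /\ Q (tree_path v n)] : set R).
Proof.
rewrite (_ : mkset _ = \bigcup_(s in [set s | Q s /\ size s = n])
    (`[0, +oo[%classic `&` tree_cell s)).
  apply: countType_bigcup_measurable => s _.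
  by apply: measurableI => //; exact: measurable_tree_cell.
apply/seteqP; split => v /=.
  move=> [v0 Qv]; exists (tree_path v n) => /=; first by rewrite size_tree_path.
  split; first by rewrite in_itv/= v0.
  by apply/tree_pathP => //; rewrite size_tree_path.
move=> [s /= [Qs <-]] [] /=; rewrite in_itv/= andbT => v0 /tree_pathP -> //.
Qed.

Lemma lebesgue_tree_cell s : has id s ->
  lebesgue_measure ([set v | 0 <= v /\ tree_path v (size s) = s] : set R) = (m s)%:E.
Proof.
move=> hs; rewrite (_ : mkset _ = `[tree_left s, tree_left s + m s[%classic).
  rewrite lebesgue_measure_itv/= lte_fin ltrDl.
  case: ltP => [_|]; first by rewrite -EFinB addrAC subrr add0r.
  by move=> ms; congr EFin; apply/eqP; rewrite eq_le ms m_ge0.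
apply/seteqP; split => v /=.
  by move=> [v0 /tree_pathP[]// lv /(_ hs)]; rewrite in_itv/= lv => ->.
rewrite in_itv/= => /andP[lv vm]; have v0 := le_trans (tree_left_ge0 s) lv.
by split=> //; apply/tree_pathP.
Qed.

Lemma lebesgue_tree_path n (Q : pred (n.-tuple bool)) :
  (forall s : n.-tuple bool, Q s -> has id s) ->
  lebesgue_measure ([set v | 0 <= v /\ exists2 s : n.-tuple bool, Q s & tree_path v n = s] : set R)
    = (\sum_(s | Q s) m s)%:E.
Proof.
move=> Qh.
rewrite (_ : mkset _ = [set v | exists2 s : n.-tuple bool, Q s & 0 <= v /\ tree_path v n = s]); last first.
  apply/seteqP; split => v /= [].
    by move=> v0 [s Qs vs]; exists s.
  by move=> s Qs [v0 vs]; split => //; exists s.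
rewrite (measure_fibers (@lebesgue_measure R) (F := fun s : n.-tuple bool => [set v | 0 <= v /\ tree_path v n = s])).
- rewrite -sumEFin; apply: eq_bigr => s Qs.
  by have := lebesgue_tree_cell (Qh s Qs); rewrite size_tuple.
- by move=> s _; exact: (measurable_tree_path n [set tval s]).
- by move=> s s' v _ _ /= [_ vs] [_ vs']; apply: val_inj => /=; rewrite -vs.
Qed.

Lemma measurable_tree_bit n (b : bool) :
  measurable ([set v | 0 <= v /\ tree_bit n v = b] : set R).
Proof.
have := measurable_tree_path n.+1 [set s | head false s = b].
by [].
Qed.

End tree.

(** * Independent uniform variables *)

Section unit_interval.
Context {R : realType}.

(** The sample space is the whole line, with everything outside [0, 1[ null, so that maps of the
    line to itself can be iterated and translated without a change of type. *)
Definition prob01 : set (measurableTypeR R) -> \bar R :=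
  mrestr (@lebesgue_measure R) (measurable_itv `[(0:R), 1[).

HB.instance Definition _ := Measure.on prob01.

Let prob01T : prob01 setT = 1%E.
Proof.
by rewrite /prob01 /mrestr setTI lebesgue_measure_itv/= lte_fin ltr01 oppr0 adde0.
Qed.

HB.instance Definition _ := Measure_isProbability.Build _ _ _ prob01 prob01T.

Lemma prob01E A : prob01 A = lebesgue_measure (A `&` `[0, 1[%classic).
Proof. by []. Qed.

End unit_interval.

Lemma fin_probability d (T : measurableType d) (R : realType)
    (P : probability T R) A : measurable A -> P A = (fine (P A))%:E.
Proof. by move=> mA; rewrite fineK// fin_num_measure. Qed.

Lemma measurable_fun_preimage d d' (T : measurableType d) (U : measurableType d')
    (f : T -> U) A : measurable_fun setT f -> measurable A -> measurable (f @^-1` A).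
Proof. by move=> mf mA; rewrite -[X in measurable X]setTI; exact: mf. Qed.

(** A pi-lambda argument. The factor [P H] lets one statement serve twice: with [H = setT] it
    compares two laws, and with a general [H] it extends independence from a generating
    pi-system. *)
Lemma law_extend d d' d'' (T : measurableType d) (T' : measurableType d')
    (U : measurableType d'') (R : realType)
    (P : probability T R) (P' : probability T' R) (G : set (set U))
    (f : T -> U) (h : T' -> U) (H : set T) :
  @measurable _ U = <<s G >> -> setI_closed G ->
  measurable H -> measurable_fun setT f -> measurable_fun setT h ->
  (forall A, G A -> P (f @^-1` A `&` H) = (P' (h @^-1` A) * P H)%E) ->
  forall A, measurable A -> P (f @^-1` A `&` H) = (P' (h @^-1` A) * P H)%E.
Proof.
move=> UG GI mH mf mh PG A; rewrite UG.
have mfA B : measurable B -> measurable (f @^-1` B) by exact: measurable_fun_preimage.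
have mhA B : measurable B -> measurable (h @^-1` B) by exact: measurable_fun_preimage.
pose Q B := P (f @^-1` B `&` H) = (P' (h @^-1` B) * P H)%E.
apply: (@dynkin_induction _ _ G Q) => //; rewrite /Q.
- by rewrite !preimage_setT setTI probability_setT mul1e.
- move=> S mS QS; rewrite -!preimage_setC (_ : _ `&` H = H `\` f @^-1` S); last by rewrite setDE setIC.
  have Hoo : (P H < +oo)%E by exact: le_lt_trans (probability_le1 _ _) (ltry _).
  have mS' := mfA _ mS.
  have D : P (H `\` f @^-1` S) = (P H - P (H `&` f @^-1` S))%E := measureD mH mS' Hoo.
  rewrite D (setIC H) QS (probability_setC P' (mhA _ mS)).
  rewrite (fin_probability P' (mhA _ mS)) (fin_probability P mH).
  by rewrite -EFinM -EFinB -(EFinB 1) -EFinM mulrBl mul1r.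
- move=> F mF tF QF; rewrite !preimage_bigcup setI_bigcupl.
  have tr X (k : X -> U) : trivIset setT (fun n => k @^-1` F n).
    apply/trivIsetP => i j _ _ ij; rewrite -preimage_setI.
    by move/trivIsetP : tF => ->//; rewrite preimage_set0.
  rewrite !measure_bigcup//.
  + rewrite (fin_probability P mH) muleC -nneseriesZl//; apply: eq_eseriesr => i _.
    by apply: (eq_trans (QF i)); rewrite (fin_probability P mH) muleC.
  + by move=> i _; exact: mhA.
  + by move=> i _; apply: measurableI => //; exact: mfA.
  + by under eq_fun do rewrite setIC; exact: trivIset_setIl.
Qed.

Definition coin {R : realType} (S : pred bool) : R :=
  ((S true)%:R + (S false)%:R) / 2.

Definition cylinder (n : nat) (S : nat -> pred bool) : set (nat -> bool) :=
  [set w | forall i, (i < n)%N -> S i (w i)].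

Definition cylinders : set (set (nat -> bool)) :=
  [set C | exists n S, C = cylinder n S].

Definition coins := g_sigma_algebraType cylinders.
HB.instance Definition _ := Measurable.on coins.

Lemma cylinder_extend n S k : cylinder n S =
  cylinder (n + k) (fun i => if (i < n)%N then S i else predT).
Proof.
apply/seteqP; split => w /= Sw i.
  by case: ifP => //= iln _; exact: Sw.
by move=> iln; have := Sw i; rewrite iln; apply; exact: ltn_addr.
Qed.

Lemma cylinderI n S S' : cylinder n S `&` cylinder n S' =
  cylinder n (fun i => [predI S i & S' i]).
Proof.
apply/seteqP; split => w /=; first by move=> [Sw S'w] i iln; apply/andP; split; [exact: Sw|exact: S'w].
by move=> Sw; split => i iln; have /andP[] := Sw _ iln.
Qed.

Lemma setI_closed_cylinders : setI_closed cylinders.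
Proof.
move=> _ _ [n [S ->]] [k [S' ->]].
rewrite (cylinder_extend n S k) (cylinder_extend k S' n) (addnC k) cylinderI.
by eexists; eexists.
Qed.

Lemma measurable_cylinder n S : measurable (cylinder n S : set coins).
Proof. by apply: sub_sigma_algebra; exists n, S. Qed.

Lemma measurable_coin i : measurable_fun setT (fun w : coins => w i).
Proof.
apply: (measurable_fun_bool true); rewrite setTI.
have -> : (fun w : coins => w i) @^-1` [set true] =
    cylinder i.+1 (fun j => if j == i then id else predT).
  apply/seteqP; split => w /=; first by move=> wi j _; case: eqP => //= ->.
  by move=> /(_ i (ltnSn i)); rewrite eqxx.
exact: measurable_cylinder.
Qed.

Lemma measurable_coins d (T : measurableType d) (f : T -> coins) :
  (forall i, measurable_fun setT (fun x => f x i)) -> measurable_fun setT f.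
Proof.
move=> mf; apply: (@measurability _ _ _ _ setT f cylinders) => // _ [_ [n [S ->]] <-].
rewrite setTI [X in measurable X](_ : _ =
    \bigcap_(i in [set i | (i < n)%N]) (fun x => f x i) @^-1` [set b | S i b]).
  apply: bigcap_measurableType => i _.
  exact: measurable_fun_preimage.
by apply/seteqP; split.
Qed.

Section coin_tree.
Context {R : realType}.
Implicit Types (s : seq bool) (v : R) (n : nat).

(* With these masses the first bit of v is 1 exactly on [0, 1[, and there the
   following bits are the binary digits of v, up to complementation. *)
Fixpoint coin_tree s : R :=
  if s is _ :: s' then (if has id s' then coin_tree s' / 2 else 1) else 1.

Lemma coin_tree_ge0 s : 0 <= coin_tree s.
Proof. by elim: s => //= b s IH; case: ifP => // _; rewrite divr_ge0. Qed.

Lemma coin_tree_split s : has id s ->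
  coin_tree s = coin_tree (true :: s) + coin_tree (false :: s).
Proof. by move=> /= ->; rewrite -splitr. Qed.

Let path := tree_path coin_tree.
Let bit := tree_bit coin_tree.

Lemma coin_tree_path v n : 0 <= v < 1 -> has id (path v n.+1) /\ coin_tree (path v n.+1) = 2^-1 ^+ n.
Proof.
move=> /andP[v0 v1]; elim: n => [|n [IH1 IH2]].
  by rewrite /path /= add0r v1.
split; first by apply/orP; right.
by rewrite -[LHS]/(if has id (path v n.+1) then coin_tree (path v n.+1) / 2 else 1) IH1 IH2 exprSr.
Qed.

Lemma bit0 v : bit 0 v = (v < 1).
Proof. by rewrite /bit /tree_bit /= add0r. Qed.

(** Each new bit is a fair coin independent of the past, because inside [0, 1[ both children of a
    cell carry half of its mass. *)
Lemma prob01_coin_tree n (Q : pred (seq bool)) (b : bool) :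
  (prob01 (R := R) [set v | Q (path v n.+1) /\ bit n.+1 v = b] =
   (1/2)%:E * prob01 [set v | Q (path v n.+1)])%E.
Proof.
have um := @measurable_tree_path R coin_tree (fun s _ => coin_tree_ge0 s) coin_tree_split.
(* The last entry of a path is its first bit, which is [true] exactly when v < 1. Requiring it
   selects [0, 1[ and ensures [has id], without which cell masses mean nothing. *)
pose q (s : n.+1.-tuple bool) := Q s && nth false s n.
have bitn v : nth false (path v n.+1) n = (v < 1).
  by have := @nth_tree_path R coin_tree v n.+1 0 isT; rewrite subn1 => ->; exact: bit0.
have pathS v : tree_path coin_tree v n.+2 = bit n.+1 v :: path v n.+1 by [].
have qh (s : n.+1.-tuple bool) : q s -> has id s.
  move=> /andP[_ sn]; apply/hasP; exists (nth false s n) => //.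
  by apply: mem_nth; rewrite size_tuple.
have sz v : size (path v n.+1) == n.+1 by rewrite size_tree_path.
have E1 : prob01 [set v | Q (path v n.+1)] = (\sum_(s | q s) coin_tree s)%:E.
  rewrite -(@lebesgue_tree_path R coin_tree (fun s _ => coin_tree_ge0 s) coin_tree_split _ _ qh).
  congr lebesgue_measure; apply/seteqP; split => v.
    move=> [/= Qv]; rewrite /= in_itv/= => /andP[v0 v1]; split => //.
    by exists (Tuple (sz v)) => //; rewrite /q [tval _]/= Qv bitn v1.
  move=> [v0 [s /andP[Qs sn] vs]]; split; rewrite -vs in Qs sn => //.
  by rewrite /= in_itv/= v0 -bitn.
rewrite E1.
transitivity (lebesgue_measure ([set v | exists2 s : n.+1.-tuple bool, q s &
   0 <= v /\ tree_path coin_tree v n.+2 = b :: s] : set R)).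
  congr lebesgue_measure; apply/seteqP; split => v.
    move=> [[/= Qv vb]]; rewrite /= in_itv/= => /andP[v0 v1].
    exists (Tuple (sz v)); first by rewrite /q [tval _]/= Qv bitn v1.
    by split => //; rewrite -vb.
  move=> [s /andP[Qs sn] [v0]]; rewrite pathS => -[vb vs].
  rewrite -vs in Qs sn; split => //.
  by rewrite /= in_itv/= v0 -bitn.
rewrite (measure_fibers (@lebesgue_measure R) (F := fun s : n.+1.-tuple bool =>
  [set v | 0 <= v /\ tree_path coin_tree v n.+2 = b :: s])).
- rewrite -EFinM mulr_sumr -sumEFin; apply: eq_bigr => s qs.
  have hs : has id (b :: s) by rewrite /= (qh _ qs) orbT.
  have := lebesgue_tree_cell (fun s _ => coin_tree_ge0 s) coin_tree_split hs.
  rewrite -[size _]/(size s).+1 size_tuple => H; apply: (eq_trans H).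
  by rewrite -[coin_tree _]/(if has id s then coin_tree s / 2 else 1) (qh _ qs) mulrC mul1r.
- by move=> s qs; apply: (um n.+2 [set b :: (s : seq bool)]).
- by move=> s s' v _ _ /= [_ vs] [_]; rewrite vs => -[ss]; exact: val_inj.
Qed.

(** Bit 0 of the tree only records v < 1, so the random digits start at bit 1. The guard fixes a
    value outside [0, 1[. *)
Definition digits v : coins := fun i => (0 <= v < 1) && bit i.+1 v.

Lemma measurable_digits : measurable_fun setT (digits : measurableTypeR R -> coins).
Proof.
apply: measurable_coins => i; apply: (measurable_fun_bool true); rewrite setTI.
rewrite [X in measurable X](_ : _ = `[0, 1[%classic `&` [set v | 0 <= v /\ bit i.+1 v = true]).
  by apply: measurableI => //; apply: measurable_tree_bit; [move=> s _; exact: coin_tree_ge0|exact: coin_tree_split].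
apply/seteqP; split => v /=; rewrite in_itv/= /digits.
  by move=> /andP[/andP[-> ->] ->].
by move=> [/andP[-> ->] [_ ->]].
Qed.

Lemma prob01_cylinder n S :
  prob01 (R := R) (digits @^-1` cylinder n S) = (\prod_(i < n) coin (S i))%:E.
Proof.
pose Q n (s : seq bool) := all (fun i => S i (nth false s (n - i.+1))) (iota 0 n).
have QE k : prob01 (R := R) (digits @^-1` cylinder k S) = prob01 [set v | Q k (path v k.+1)].
  congr lebesgue_measure; apply/seteqP; split => v /= [Sv v01]; split => //.
    apply/allP => i; rewrite mem_iota add0n => /= ik.
    have := Sv i ik; rewrite /digits; move: v01; rewrite /= in_itv/= => -> /=.
    by rewrite /bit -(@nth_tree_path R coin_tree v k.+1 i.+1).
  move=> i ik; have /allP/(_ i) := Sv; rewrite mem_iota add0n => /(_ ik).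
  rewrite /digits; move: v01; rewrite /= in_itv/= => -> /=.
  by rewrite /bit -(@nth_tree_path R coin_tree v k.+1 i.+1).
rewrite QE; elim: n => [|n IH].
  by rewrite big_ord0 /Q /= (_ : [set _ | _] = setT) ?probability_setT//; exact/seteqP.
have mQ b : measurable ([set v | Q n (path v n.+1) /\ bit n.+1 v = b] `&` `[0, 1[%classic : set (measurableTypeR R)).
  rewrite [X in measurable X](_ : _ = `[0, 1[%classic `&` [set v | 0 <= v /\ [set s | Q n (behead s) /\ head false s = b] (path v n.+2)]).
    by apply: measurableI => //; apply: measurable_tree_path; [move=> s _; exact: coin_tree_ge0|exact: coin_tree_split].
  apply/seteqP; split => v /=; rewrite in_itv/=; first by move=> [? /andP[-> ->]].
  by move=> [/andP[-> ->] [_ ?]].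
(* Split according to the newest bit; each half is then a condition on the older bits, to which
   [prob01_coin_tree] applies. *)
have E : prob01 (R := R) [set v | Q n.+1 (path v n.+2)] =
   (prob01 [set v | S n true /\ (Q n (path v n.+1) /\ bit n.+1 v = true)] +
    prob01 [set v | S n false /\ (Q n (path v n.+1) /\ bit n.+1 v = false)])%E.
  have mQ' b : measurable ([set v | S n b /\ (Q n (path v n.+1) /\ bit n.+1 v = b)] `&` `[0, 1[%classic : set (measurableTypeR R)).
    case Sb : (S n b).
      rewrite [X in measurable X](_ : _ = [set v | Q n (path v n.+1) /\ bit n.+1 v = b] `&` `[0, 1[%classic)//.
      by apply/seteqP; split => v /=; [move=> [[_ ?] ?]|move=> [? ?]].
    by rewrite [X in measurable X](_ : _ = set0)//; apply/seteqP; split => v //= [[]].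
  rewrite !prob01E -measureU//.
    congr lebesgue_measure; apply/seteqP; split => v /=.
      move=> [Qv v01]; move/allP : (Qv) => Qv'.
      have Qv0 : Q n (path v n.+1).
        apply/allP => i; rewrite mem_iota add0n => /= ik.
        have := Qv' i; rewrite mem_iota add0n => /(_ (leqW ik)).
        by rewrite subSn.
      have := Qv' n; rewrite mem_iota add0n ltnSn => /(_ isT).
      rewrite subnn /= -/(tree_bit coin_tree n.+1 v) -/bit.
      by case E : (bit n.+1 v) => Snb; [left|right].
    have H b : S n b -> Q n (path v n.+1) -> bit n.+1 v = b -> Q n.+1 (path v n.+2).
      move=> Sb /allP Qv vb; apply/allP => i; rewrite mem_iota add0n ltnS => /=.
      rewrite leq_eqVlt => /orP[/eqP->|ik].
        by rewrite subnn /= -/(tree_bit coin_tree n.+1 v) -/bit vb.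
      by have := Qv i; rewrite mem_iota add0n ik => /(_ isT); rewrite subSn.
    by move=> [[[Sb [Qv vb]] v01]|[[Sb [Qv vb]] v01]]; split => //; apply: H Sb _ _.
  by rewrite -subset0 => v /= [[[_ [_ ->]] _] [[_ [_]]]].
have F b : prob01 (R := R) [set v | S n b /\ (Q n (path v n.+1) /\ bit n.+1 v = b)] =
   (((S n b)%:R / 2)%:E * prob01 [set v | Q n (path v n.+1)])%E.
  case: (S n b) => /=.
    by rewrite -(prob01_coin_tree _ (Q n) b); congr lebesgue_measure; apply/seteqP; split => v /=; [move=> [[_ ?] ?]|move=> [? ?]].
  by rewrite mul0r mul0e (_ : mkset _ = set0) ?measure0//; apply/seteqP; split => v //= [[]].
apply: (eq_trans E); rewrite !F -ge0_muleDl ?lee_fin ?divr_ge0//.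
by rewrite IH -EFinD -EFinM big_ord_recr/= -mulrDl mulrC.
Qed.

(** The negation appears because [true] selects the left half of a cell, hence the binary digit
    0. *)
Definition undigits_sum (n : nat) (w : coins) : R := \sum_(i < n) (~~ w i)%:R * 2^-1 ^+ i.+1.

Definition undigits (w : coins) : R := limn (undigits_sum ^~ w).

Lemma cvg_undigits w : undigits_sum n w @[n --> \oo] --> undigits w.
Proof.
apply: nondecreasing_is_cvgn => [n k|].
  move=> /subnK <-; elim: (k - n)%N => // l IH; rewrite addSn.
  by apply: le_trans IH _; rewrite /undigits_sum big_ord_recr/= lerDl mulr_ge0.
exists 1 => _ [n _ <-].
suff : undigits_sum n w <= 1 - 2^-1 ^+ n by move/le_trans; apply; rewrite lerBlDr lerDl.
elim: n => [|n IH]; first by rewrite /undigits_sum big_ord0 expr0 subrr.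
rewrite /undigits_sum big_ord_recr/= -/(undigits_sum n w).
have : (~~ w n)%:R * 2^-1 ^+ n.+1 <= 2^-1 ^+ n.+1 :> R.
  by rewrite ler_piMl// lern1; case: (w n).
by rewrite exprS; lra.
Qed.

Lemma measurable_undigits : measurable_fun setT (undigits : coins -> measurableTypeR R).
Proof.
apply: (@measurable_fun_cvg _ _ _ _ undigits_sum) => [n|w _]; last exact: cvg_undigits.
apply: measurable_sum => i; apply: measurable_funM => //.
have -> : (fun w : coins => (~~ w i)%:R : R) = \1_[set w : coins | w i = false].
  apply/funext => w; rewrite indicE; congr (nat_of_bool _)%:R.
  by apply/idP/idP; rewrite inE /=; [move/negbTE|move=> ->].
apply: measurable_indic; rewrite (_ : [set _ | _] = (fun w : coins => w i) @^-1` [set false])//.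
exact: measurable_fun_preimage (measurable_coin i) _.
Qed.

(** The partial sums are the left ends of the cells containing v, whose lengths 2^-n tend to 0. *)
Lemma digitsK v : 0 <= v < 1 -> undigits (digits v) = v.
Proof.
move=> v01; apply/cvg_lim => //.
have E n : undigits_sum n (digits v) = tree_left coin_tree (path v n.+1).
  elim: n => [|n IH].
    by rewrite /undigits_sum big_ord0 /path /=; case/andP: v01 => _ v1; rewrite !add0r v1.
  have TL : tree_left coin_tree (path v n.+2) = tree_left coin_tree (path v n.+1) +
    (if bit n.+1 v then 0 else coin_tree (true :: path v n.+1)) by [].
  have [h1 h2] := coin_tree_path n v01.
  rewrite TL -[coin_tree (_ :: _)]/(if has id (path v n.+1) then coin_tree (path v n.+1) / 2 else 1).
  rewrite h1 h2 /undigits_sum big_ord_recr -/(undigits_sum n _) IH; congr (_ + _).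
  rewrite /digits v01 -exprSr.
  by case: (bit _ _); rewrite ?mul0r ?mul1r.
apply: (@squeeze_cvgr _ _ _ _ (fun n => v - 2^-1 ^+ n) (cst v)).
- near=> n; rewrite E.
  have v0 : 0 <= v by case/andP: v01.
  have [h1 h2] := coin_tree_path n v01.
  have /(tree_pathP (fun s _ => coin_tree_ge0 s) coin_tree_split) : tree_path coin_tree v (size (path v n.+1)) = path v n.+1 by rewrite size_tree_path.
  move=> /(_ v0)[lv /(_ h1)]; rewrite h2 => vl.
  by rewrite lerBlDr (ltW vl).
- rewrite -[X in _ --> X]subr0; apply: cvgB; first exact: cvg_cst.
  by apply: cvg_expr; rewrite ger0_norm// invf_lt1// ltr1n.
- exact: cvg_cst.
Unshelve. all: by end_near. Qed.

Lemma prob01_undigits A : measurable A ->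
  prob01 (R := R) (digits @^-1` (undigits @^-1` A)) = prob01 A.
Proof.
move=> mA; congr lebesgue_measure; apply/seteqP; split => v /= [Av v01]; split => //;
  by move: Av; rewrite digitsK//; move: v01; rewrite /= in_itv.
Qed.

End coin_tree.

Section pairing.
Context {R : realType}.
Local Notation P := (@prob01 R).

Let ev (w : coins) : coins := fun i => w i.*2.
Let od (w : coins) : coins := fun i => w i.*2.+1.

Let measurable_ev : measurable_fun setT ev.
Proof. by apply: measurable_coins => i; exact: measurable_coin. Qed.

Let measurable_od : measurable_fun setT od.
Proof. by apply: measurable_coins => i; exact: measurable_coin. Qed.

Let evd := ev \o (@digits R).
Let odd' := od \o (@digits R).

Let measurable_evd : measurable_fun setT (evd : measurableTypeR R -> coins).
Proof. by apply: measurableT_comp => //; exact: measurable_digits. Qed.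

Let measurable_odd' : measurable_fun setT (odd' : measurableTypeR R -> coins).
Proof. by apply: measurableT_comp => //; exact: measurable_digits. Qed.

Let prod_double (F : nat -> R) n :
  \prod_(i < n.*2) F i = (\prod_(i < n) F i.*2) * \prod_(i < n) F i.*2.+1.
Proof.
elim: n => [|n IH]; first by rewrite !big_ord0 mulr1.
by rewrite doubleS !big_ord_recr/= IH; ring.
Qed.

Let cylinders_indep C1 C2 : cylinders C1 -> cylinders C2 ->
  (P (evd @^-1` C1 `&` odd' @^-1` C2) =
   P (@digits R @^-1` C1) * P (@digits R @^-1` C2))%E.
Proof.
move=> [n [S ->]] [k [S' ->]].
rewrite (cylinder_extend n S k) (cylinder_extend k S' n) (addnC k).
move: (fun i => _) (fun i => _) => T' T; move: (n + k)%N => N.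
rewrite !prob01_cylinder -EFinM.
(* Conditions on N even and N odd digits interleave into one cylinder of length 2N. *)
rewrite (_ : _ `&` _ = @digits R @^-1` cylinder N.*2 (fun i => if odd i then T' i./2 else T i./2)).
  rewrite prob01_cylinder (prod_double (fun i => coin (if odd i then T' i./2 else T i./2))).
  congr (_ * _)%:E; apply: eq_bigr => i _; first by rewrite odd_double doubleK.
  by rewrite oddS odd_double -[_./2]/(uphalf i.*2) uphalf_double.
apply/seteqP; split => v /=.
  move=> [H1 H2] i iN; have := odd_double_half i.
  have iN2 : (i./2 < N)%N by rewrite -ltn_double; apply: leq_ltn_trans iN; lia.
  case: ifP => oi; rewrite ?add0n ?add1n => iE.
    by have := H2 _ iN2; rewrite /odd' /od /= iE.
  by have := H1 _ iN2; rewrite /evd /ev /= iE.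
move=> H; split => i iN.
  by have := H i.*2; rewrite ltn_double odd_double doubleK; exact.
by have := H i.*2.+1; rewrite oddS odd_double -[_./2]/(uphalf i.*2) uphalf_double; apply; lia.
Qed.

Let evd_law A : measurable A -> P (evd @^-1` A) = P (@digits R @^-1` A).
Proof.
move=> mA; have := @law_extend _ _ _ _ _ coins R P P cylinders evd (@digits R) setT
  erefl setI_closed_cylinders measurableT measurable_evd (@measurable_digits R) _ A mA.
rewrite setIT probability_setT mule1; apply => C cC.
have c0 : cylinders setT by exists 0%N, (fun=> predT); exact/seteqP.
by have := cylinders_indep cC c0; rewrite !preimage_setT probability_setT mule1.
Qed.

Let odd'_law A : measurable A -> P (odd' @^-1` A) = P (@digits R @^-1` A).
Proof.
move=> mA; have := @law_extend _ _ _ _ _ coins R P P cylinders odd' (@digits R) setT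
  erefl setI_closed_cylinders measurableT measurable_odd' (@measurable_digits R) _ A mA.
rewrite setIT probability_setT mule1; apply => C cC.
have c0 : cylinders setT by exists 0%N, (fun=> predT); exact/seteqP.
by have := cylinders_indep c0 cC; rewrite !preimage_setT probability_setT mul1e setTI setIT mule1.
Qed.

(** Independence is extended from cylinders one factor at a time, by two nested uses of
    [law_extend]. *)
Let coins_indep A B : measurable A -> measurable B ->
  (P (evd @^-1` A `&` odd' @^-1` B) =
   P (@digits R @^-1` A) * P (@digits R @^-1` B))%E.
Proof.
move=> mA mB; rewrite setIC -(evd_law mA) muleC.
apply: (@law_extend _ _ _ _ _ coins R P P cylinders odd' (@digits R) (evd @^-1` A)
  erefl setI_closed_cylinders _ measurable_odd' (@measurable_digits R)) => // [|C cC].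
  exact: measurable_fun_preimage measurable_evd _.
have mC : measurable (C : set coins) by exact: sub_sigma_algebra.
rewrite setIC.
change (P (evd @^-1` A `&` odd' @^-1` C) = (P (@digits R @^-1` C) * P (evd @^-1` A))%E).
rewrite (evd_law mA) muleC -(odd'_law mC).
apply: (@law_extend _ _ _ _ _ coins R P P cylinders evd (@digits R) (odd' @^-1` C)
  erefl setI_closed_cylinders _ measurable_evd (@measurable_digits R)) => // [|C' cC'].
  exact: measurable_fun_preimage measurable_odd' _.
change (P (evd @^-1` C' `&` odd' @^-1` C) = (P (@digits R @^-1` C') * P (odd' @^-1` C))%E).
by rewrite (odd'_law mC); exact: cylinders_indep.
Qed.

(* The digits of even and of odd rank of a uniform number give two independent
   uniform numbers. *)
Lemma prob01_pairing : exists g1 g2 : measurableTypeR R -> measurableTypeR R,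
  [/\ measurable_fun setT g1, measurable_fun setT g2 &
      forall A B, measurable A -> measurable B ->
        P (g1 @^-1` A `&` g2 @^-1` B) = (P A * P B)%E].
Proof.
exists (@undigits R \o evd), (@undigits R \o odd'); split.
- exact: measurableT_comp (@measurable_undigits R) measurable_evd.
- exact: measurableT_comp (@measurable_undigits R) measurable_odd'.
- move=> A B mA mB; rewrite !comp_preimage coins_indep ?prob01_undigits//.
  + exact: measurable_fun_preimage (@measurable_undigits R) _.
  + exact: measurable_fun_preimage (@measurable_undigits R) _.
Qed.

End pairing.

(** * Multinomial counts of independent samples *)

Section sampling.
Context d (T : measurableType d) (R : realType) (P : probability T R).
Context (g1 g2 : T -> T).
Hypothesis (mg1 : measurable_fun setT g1) (mg2 : measurable_fun setT g2).
Hypothesis g_indep : forall A B, measurable A -> measurable B ->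
  P (g1 @^-1` A `&` g2 @^-1` B) = (P A * P B)%E.

(* The maps g1, g1 o g2, g1 o g2 o g2, ... are independent with law P. *)
Definition sample_count (m : nat) (A : set T) (w : T) : nat :=
  \sum_(i < m) (g1 (iter i g2 w) \in A).

Lemma sample_count0 A w : sample_count 0 A w = 0%N.
Proof. by rewrite /sample_count big_ord0. Qed.

Lemma sample_countS m A w :
  sample_count m.+1 A w = ((g1 w \in A) + sample_count m A (g2 w))%N.
Proof.
rewrite /sample_count big_ord_recl/=; congr addn.
by apply: eq_bigr => i _; rewrite -iterSr.
Qed.

Section disjoint_sets.
Context (n : nat) (A : 'I_n -> set T).
Hypothesis mA : forall j, measurable (A j).
Hypothesis A_disj : forall i j, i != j -> A i `&` A j = set0.

Let event m (k : 'I_n -> nat) := [set w | forall j, sample_count m (A j) w = k j].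

Let rho j := fine (P (A j)).
Let rest := ~` \bigcup_j A j.
Let r := fine (P rest).

(** Counts still to be realised after a first sample in class [o], where [None] is the complement of
    all the [A j]. The predicate [ok] excludes the classes for which the subtraction would be
    truncated. *)
Let dec (k : 'I_n -> nat) (o : option 'I_n) : 'I_n -> nat :=
  if o is Some j then fun i => (k i - (i == j))%N else k.
Let cls (o : option 'I_n) := if o is Some j then A j else rest.
Let ok (k : 'I_n -> nat) (o : option 'I_n) := if o is Some j then (0 < k j)%N else true.

Let mcls o : measurable (cls o).
Proof.
case: o => [j|] /=; first exact: mA.
by apply: measurableC; apply: countType_bigcup_measurable => j _; exact: mA.
Qed.

Let clsI o o' w : cls o w -> cls o' w -> o = o'.
Proof.
case: o o' => [j|] [j'|] //= Aw Aw'.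
- congr Some; apply/eqP/negPn/negP => /A_disj jj'.
  by have : (A j `&` A j') w by []; rewrite jj'.
- by case: Aw'; exists j.
- by case: Aw; exists j'.
Qed.

Let cls_in o w j : cls o w -> (w \in A j) = (o == Some j).
Proof.
move=> ow; apply/idP/eqP; first by rewrite inE => /(clsI (o' := Some j) ow).
by move=> oj; rewrite inE; move: ow; rewrite oj.
Qed.

Let eventS m k : event m.+1 k = [set w | exists2 o, ok k o &
  (g1 @^-1` (cls o) `&` g2 @^-1` (event m (dec k o))) w].
Proof.
apply/seteqP; split => w /=.
  move=> Ew.
  have [ o ow] : exists o, cls o (g1 w).
    have [[j _ jw]|nw] := pselect ((\bigcup_j A j) (g1 w)); first by exists (Some j).
    by exists None.
  exists o.
    case: o ow => //= j jw; have := Ew j; rewrite sample_countS.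
    by rewrite mem_set// => <-.
  split => // j; have := Ew j; rewrite sample_countS (cls_in _ ow).
  by case: o ow => [i|] ow //= <-; rewrite (inj_eq Some_inj) eq_sym addKn.
move=> [ o oko [ow Ew]] j; rewrite sample_countS Ew (cls_in _ ow).
case: o oko ow {Ew} => [i|] //= ki _; rewrite (inj_eq Some_inj) (eq_sym i).
by case: eqP => [->|]; rewrite ?subn0 ?add1n ?subn1 ?prednK.
Qed.

Let measurable_event m k : measurable (event m k).
Proof.
elim: m k => [|m IH] k.
  have [k0|k0] := pselect (forall j, k j = 0%N).
    by rewrite (_ : event _ _ = setT)//; apply/seteqP; split => // w _ j; rewrite sample_count0 k0.
  rewrite (_ : event _ _ = set0)//; apply/seteqP; split => // w Ew.
  by apply: k0 => j; rewrite -Ew sample_count0.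
rewrite eventS (_ : mkset _ = \bigcup_(o in [set o | ok k o]) (g1 @^-1` (cls o) `&` g2 @^-1` (event m (dec k o)))).
  apply: countType_bigcup_measurable => o _; apply: measurableI.
    exact: measurable_fun_preimage.
  exact: measurable_fun_preimage.
by apply/seteqP; split => w /= [ q qk H]; exists q.
Qed.

Let weight (k : 'I_n -> nat) : R := \prod_j (rho j ^+ k j / (k j)`!%:R).
Let total (k : 'I_n -> nat) : nat := \sum_j k j.

Let weight_dec k j : (0 < k j)%N -> rho j * weight (dec k (Some j)) = (k j)%:R * weight k.
Proof.
move=> kj; rewrite /weight (bigD1 j)//= [in RHS](bigD1 j)//= eqxx subn1 !mulrA.
congr (_ * _); last by apply: eq_bigr => i /negbTE ->; rewrite subn0.
rewrite -(prednK kj) factS natrM exprS/=.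
have : (k j).-1.+1%:R != 0 :> R by rewrite pnatr_eq0.
have : (k j).-1`!%:R != 0 :> R by rewrite pnatr_eq0 -lt0n fact_gt0.
move: (_.+1%:R) (_`!%:R) => x y y0 x0.
by field; rewrite x0 y0.
Qed.

Let total_dec k j : (0 < k j)%N -> (total (dec k (Some j))).+1 = total k.
Proof.
move=> kj; rewrite /total (bigD1 j)//= [in RHS](bigD1 j)//= eqxx subn1 -addSn prednK//.
by congr addn; apply: eq_bigr => i /negbTE ->; rewrite subn0.
Qed.

Let ffactSS m s : (m.+1 ^_ s.+1 = m ^_ s.+1 + s.+1 * m ^_ s)%N.
Proof.
rewrite ffactSS ffactnSr; have [sm|ms] := leqP s m.
  by rewrite [RHS](_ : _ = (m - s + s.+1) * m ^_ s)%N; [congr muln; lia|lia].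
by rewrite (ffact_small ms) !muln0.
Qed.

(** The multinomial law, by conditioning on the class of the first sample. The falling factorial
    vanishes when more than m points are required, so the truncated exponent of r is harmless
    there. *)
Let probability_event m k :
  P (event m k) = ((m ^_ (total k))%:R * r ^+ (m - total k) * weight k)%:E.
Proof.
elim: m k => [|m IH] k.
  have [k0|k0] := pselect (forall j, k j = 0%N).
    rewrite (_ : event _ _ = setT); last by apply/seteqP; split => // w _ j; rewrite sample_count0 k0.
    rewrite probability_setT /total /weight !big1 ?mulr1// => j _; rewrite ?k0//.
    by rewrite expr0 fact0 divr1.
  rewrite (_ : event _ _ = set0); last first.
    by apply/seteqP; split => // w Ew; apply: k0 => j; rewrite -Ew sample_count0.
  rewrite measure0 ffact_small ?mul0r// lt0n sum_nat_eq0.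
  apply/negP => /forallP k0'; apply: k0 => j; by have := k0' j => /= /eqP.
rewrite eventS probability_fibers; last 2 first.
- move=> o _; apply: measurableI; exact: measurable_fun_preimage.
- by move=> o o' w _ _ [/= ow _] [/= ow' _]; exact: clsI ow ow'.
transitivity (\sum_(o | ok k o) (fine (P (cls o)) * ((m ^_ (total (dec k o)))%:R *
    r ^+ (m - total (dec k o)) * weight (dec k o)))%:E)%E.
  apply: eq_bigr => o _; rewrite g_indep// IH (fin_probability P (mcls o)).
  by rewrite -EFinM.
rewrite sumEFin; congr EFin.
rewrite (bigID (pred1 None))/= (big_pred1 None) => [|q]; last by case: q => [j|] /=; rewrite ?andbF.
rewrite -/rest -/r.
transitivity (r * ((m ^_ (total k))%:R * r ^+ (m - total k) * weight k) +
  \sum_(j | (0 < k j)%N) rho j * ((m ^_ (total k).-1)%:R * r ^+ (m.+1 - total k) * weight (dec k (Some j)))).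
  congr (_ + _).
  rewrite (reindex_omap Some id) => [|[j|] //].
  apply: eq_big => [j|j]; first by rewrite /= eqxx !andbT.
  by rewrite /= eqxx !andbT => kj; rewrite -(total_dec kj) subSS.
(* Class [Some j] contributes [k j] times a factor independent of j. The sum thus depends on the
   total count only, and what remains is the recurrence [ffactSS]. *)
rewrite (eq_bigr (fun j => (k j)%:R * ((m ^_ (total k).-1)%:R * r ^+ (m.+1 - total k) * weight k))); last first.
  by move=> j kj; rewrite mulrCA (weight_dec kj) mulrCA.
rewrite -mulr_suml (_ : \sum_(j | _) _ = (total k)%:R); last first.
  rewrite /total natr_sum [RHS](bigID (fun j => 0 < k j)%N)/= [X in _ = _ + X]big1 ?addr0// => j.
  by rewrite -eqn0Ngt => /eqP ->.
case: (total k) => [|s]; first by rewrite mul0r addr0 subn0 !ffactn0 subn0 !mul1r exprS mulrA.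
rewrite ffactSS subSS/=.
have [sm|ms] := ltnP s m.
  by rewrite -(subnSK sm) natrD natrM exprS; ring.
rewrite (@ffact_small m s.+1)// natrD natrM mulr0n !mul0r mulr0 add0r add0r.
by ring.
Qed.

Lemma sample_count_law m (k : 'I_n -> nat) :
  measurable [set w | forall j, sample_count m (A j) w = k j] /\
  P [set w | forall j, sample_count m (A j) w = k j] =
   ((m ^_ (\sum_j k j))%:R * fine (P (~` \bigcup_j A j)) ^+ (m - \sum_j k j) *
    \prod_j (fine (P (A j)) ^+ k j / (k j)`!%:R))%:E.
Proof. by split; [exact: measurable_event|exact: probability_event]. Qed.

Lemma probability_rest : fine (P (~` \bigcup_j A j)) = 1 - \sum_j fine (P (A j)).
Proof.
have mU : measurable (\bigcup_j A j) by apply: countType_bigcup_measurable => j _.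
rewrite probability_setC// fineB ?fin_num_measure//=; congr (_ - _).
rewrite (_ : \bigcup_j A j = [set w | exists2 j, xpredT j & A j w]); last first.
  by apply/seteqP; split => w [j _ jw]; exists j.
rewrite probability_fibers//.
  by rewrite (eq_bigr (fun j => (rho j)%:E)) ?sumEFin// => j _; rewrite fin_probability.
by move=> i j w _ _ iw jw; case: (@clsI (Some i) (Some j) w iw jw).
Qed.

End disjoint_sets.
End sampling.

(** * Poisson processes *)

Section poisson_pmf.
Context {R : realType}.
Implicit Types (x y : R) (k n : nat).

(** The binomial theorem. The range is an arbitrary [n > k] so that one ordinal type can later serve
    all coordinates at once. *)
Lemma poisson_pmf_conv x y k n : (k < n)%N ->
  \sum_(a < n | (a <= k)%N) poisson_pmf' x a * poisson_pmf' y (k - a) =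
  poisson_pmf' (x + y) k.
Proof.
move=> kn; rewrite (eq_bigl (fun a : 'I_n => (a < k.+1)%N)) => [|a]; last by rewrite ltnS.
rewrite -(big_ord_widen n (fun a => poisson_pmf' x a * poisson_pmf' y (k - a)))//.
rewrite [in RHS]/poisson_pmf' (addrC x) exprDn !mulr_suml; apply: eq_bigr => a _.
have ak : (a <= k)%N by rewrite -ltnS.
rewrite /poisson_pmf' opprD expRD -mulr_natr -(bin_fact ak) !natrM.
have fact0 i : i`!%:R != 0 :> R by rewrite pnatr_eq0 -lt0n fact_gt0.
have bin0 : 'C(k, a)%:R != 0 :> R by rewrite pnatr_eq0 -lt0n bin_gt0.
by field; rewrite !fact0 bin0.
Qed.

(** Terms with m < s vanish, and (m ^_ s) / m! = 1 / (m - s)! turns the others into the exponential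
    series of r. This is what mixing multinomial laws over a Poisson(1) sample size requires. *)
Lemma cvg_poisson_mixture s (r : R) :
  \sum_(m < s + n) expR (- 1) / m`!%:R * ((m ^_ s)%:R * r ^+ (m - s)) @[n --> \oo]
    --> expR (r - 1).
Proof.
rewrite addrC expRD.
have -> : (fun n => \sum_(m < s + n) expR (- 1) / m`!%:R * ((m ^_ s)%:R * r ^+ (m - s))) =
    (fun n => expR (- 1) * series (exp_coeff r) n).
  apply/funext => n; rewrite big_split_ord/= big1 ?add0r => [|i _]; last first.
    by rewrite ffact_small// mul0r mulr0.
  rewrite /series/= mulr_sumr big_mkord; apply: eq_bigr => i _.
  rewrite /exp_coeff/= addKn -mulrA; congr (_ * _).
  have := @ffact_fact (s + i) s (leq_addr _ _); rewrite addKn => <-; rewrite natrM.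
  have fact0 : i`!%:R != 0 :> R by rewrite pnatr_eq0 -lt0n fact_gt0.
  have ffact0 : ((s + i) ^_ s)%:R != 0 :> R by rewrite pnatr_eq0 -lt0n ffact_gt0 leq_addr.
  by field; rewrite fact0 ffact0.
apply: cvgM; first exact: cvg_cst.
exact: is_cvg_series_exp_coeff.
Qed.

(** Inversion of the distribution function: N takes the value m between consecutive partial sums
    [s m] and [s m.+1] of the Poisson weights. *)
Lemma prob01_poisson1 : exists N : measurableTypeR R -> nat, forall m,
  measurable [set u | N u = m] /\
  prob01 [set u | N u = m] = (expR (- 1) / m`!%:R : R)%:E.
Proof.
pose p m : R := expR (- 1) / m`!%:R.
have p0 m : 0 < p m by rewrite divr_gt0 ?expR_gt0// ltr0n fact_gt0.
pose s n := \sum_(m < n) p m.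
have sS n : s n.+1 = s n + p n by rewrite /s big_ord_recr.
(* The Poisson weights have total mass one: this is the mixture limit with s = 0 and r = 1. *)
have s1 : s n @[n --> \oo] --> (1 : R).
  have := @cvg_poisson_mixture 0 1; rewrite subrr expR0.
  rewrite [X in X n @[n --> _] --> _ -> _](_ : _ = s)//.
  apply/funext => n; apply: eq_bigr => m _.
  by rewrite ffactn0 expr1n !mulr1.
have s_nd : {homo s : n m / (n <= m)%N >-> n <= m}.
  move=> n m /subnK <-; elim: (m - n)%N => // k; rewrite addSn sS => /le_trans; apply.
  by rewrite lerDl ltW.
have s_ge0 n : 0 <= s n by apply: sumr_ge0 => i _; exact: ltW.
have s_le1 n : s n <= 1.
  by rewrite -(cvg_lim _ s1)//; apply: nondecreasing_cvgn_le => //; exact: cvgP s1.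
have sP u : 0 <= u < 1 -> exists m, s m <= u < s m.+1.
  move=> /andP[u0 u1].
  have [n un] : exists n, u < s n.
    by have [n _ /(_ n (leqnn n))] := cvgr_gt _ s1 _ u1; exists n.
  elim: n un => [|n IH] un; first by move: un; rewrite /s big_ord0 ltNge u0.
  have [/IH //|nu] := ltP u (s n); by exists n; rewrite nu.
have suniq u m m' : s m <= u < s m.+1 -> s m' <= u < s m'.+1 -> m = m'.
  wlog mm' : m m' / (m <= m')%N.
    move=> H h1 h2; have [mm'|mm'] := leqP m m'; first exact: H.
    by apply/esym; apply: H => //; exact: ltnW.
  move=> /andP[_ um] /andP[m'u _]; apply/eqP; rewrite eqn_leq mm' leqNgt; apply/negP => lt.
  by have := s_nd _ _ lt; lra.
(* N is set to 0 off [0, 1[. That set is null, but it enters the measurability of the event N =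
   0. *)
have sP' (u : R) : exists m, if 0 <= u < 1 then is_true (s m <= u < s m.+1) else m = 0%N.
  by case u01 : (0 <= u < 1); [exact: sP|exists 0%N].
have [N NP] := boolp.choice sP'.
have NE m u : 0 <= u < 1 -> (N u = m <-> s m <= u < s m.+1).
  move=> u01; have := NP u; rewrite u01 => Nu; split => [<-//|mu].
  exact: suniq mu.
have smI m : `[s m, s m.+1[%classic `<=` [set u : R | 0 <= u < 1].
  move=> u; rewrite /= in_itv/= => /andP[mu um].
  by rewrite (le_trans (s_ge0 m) mu)/= (lt_le_trans um (s_le1 _)).
have E m : [set u | N u = m] `&` `[0, 1[%classic = `[s m, s m.+1[%classic.
  apply/seteqP; split => u /=; rewrite !in_itv/=; first by move=> [Nu u01]; apply/NE.
  by move=> mu; have u01 := smI m u; rewrite /= in_itv/= in u01; split; [apply/NE|]; try exact: u01.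
exists N => m; split; last first.
  rewrite prob01E E lebesgue_measure_itv/= lte_fin sS ltrDl p0.
  by rewrite -EFinB addrAC subrr add0r.
have -> : [set u | N u = m] = `[s m, s m.+1[%classic `|`
    (if m == 0%N then ~` `[0, 1[%classic else set0).
  rewrite -E; apply/seteqP; split => u /=.
    move=> Nu; have := NP u; case: ifP => u01 ; first by left; rewrite in_itv.
    by move=> N0; right; rewrite -Nu N0 eqxx /= in_itv/= u01.
  move=> [[]//|]; case: eqP => // -> /=; rewrite in_itv/= => /negP/negbTE u01.
  by have := NP u; rewrite u01.
by apply: measurableU => //; case: ifP => // _; exact: measurableC.
Qed.

End poisson_pmf.

Section poisson_cells.
Context d (T : measurableType d) (R : realType) (P : probability T R).
Context (g1 g2 : T -> T) (N : T -> nat).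
Hypothesis (mg1 : measurable_fun setT g1) (mg2 : measurable_fun setT g2).
Hypothesis g_indep : forall A B, measurable A -> measurable B ->
  P (g1 @^-1` A `&` g2 @^-1` B) = (P A * P B)%E.
Hypothesis mN : forall m, measurable [set u | N u = m].
Hypothesis PN : forall m, P [set u | N u = m] = (expR (- 1) / m`!%:R)%:E.

(** The number of points is read from [g1 w] and their positions from [g2 w], so the two are
    independent. *)
Definition cell_count (A : set T) (w : T) : nat := sample_count g1 g2 (N (g1 w)) A (g2 w).

(** Sorting a Poisson number of independent points into disjoint sets gives independent Poisson
    counts: the multinomial law is mixed over the number of points. *)
Lemma cell_count_law n (A : 'I_n -> set T) (k : 'I_n -> nat) :
  (forall j, measurable (A j)) -> (forall i j, i != j -> A i `&` A j = set0) ->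
  measurable [set w | forall j, cell_count (A j) w = k j] /\
  P [set w | forall j, cell_count (A j) w = k j] =
    (\prod_j poisson_pmf' (fine (P (A j))) (k j))%:E.
Proof.
move=> mA Ad.
pose F m := g1 @^-1` [set u | N u = m] `&`
  g2 @^-1` [set w | forall j, sample_count g1 g2 m (A j) w = k j].
have slaw := sample_count_law mg1 mg2 g_indep mA Ad.
have mF m : measurable (F m).
  apply: measurableI; apply: measurable_fun_preimage => //.
  exact: (slaw m k).1.
have FE : [set w | forall j, cell_count (A j) w = k j] = \bigcup_m F m.
  apply/seteqP; split => w /=; first by move=> H; exists (N (g1 w)).
  by move=> [m _ [/= <- H]].
have mE : measurable [set w | forall j, cell_count (A j) w = k j].
  by rewrite FE; exact: bigcupT_measurable.
split => //.
pose s := (\sum_j k j)%N.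
pose r := fine (P (~` \bigcup_j A j)).
pose W := \prod_j (fine (P (A j)) ^+ k j / (k j)`!%:R).
pose B n := [set w | exists2 m : 'I_(s + n), xpredT m & F m w].
have PB q : P (B q) = ((\sum_(m < s + q) expR (- 1) / m`!%:R * ((m ^_ s)%:R * r ^+ (m - s))) * W)%:E.
  rewrite /B (probability_fibers _ (F := fun m : 'I_(s + q) => F m))//; last first.
    by move=> i j w _ _ [/= Ni _] [/= Nj _]; apply/val_inj; rewrite /= -Ni -Nj.
  rewrite mulr_suml -sumEFin; apply: eq_bigr => m _.
  rewrite g_indep//; last exact: (slaw m k).1.
  by rewrite (slaw m k).2 PN -EFinM !mulrA.
have mB q : measurable (B q).
  rewrite (_ : B q = \bigcup_(m in [set m : 'I_(s + q) | true]) F m).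
    by apply: countType_bigcup_measurable => m _.
  by apply/seteqP; split => w [m _ Fm]; exists m.
have cB : P (B q) @[q --> \oo] --> P [set w | forall j, cell_count (A j) w = k j].
  rewrite FE; apply: probability_cvg => //; first exact: bigcupT_measurable.
  move=> w; exists (N (g1 w)).+1 => // q /= Nq; split; first by move=> [m _ Fm]; exists (val m).
  move=> [m _ Fm]; have mN' : (m < s + q)%N.
    by case: Fm => /= <- _; apply: leq_trans Nq _; rewrite leq_addl.
  by exists (Ordinal mN').
have cB' : P (B q) @[q --> \oo] --> (expR (r - 1) * W)%:E.
  under eq_fun do rewrite PB.
  apply: cvg_EFin; first by near=> q.
  apply: cvgM; last exact: cvg_cst.
  exact: cvg_poisson_mixture.
rewrite (cvg_unique _ cB cB')//; congr EFin.
(* Since r is one minus the sum of the P(A j), exp(r - 1) is the product of the factors exp(- P(A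
   j)). *)
rewrite /r probability_rest// /W addrAC subrr add0r.
rewrite /poisson_pmf' [LHS]mulrC [RHS]big_split/=; congr (_ * _).
by rewrite -sumrN expR_sum.
Unshelve. all: by end_near. Qed.

Definition super_count (K : nat) (A : nat -> set T) (w : T) : nat :=
  \sum_(i < K) cell_count (A i) (g1 (iter i g2 w)).

Lemma super_countS K A w : super_count K.+1 A w =
  (cell_count (A 0%N) (g1 w) + super_count K (fun i => A i.+1) (g2 w))%N.
Proof.
rewrite /super_count big_ord_recl/=; congr addn.
by apply: eq_bigr => i _; rewrite -iterSr.
Qed.

Lemma poisson_pmf'0 (k : nat) : poisson_pmf' (0 : R) k = (k == 0%N)%:R.
Proof.
by case: k => [|k]; rewrite /poisson_pmf' oppr0 expR0 ?expr0 ?fact0 ?divr1 ?mulr1// exprS !mul0r.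
Qed.

(** Cell 0 is independent of the remaining ones, so the law of the total count is a convolution in
    every coordinate; the sum over all ways of splitting the counts factors into a product of
    convolutions. *)
Lemma super_count_law n K (A : nat -> 'I_n -> set T) (k : 'I_n -> nat) :
  (forall i j, measurable (A i j)) ->
  (forall q i j, i != j -> A q i `&` A q j = set0) ->
  measurable [set w | forall j, super_count K (A ^~ j) w = k j] /\
  P [set w | forall j, super_count K (A ^~ j) w = k j] =
    (\prod_j poisson_pmf' (\sum_(i < K) fine (P (A i j))) (k j))%:E.
Proof.
elim: K A k => [|K IH] A k mA Ad.
  under [\prod_j _]eq_bigr do rewrite big_ord0 poisson_pmf'0.
  have [k0|k0] := pselect (forall j, k j = 0%N).
    rewrite (_ : mkset _ = setT).
      by rewrite probability_setT big1// => j _; rewrite k0.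
    by apply/seteqP; split => // w _ j; rewrite /super_count big_ord0 k0.
  rewrite (_ : mkset _ = set0); last first.
    by apply/seteqP; split => // w /= H; apply: k0 => j; rewrite -H /super_count big_ord0.
  split => //; rewrite measure0.
  have /existsNP[j /eqP kj] := k0.
  by rewrite (bigD1 j)//= (negbTE kj) mul0r.
(* A common strict bound on the [k j], so that the possible shares of cell 0 form a finite type. *)
pose M := (\sum_j k j).+1.
have kM j : (k j < M)%N by rewrite ltnS /M (bigD1 j)//= leq_addr.
pose Q (f : {ffun 'I_n -> 'I_M}) := f \in family (fun j => [pred a : 'I_M | (a <= k j)%N]).
pose F (f : {ffun 'I_n -> 'I_M}) :=
  g1 @^-1` [set w | forall j, cell_count (A 0%N j) w = f j] `&`
  g2 @^-1` [set w | forall j, super_count K (fun i => A i.+1 j) w = (k j - f j)%N].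
have claw f := @cell_count_law n (A 0%N) (fun j => nat_of_ord (f j : 'I_M)) (mA 0%N) (Ad 0%N).
have slaw f := IH (fun i => A i.+1) f (fun i => mA i.+1) (fun i => Ad i.+1).
have mF f : measurable (F f).
  apply: measurableI; apply: measurable_fun_preimage => //.
  - exact: (claw f).1.
  - exact: (slaw (fun j => (k j - f j)%N)).1.
have FE : [set w | forall j, super_count K.+1 (A ^~ j) w = k j] =
    [set w | exists2 f, Q f & F f w].
  apply/seteqP; split => w /=.
    move=> H.
    have le j : (cell_count (A 0%N j) (g1 w) <= k j)%N.
      by rewrite -H super_countS leq_addr.
    exists [ffun j => inord (cell_count (A 0%N j) (g1 w))].
      by apply/familyP => j; rewrite ffunE inE inordK// (leq_ltn_trans (le j)).
    split => j /=; rewrite ffunE inordK ?(leq_ltn_trans (le j))//.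
    by rewrite -H super_countS addKn.
  move=> [f /familyP Qf [/= Hf Hs]] j; rewrite super_countS Hf Hs subnKC//.
  by have := Qf j; rewrite inE.
rewrite FE; split.
  rewrite (_ : mkset _ = \bigcup_(f in [set f | Q f]) F f).
    by apply: countType_bigcup_measurable => f _.
  by apply/seteqP; split => w [f Qf Ff]; exists f.
rewrite probability_fibers//; last first.
  move=> f f' w _ _ [/= Hf _] [/= Hf' _]; apply/ffunP => j; apply/val_inj.
  by rewrite /= -Hf -Hf'.
transitivity (\sum_(f | Q f) (\prod_j (poisson_pmf' (fine (P (A 0%N j))) (f j) *
   poisson_pmf' (\sum_(i < K) fine (P (A i.+1 j))) (k j - f j)%N))%:E)%E.
  apply: eq_bigr => f _; rewrite g_indep.
  - by rewrite (claw f).2 (slaw (fun j => (k j - f j)%N)).2 -EFinM; congr EFin; rewrite [RHS]big_split.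
  - exact: (claw f).1.
  - exact: (slaw (fun j => (k j - f j)%N)).1.
rewrite sumEFin; congr EFin; rewrite /Q -(bigA_distr_big_dep
  (fun j => [pred a : 'I_M | (a <= k j)%N])
  (fun j (a : 'I_M) => poisson_pmf' (fine (P (A 0%N j))) a *
   poisson_pmf' (\sum_(i < K) fine (P (A i.+1 j))) (k j - a)%N)).
apply: eq_bigr => j _; rewrite big_ord_recl.
exact: (poisson_pmf_conv _ _ (kM j)).
Qed.

End poisson_cells.

(** Membership is eventually decided at each point, so B is the lower limit of the sequence. Paired
    with [probability_cvg], this gives both measurability and probability of the limit events
    below. *)
Lemma measurable_near d (T : measurableType d) (A : (set T)^nat) (B : set T) :
  (forall n, measurable (A n)) ->
  (forall w, \forall n \near \oo, A n w <-> B w) -> measurable B.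
Proof.
move=> mA AB; rewrite (_ : B = \bigcup_n \bigcap_(k in [set k | (n <= k)%N]) A k).
  by apply: bigcupT_measurable => n; apply: bigcap_measurableType => k _.
apply/seteqP; split => w.
  by move=> Bw; have [n _ nA] := AB w; exists n => // k /= nk; apply/(nA k nk).
move=> [n _ nA]; have [m _ mB] := AB w.
apply/(mB (maxn n m)); first by rewrite /= leq_maxr.
by apply: nA; rewrite /= leq_maxl.
Qed.

(** Either the sequence passes k, and then L is at least k + 1 and possibly infinite, or it is
    bounded, hence eventually constant and equal to L. *)
Lemma cvg_nat_near (R : realType) (s : nat -> nat) (L : \bar R) (k : nat) :
  {homo s : n m / (n <= m)%N} -> (s n)%:R%:E @[n --> \oo] --> L ->
  \forall n \near \oo, s n = k <-> L = k%:R%:E.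
Proof.
move=> s_nd sL; have [[n0 kn0]|sk] := pselect (exists n, (k < s n)%N).
  have kL : (k.+1%:R%:E <= L)%E.
    rewrite -(cvg_lim _ sL)//; apply: lime_ge; first exact: cvgP sL.
    exists n0 => // n /= n0n; rewrite lee_fin ler_nat.
    exact: leq_trans kn0 (s_nd _ _ n0n).
  exists n0 => // n /= n0n; split.
    by have := s_nd _ _ n0n; lia.
  by move=> Lk; move: kL; rewrite Lk lee_fin ler_nat ltnn.
have {}sk n : (s n <= k)%N by rewrite leqNgt; apply/negP => kn; apply: sk; exists n.
have [n0 n0P] : exists n0, forall n, (s n <= s n0)%N.
  have ex : exists m, `[< exists n, s n = m >] by exists (s 0%N); apply/asboolP; exists 0%N.
  have ub m : `[< exists n, s n = m >] -> (m <= k)%N by move/asboolP => [n <-].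
  case: (ex_maxnP ex ub) => m /asboolP[n0 <-] max; exists n0 => n.
  by apply: max; apply/asboolP; exists n.
have sn0 n : (n0 <= n)%N -> s n = s n0.
  by move=> n0n; apply/eqP; rewrite eqn_leq n0P s_nd.
have -> : L = (s n0)%:R%:E.
  apply: (cvg_unique _ sL) => //; apply: cvg_near_cst.
  by exists n0 => // n /= /sn0 ->.
exists n0 => // n /= /sn0 ->; split => [->//|[/eqP]]; rewrite eqr_nat => /eqP //.
Qed.

Lemma Fsigma_sub (E : topologicalType) (C : set (set E)) :
  Fsigma C -> C `<=` (@Fprime E).
Proof.
apply: (@smallest_sub _ _ _ [set C | C `<=` Fprime]).
  split => [|A _|A Asub]; [exact: sub0set|exact: subDsetl|].
  by apply: bigcup_sub => i _; exact: Asub.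
by move=> _ [K _ <-] F [].
Qed.

Lemma ProdSigma_Dom (R : realType) (E : topologicalType) (B : set (R * set E)) :
  ProdSigma B -> B `<=` Dom.
Proof.
apply: (@smallest_sub _ _ _ [set B | B `<=` Dom]).
  split => [|A _|A Asub]; [exact: sub0set|exact: subDsetl|].
  by apply: bigcup_sub => i _; exact: Asub.
move=> _ [I [C [_ I0 /Fsigma_sub CF ->]]] p [/= Ip Cp].
by split; [exact: I0|exact: CF].
Qed.

Lemma cvg_poisson_pmf (R : realType) (u : R^nat) (m : R) k :
  u n @[n --> \oo] --> m ->
  poisson_pmf' (u n) k @[n --> \oo] --> poisson_pmf' m k.
Proof.
move=> um; apply: cvgM; last first.
  exact: (cvg_comp _ _ (cvgN um) (@continuous_expR R (- m))).
apply: cvgM; last exact: cvg_cst.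
exact: (cvg_comp _ _ um (@exprn_continuous R k m)).
Qed.

(** * Superposition of countably many cells *)

Section poisson_process_existence.
Context {R : realType} {E : topologicalType}.
Local Notation T := (measurableTypeR R).
Local Notation P := (@prob01 R).
Context (mu : set (R * set E) -> \bar R) (phi : nat -> T -> R * set E).
Hypothesis mphi : forall i B, ProdSigma B -> measurable (phi i @^-1` B).
Hypothesis muE : forall B, ProdSigma B ->
  mu B = (\sum_(0 <= i <oo) P (phi i @^-1` B))%E.

(** The counts of the first K cells increase to the count of the whole process, so an event on
    finitely many counts is decided once K is large. Its probability is the limit of Poisson
    probabilities whose parameters are the partial sums of [mu]. *)
Lemma poisson_process_exists :
  exists pts : T -> nat -> option (R * set E), poisson_process P pts mu.
Proof.
have [g1 [g2 [mg1 mg2 g_indep]]] := @prob01_pairing R.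
have [N NP] := @prob01_poisson1 R.
have mN m := (NP m).1; have PN m := (NP m).2.
(* Cell i carries a Poisson(1) number of points with the law of [phi i];
   those falling outside [Dom] are discarded. *)
pose cell i w := g1 (iter i g2 w).
pose point i a w := phi i (g1 (iter a g2 (g2 (cell i w)))).
pose pts (w : T) (n : nat) : option (R * set E) :=
  if @pickle_inv (nat * nat)%type n is Some (i, a) then
    if (a < N (g1 (cell i w)))%N && `[< Dom (point i a w) >] then Some (point i a w)
    else None
  else None.
pose S B K w := super_count g1 g2 N K (fun i => phi i @^-1` B) w.
have S_nd B w : {homo (fun K => S B K w) : n m / (n <= m)%N}.
  move=> n m nm; rewrite /S /super_count (big_ord_widen m (fun i =>
    cell_count g1 g2 N (phi i @^-1` B) (g1 (iter i g2 w))) nm).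
  by rewrite big_mkcond/=; apply: leq_sum => i _; case: ifP.
have countE w B : ProdSigma B ->
    Defs.count (pts w) B = (\sum_(0 <= i <oo) (cell_count g1 g2 N (phi i @^-1` B) (cell i w))%:R%:E)%E.
  (* Discarding the points outside [Dom] does not change this count, as B is contained in [Dom]. *)
  move=> /ProdSigma_Dom BD.
  pose b (i a : nat) : \bar R := if (a < N (g1 (cell i w)))%N then (\1_B (point i a w) : R)%:E else 0%E.
  have b0 i a : (0 <= b i a)%E by rewrite /b; case: ifP; rewrite ?lee_fin.
  pose f n : \bar R := if @pickle_inv (nat * nat)%type n is Some (i, a) then b i a else 0%E.
  have f0 n : (0 <= f n)%E by rewrite /f; case: pickle_inv => // -[].
  transitivity (\sum_(0 <= n <oo) f n)%E.
    apply: eq_eseriesr => n _; rewrite /pts /f; case: pickle_inv => // -[i a].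
    rewrite /b; case: (a < _)%N => //=; case: asboolP => // nD.
    by rewrite indicE memNset// => /BD.
  rewrite nneseries_esumT// [RHS]nneseries_esumT//.
  transitivity (\esum_(n in range (pickle : nat * nat -> nat)) f n)%E.
    rewrite [RHS]esum_mkcond; apply: eq_esum => n _; case: ifPn => //.
    rewrite notin_setE => nr; rewrite /f; case En : pickle_inv => [[i a]|//].
    by case: nr; exists (i, a) => //; have := @pickle_invK (nat * nat)%type n; rewrite En.
  rewrite esum_image; last by move=> p q _ _; exact: (pcan_inj pickleK).
  transitivity (\esum_(k in setT `*`` (fun=> setT)) b k.1 k.2)%E.
    rewrite (_ : _ `*`` _ = setT); last exact/seteqP.
    by apply: eq_esum => -[i a] _; rewrite /f pickleK_inv.
  rewrite -(esum_esum (fun i j _ _ => b0 i j)); apply: eq_esum => i _.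
  transitivity (\esum_(a in `I_(N (g1 (cell i w)))) (\1_B (point i a w) : R)%:E)%E.
    rewrite [RHS]esum_mkcond; apply: eq_esum => a _; rewrite /b.
    by case: ifPn => aN; [rewrite mem_set|rewrite memNset//; apply/negP].
  rewrite esum_fset ?finite_II//.
  rewrite -fsbig_ord sumEFin /cell_count /sample_count natr_sum; congr EFin.
have S_cvg w B : ProdSigma B -> (S B K w)%:R%:E @[K --> \oo] --> Defs.count (pts w) B.
  move=> pB; rewrite countE//.
  have H : cvgn (fun n => \sum_(0 <= i < n) (cell_count g1 g2 N (phi i @^-1` B) (cell i w))%:R%:E : \bar R)%E.
    by apply: is_cvg_nneseries => n _ _; rewrite lee_fin ler0n.
  apply: cvg_trans H; apply: near_eq_cvg; apply: nearW => K.
  by rewrite /S /super_count natr_sum big_mkord sumEFin.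
have near_count n (B : 'I_n -> set (R * set E)) (k : 'I_n -> nat) w :
    (forall j, ProdSigma (B j)) ->
    \forall K \near \oo, (forall j, S (B j) K w = k j) <->
      (forall j, Defs.count (pts w) (B j) = (k j)%:R%:E).
  move=> pB.
  have : \forall K \near \oo, forall j, S (B j) K w = k j <-> Defs.count (pts w) (B j) = (k j)%:R%:E.
    by apply: filter_forall => j; apply: cvg_nat_near; [exact: S_nd|exact: S_cvg].
  by apply: filterS => K H; split => H' j; apply/H.
have Slaw n (B : 'I_n -> set (R * set E)) (k : 'I_n -> nat) K :
    (forall j, ProdSigma (B j)) -> (forall i j, i != j -> B i `&` B j = set0) ->
    measurable [set w | forall j, S (B j) K w = k j] /\
    P [set w | forall j, S (B j) K w = k j] =
      (\prod_j poisson_pmf' (\sum_(i < K) fine (P (phi i @^-1` B j))) (k j))%:E.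
  move=> pB Bd.
  apply: (super_count_law mg1 mg2 g_indep mN PN K (A := fun i j => phi i @^-1` B j)).
    by move=> i j; exact: mphi.
  by move=> q i j ij; rewrite -preimage_setI Bd// preimage_set0.
exists pts; split.
- move=> w i p; rewrite /pts; case: pickle_inv => // -[j a].
  by case: ifP => // /andP[_ /asboolP D] [<-].
- move=> B k pB muB.
  have Bd (i j : 'I_1) : i != j -> B `&` B = set0 by rewrite !ord1.
  have := @measurable_near _ T (fun K => [set w | forall j : 'I_1, S B K w = k])
    [set w | forall j : 'I_1, Defs.count (pts w) B = k%:R%:E].
  rewrite (_ : [set w | 'I_1 -> Defs.count _ _ = _] = [set w | Defs.count (pts w) B = k%:R%:E]).
    apply => [K|w]; first exact: (@Slaw 1%N (fun=> B) (fun=> k) K (fun=> pB) Bd).1.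
    have := @near_count 1%N (fun=> B) (fun=> k) w (fun=> pB).
    apply: filterS => K H /=; split; last by move=> h; apply/H.
    by move=> h; have /H : forall j : 'I_1, S B K w = k by []; move=> /(_ ord0).
  by apply/seteqP; split => w /= => [/(_ ord0)|].
- move=> n B k pB muB Bd.
  rewrite (_ : \bigcap_j _ = [set w | forall j, Defs.count (pts w) (B j) = (k j)%:R%:E]); last first.
    by apply/seteqP; split => w /= H j; [exact: H|move=> _; exact: H].
  have mA K := (Slaw n B k K pB Bd).1.
  have nc w := near_count n B k w pB.
  have c1 := @probability_cvg _ T R P _ _ mA (measurable_near mA nc) nc.
  have c2 : P [set w | forall j, S (B j) K w = k j] @[K --> \oo] -->
      (\prod_(j < n) poisson_pmf' (fine (mu (B j))) (k j))%:E.
    under eq_fun do rewrite (Slaw n B k _ pB Bd).2.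
    apply: cvg_EFin; first by apply: nearW => K.
    apply: cvg_big => [|j _]; first by move=> x; exact: mul_continuous.
    apply: cvg_poisson_pmf.
    (* Finiteness of mu(B) turns the convergence of partial sums in the extended reals into one of
       real parameters. *)
    have pc : (\sum_(0 <= i < K) P (phi i @^-1` B j))%E @[K --> \oo] --> (fine (mu (B j)))%:E.
      rewrite fineK; last by rewrite ge0_fin_numE ?muB// muE// nneseries_ge0// => i _; exact: measure_ge0.
      rewrite muE//; apply: (@is_cvg_nneseries _ (fun i => P (phi i @^-1` B j)) xpredT 0%N) => i _ _; exact: measure_ge0.
    rewrite (_ : (fun K : nat => _) =
        fine \o (fun n => \sum_(0 <= i < n) P (phi i @^-1` B j))%E).
      exact: fine_cvg pc.
    apply/funext => K /=.
    rewrite big_mkord (eq_bigr (fun i : 'I_K => (fine (P (phi i @^-1` B j)))%:E)).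
      by rewrite sumEFin.
    by move=> i _; rewrite fin_probability//; exact: mphi.
  exact: (cvg_unique _ c1 c2).
Qed.

End poisson_process_existence.

(** * Sup-measures on locally compact spaces *)

Section lcsc.
Context {E : topologicalType}.
Hypotheses (hE : hausdorff_space E) (lcE : locally_compact [set: E])
  (scE : @second_countable E).

(** Inside a compact neighbourhood, regularity yields a member of the base whose closure is compact
    and fits in the given neighbourhood. Keeping only members with compact closure thus still gives
    a base; indices coding no such member get the empty set. *)
Lemma relatively_compact_basis : exists B : nat -> set E,
  [/\ forall n, open (B n), forall n, compact (closure (B n)) &
   forall x U, nbhs x U -> exists n, B n x /\ closure (B n) `<=` U].
Proof.
have [BB /countable_injP[f f_inj] [BBo BBx]] := scE.
pose ok U := BB U /\ compact (closure U).
have ex n : exists U, (ok U /\ f U = n) \/ (~ (exists V, ok V /\ f V = n) /\ U = set0).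
  have [[V [okV fV]]|nV] := pselect (exists V, ok V /\ f V = n); first by exists V; left.
  by exists set0; right.
have [B BP] := boolp.choice ex.
exists B; split.
- by move=> n; case: (BP n) => [[[/BBo + _] _]|[_ ->]] //; exact: open0.
- by move=> n; case: (BP n) => [[[_ +] _]|[_ ->]] //; rewrite closure0; exact: compact0.
- move=> x U Ux.
  have [V] := @lcE x Logic.I; rewrite withinET => Vx [cV clV].
  have Wx : nbhs x (U `&` V) by exact: filterI.
  have [W Wx' WU] := compact_regular hE cV Vx Wx.
  have [Z [BO Ox] OW] := BBx x W Wx'.
  have clO : closure Z `<=` U `&` V by apply: subset_trans WU; exact: closure_subset.
  have okO : ok Z.
    split => //; apply: subclosed_compact cV _; first exact: closed_closure.
    by move=> y /clO[].
  exists (f Z); case: (BP (f Z)) => [[[BBf _] fE]|[nV _]]; last by case: nV; exists Z.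
  have -> : B (f Z) = Z by apply: f_inj; rewrite ?inE.
  by split => // y /clO[].
Qed.

Context (B : nat -> set E).
Hypotheses (Bo : forall n, open (B n)) (Bc : forall n, compact (closure (B n)))
  (Bb : forall x U, nbhs x U -> exists n, B n x /\ closure (B n) `<=` U).

Definition basis_open (I : seq nat) := \bigcup_(i in [set` I]) B i.
Definition basis_closed (I : seq nat) := \bigcup_(i in [set` I]) closure (B i).

Lemma basis_open_closed I : basis_open I `<=` basis_closed I.
Proof. by move=> x [i Ii Bx]; exists i => //; exact: subset_closure. Qed.

Lemma open_basis_open I : open (basis_open I).
Proof. by apply: bigcup_open => i _; exact: Bo. Qed.

Lemma compact_basis_closed I : compact (basis_closed I).
Proof. by rewrite /basis_closed bigcup_seq; apply: bigsetU_compact => i _; exact: Bc. Qed.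

Lemma compact_basis_subcover K (D : set nat) : compact K ->
  (forall x, K x -> exists i, D i /\ B i x) ->
  exists I : seq nat, (forall i, i \in I -> D i) /\ K `<=` basis_open I.
Proof.
move=> cK KD; have /compact_near_coveringP nK := cK.
(* Finite lists of indices, directed by inclusion: compactness in its near-covering form then yields
   a single list that works for all points of K. *)
pose F := filter_from [set: seq nat] (fun I => [set J : seq nat | {subset I <= J}]).
have FF : Filter F.
  apply: filter_from_filter; first by exists [::].
  by move=> I J _ _; exists (I ++ J) => // L LIJ; split => i iI;
    apply: LIJ; rewrite mem_cat iI ?orbT.
pose Q (I : seq nat) x := exists i, [/\ i \in I, B i x & D i].
have [x Kx|I _ IP] := nK _ F Q FF.
  have [n [Dn Bx]] := KD x Kx.
  exists (B n, [set J : seq nat | {subset [:: n] <= J}]).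
    split => /=; first exact: (open_nbhs_nbhs (conj (Bo n) Bx)).
    by exists [:: n].
  by move=> [y J] /= [By nJ]; exists n; split => //; apply: nJ; rewrite inE.
have IK : K `<=` Q I by apply: IP => i.
exists [seq i <- I | `[< D i >]]; split.
  by move=> i; rewrite mem_filter => /andP[/asboolP].
move=> x /IK[i [iI Bx Di]]; exists i => //=.
by rewrite mem_filter iI andbT; exact/asboolP.
Qed.

Lemma basis_interpolation K U : compact K -> open U -> K `<=` U ->
  exists I, K `<=` basis_open I /\ basis_closed I `<=` U.
Proof.
move=> cK oU KU.
have [x Kx|I [ID KI]] := @compact_basis_subcover K [set n | closure (B n) `<=` U] cK.
  by have [n [Bx BU]] := Bb (open_nbhs_nbhs (conj oU (KU x Kx))); exists n.
by exists I; split => // x [i /= /ID BU /BU].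
Qed.

Lemma compact_outer_seq K : compact K -> exists C G : nat -> set E,
  [/\ forall n, compact (C n), forall n m, (n <= m)%N -> C m `<=` C n,
      \bigcap_n C n = K & forall n, [/\ open (G n), K `<=` G n & G n `<=` C n]].
Proof.
move=> cK; have [I0 [KI0 _]] := basis_interpolation cK openT (@subsetT _ _).
(* J enumerates all finite basic unions covering K, with [I0] as default. Finite intersections along
   this enumeration decrease to K, because any point outside K is avoided by some closed basic
   cover. *)
pose J m := if (unpickle m : option (seq nat)) is Some L then if `[< K `<=` basis_open L >] then L else I0 else I0.
have JK m : K `<=` basis_open (J m).
  by rewrite /J; case: unpickle => // I; case: asboolP.
pose C n := \bigcap_(m in [set m | (m <= n)%N]) basis_closed (J m).
pose G n := \bigcap_(m in [set m | (m <= n)%N]) basis_open (J m).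
have KG n : K `<=` G n by move=> x Kx m _; exact: JK.
have GC n : G n `<=` C n by move=> x Gx m mn; apply: basis_open_closed; exact: Gx.
exists C, G; split.
- move=> n; apply: (@subclosed_compact _ (C n) (basis_closed (J 0%N))).
  + by apply: closed_bigI => m _; apply: compact_closed => //; exact: compact_basis_closed.
  + exact: compact_basis_closed.
  + by move=> x; apply.
- by move=> n m nm x Cx k /= kn; apply: Cx => /=; exact: leq_trans nm.
- apply/seteqP; split => x; last by move=> Kx n _; apply: GC; exact: KG.
  move=> Cx; apply: contrapT => nKx.
  have [||I [KI IU]] := @basis_interpolation K (~` [set x]) cK.
  + by apply: closed_openC; apply: compact_closed => //; exact: compact_set1.
  + by move=> y Ky /= yx; apply: nKx; rewrite -yx.
  have := Cx (pickle I) Logic.I (pickle I) (leqnn _).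
  rewrite /J pickleK; case: asboolP => // _ /IU; exact.
- move=> n; split => //; rewrite /G.
  rewrite (_ : \bigcap_(m in _) _ = \bigcap_(m in `I_n.+1) basis_open (J m))//.
  rewrite bigcap_mkord; elim/big_ind : _ => //; first exact: openT.
    by move=> ? ?; exact: openI.
  by move=> i _; exact: open_basis_open.
Qed.

End lcsc.

Section sup_measures.
Context {R : realType} {E : topologicalType}.
Hypotheses (hE : hausdorff_space E) (lcE : locally_compact [set: E])
  (scE : @second_countable E).
Context (phi : set E -> \bar R) (supphi : sup_measure phi).
Local Open Scope ereal_scope.

Lemma sup_measure_mono A B : A `<=` B -> phi A <= phi B.
Proof. by case: supphi => H _ _ _ _; exact: H. Qed.

Lemma sup_measure0 : phi set0 = 0.
Proof. by case: supphi. Qed.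

Lemma sup_measure_ge0 A : 0 <= phi A.
Proof. by rewrite -sup_measure0; exact: sup_measure_mono. Qed.

Lemma sup_measure_cvg (K : (set E)^nat) : (forall n, compact (K n)) ->
  (forall n m, (n <= m)%N -> K m `<=` K n) ->
  phi (K n) @[n --> \oo] --> phi (\bigcap_n K n).
Proof. by case: supphi => _ _ _ H _; exact: H. Qed.

Lemma sup_measure_open K c : compact K -> phi K < c ->
  exists G, [/\ open G, K `<=` G & phi G < c].
Proof.
move=> cK Kc; have [B [Bo Bc Bb]] := relatively_compact_basis hE lcE scE.
have [C [G [cC Cnd CK GP]]] := compact_outer_seq hE Bo Bc Bb cK.
have [n Cc] : exists n, phi (C n) < c.
  apply: contrapT => nC; have Cc n : c <= phi (C n).
    by rewrite leNgt; apply/negP => Cc; apply: nC; exists n.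
  move: Kc; rewrite -CK ltNge => /negP; apply.
  have cv := sup_measure_cvg cC Cnd.
  rewrite -(cvg_lim _ cv)//; apply: lime_ge; first exact: cvgP cv.
  exact: nearW.
have [Go KG GC] := GP n.
by exists (G n); split => //; apply: le_lt_trans Cc; exact: sup_measure_mono.
Qed.

(** The supremum property is assumed for open sets only. It reaches compact sets by approximating
    them from outside with open sets on which phi is almost as small. *)
Lemma sup_measureU K L : compact K -> compact L ->
  phi (K `|` L) = maxe (phi K) (phi L).
Proof.
move=> cK cL; apply/eqP; rewrite eq_le; apply/andP; split; last first.
  by rewrite ge_max !sup_measure_mono.
rewrite leNgt; apply/negP; rewrite gt_max => /andP[Kc Lc].
have [G [Go KG Gc]] := sup_measure_open cK Kc.
have [H [Ho LH Hc]] := sup_measure_open cL Lc.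
have [_ _ _ _ [_ /(_ bool (fun b => if b then G else H))]] := supphi.
move=> /(_ (fun b => _)) phiU.
have : phi (K `|` L) <= maxe (phi G) (phi H).
  apply: (@le_trans _ _ (phi (\bigcup_(b in [set: bool]) if b then G else H))).
    by apply: sup_measure_mono => x [/KG Gx|/LH Hx]; [exists true|exists false].
  rewrite phiU; last by case.
  apply: ge_ereal_sup => _ [->|[b _ <-]] /=.
    by rewrite le_max sup_measure_ge0.
  by case: b; rewrite le_max lexx// orbT.
by rewrite leNgt gt_max Gc Hc.
Qed.

End sup_measures.

(** * Maxitive functionals and nested families *)

Section maxitive.
Context {R : realType} {E : topologicalType}.
Implicit Types (phi : set E -> \bar R) (K : nat -> set E) (v w : nat -> R) (t : R).

(** What sup-measures and the Poisson functional share, and all that the comparison of their laws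
    uses; the latter is never shown to be a sup-measure. *)
Definition maxitive phi :=
  [/\ forall A B, A `<=` B -> (phi A <= phi B)%E, phi set0 = 0%E &
      forall A B, compact A -> compact B -> phi (A `|` B) = maxe (phi A) (phi B)].

Lemma maxitive_ge0 phi A : maxitive phi -> (0 <= phi A)%E.
Proof. by move=> [m <- _]; exact: m. Qed.

Lemma maxitive_bigU phi (I : eqType) (r : seq I) (K : I -> set E) t c :
  maxitive phi -> (forall i, compact (K i)) -> 0 <= t -> 0 <= c ->
  (c%:E * phi (\big[setU/set0]_(i <- r) K i) <= t%:E)%E <->
  (forall i, i \in r -> (c%:E * phi (K i) <= t%:E)%E).
Proof.
move=> [m p0 pU] cK t0 c0; elim: r => [|i r IH].
  by rewrite big_nil p0 mule0 lee_fin.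
rewrite big_cons pU//; last exact: bigsetU_compact.
rewrite maxe_pMr ?lee_fin// ge_max; split.
  by move=> /andP[ci /IH cr] j; rewrite inE => /predU1P[->//|]; exact: cr.
move=> H; rewrite H ?mem_head//=; apply/IH => j jr.
by apply: H; rewrite inE jr orbT.
Qed.

(** Sort the weights in decreasing order and let [L i] be the union of the first i + 1 sets. Every
    set in that union has weight at least [u i], so the bounds on the single sets give the bound on
    the union by maxitivity; conversely each [K j] lies in the union formed at its own rank. *)
Lemma nested_reduction n (K : 'I_n -> set E) (v : 'I_n -> R) :
  (forall j, compact (K j)) -> (forall j, 0 <= v j) ->
  exists (L : nat -> set E) (u : nat -> R),
    [/\ forall i, compact (L i), forall i j, (i <= j)%N -> L i `<=` L j,
        forall i j, (i <= j)%N -> u j <= u i, u n = 0 &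
        forall phi, maxitive phi -> forall t, 0 <= t ->
          (forall j, ((v j)%:E * phi (K j) <= t%:E)%E) <->
          (forall i, (i < n)%N -> ((u i)%:E * phi (L i) <= t%:E)%E)].
Proof.
move=> cK v0.
pose r : rel 'I_n := fun i j => v j <= v i.
pose s := sort r (enum 'I_n).
have r_tr : transitive r by move=> j i k ij jk; exact: le_trans jk ij.
have r_tot : total r by move=> i j; rewrite /r le_total.
have s_sorted : sorted r s by exact: sort_sorted.
have size_s : size s = n by rewrite size_sort size_enum_ord.
pose L i := \big[setU/set0]_(j <- take i.+1 s) K j.
(* The default value 0 beyond the list provides [u n = 0]. *)
pose u i := nth 0 [seq v j | j <- s] i.
have uE i (j0 : 'I_n) : (i < n)%N -> u i = v (nth j0 s i).
  by move=> iN; rewrite /u (nth_map j0) ?size_s.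
have u_ge i : (n <= i)%N -> u i = 0 by move=> ni; rewrite /u nth_default// size_map size_s.
have u0 i : 0 <= u i.
  have [ni|iN] := leqP n i; first by rewrite u_ge.
  by rewrite (uE i (Ordinal iN)).
have u_nd i j : (i <= j)%N -> u j <= u i.
  move=> ij; have [nj|jn] := leqP n j; first by rewrite (u_ge j).
  have iN := leq_ltn_trans ij jn.
  rewrite (uE _ (Ordinal jn))// (uE i (Ordinal jn))//.
  apply: (sorted_leq_nth r_tr _ _ s_sorted) => //; rewrite ?inE ?size_s//.
  by move=> x; rewrite /r.
have mem_take i j : j \in take i.+1 s -> (i < n)%N -> u i <= v j.
  move=> jt iN; have jlt : (index j (take i.+1 s) < size (take i.+1 s))%N by rewrite index_mem.
  move: (jlt); rewrite size_take size_s => h.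
  have ji : (index j (take i.+1 s) <= i)%N by move: (index _ _) h => q; case: (ltnP i.+1 n) => c h; lia.
  rewrite -[X in v X](nth_index j jt) nth_take; last by rewrite ltnS.
  rewrite -uE; [exact: u_nd|exact: leq_ltn_trans ji iN].
exists L, u; split => //.
- by move=> i; apply: bigsetU_compact.
- move=> i j ij; rewrite /L -!bigcup_seq => x [k /= ki Kx]; exists k => //=.
  have : subseq (take i.+1 s) (take j.+1 s).
    by rewrite -(@take_takel _ i.+1 j.+1)// take_subseq.
  by move/mem_subseq; exact.
- by rewrite u_ge.
- move=> phi mphi t t0; split => H i.
    move=> iN; apply/(maxitive_bigU _ mphi cK t0 (u0 i)) => j jt.
    apply: le_trans (H j); apply: lee_wpmul2r; first exact: maxitive_ge0.
    by rewrite lee_fin; exact: mem_take.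
  have si : i \in s by rewrite mem_sort mem_enum.
  have jn : (index i s < n)%N by have := index_mem i s; rewrite si size_s.
  have := H _ jn; rewrite (uE _ i jn) nth_index// => Hi.
  have := (maxitive_bigU _ mphi cK t0 (v0 i)).1 Hi i; apply.
  by rewrite in_take.
Qed.

Definition step K w n : E -> R := fun x => \sum_(k < n) w k * \1_(K k) x.

(** By telescoping, the step function is at least [v i] on [K i], and at most [v i] at a point
    outside all earlier sets. Its infimum over a compact C is therefore governed by the first [K i]
    that contains C. *)
Lemma ext_int_step phi K v n t :
  (forall A B, A `<=` B -> (phi A <= phi B)%E) -> phi set0 = 0%E ->
  (forall i, compact (K i)) -> (forall i j, (i <= j)%N -> K i `<=` K j) ->
  (forall i j, (i <= j)%N -> v j <= v i) -> v n = 0 -> 0 <= t ->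
  (ext_int phi (step K (fun k => v k - v k.+1)%R n) <= t%:E)%E <->
  (forall i, (i < n)%N -> ((v i)%:E * phi (K i) <= t%:E)%E).
Proof.
move=> phi_mono phi0 cK K_nd v_ni vn t0.
set f := step _ _ _.
have phi_ge0 A : (0 <= phi A)%E by rewrite -phi0; exact: phi_mono.
have f_ge0 x : 0 <= f x.
  by apply: sumr_ge0 => k _; rewrite mulr_ge0 ?subr_ge0 ?v_ni// indicE.
have tele i : (i <= n)%N -> \sum_(i <= k < n) (v k - v k.+1) = v i.
  move=> iN; under eq_bigr do rewrite -opprB.
  by rewrite sumrN telescope_sumr// vn sub0r opprK.
have fE i x : (i <= n)%N -> f x = \sum_(0 <= k < i) (v k - v k.+1) * \1_(K k) x +
    \sum_(i <= k < n) (v k - v k.+1) * \1_(K k) x.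
  by move=> iN; rewrite /f /step -(big_mkord xpredT (fun k => (v k - v k.+1) * \1_(K k) x)) (@big_cat_nat _ _ _ i).
have f_ge i x : (i <= n)%N -> K i x -> v i <= f x.
  move=> iN Kx; rewrite (fE i)// -[v i]add0r; apply: lerD.
    by apply: sumr_ge0 => k _; rewrite mulr_ge0 ?subr_ge0 ?v_ni// indicE.
  rewrite -tele// big_nat_cond [leRHS]big_nat_cond; apply: ler_sum => k /andP[/andP[ik _] _].
  by rewrite indicE mem_set ?mulr1//; exact: K_nd ik _ Kx.
have f_le i x : (i <= n)%N -> (forall k, (k < i)%N -> ~ K k x) -> f x <= v i.
  move=> iN nK; rewrite (fE i)// big_nat_cond big1 ?add0r => [|k /andP[/andP[_ ki] _]].
    rewrite -tele//; apply: ler_sum => k _; rewrite ler_piMr ?subr_ge0 ?v_ni//.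
  by rewrite indicE memNset ?mulr0//; exact: nK.
have lb C : has_lbound (f @` C) by exists 0 => _ [x _ <-].
split.
  move=> ft i iN; have [->|/set0P[x0 Kx0]] := eqVneq (K i) set0.
    by rewrite phi0 mule0 lee_fin.
  apply: le_trans ft; apply: le_trans (ereal_sup_ubound _); last by exists (K i).
  rewrite muleC; apply: lee_wpmul2l => //; rewrite lee_fin.
  apply: lb_le_inf; first by exists (f x0), x0.
  by move=> _ [x Kx <-]; apply: f_ge => //; exact: ltnW.
move=> H; apply: ge_ereal_sup => _ [C cC <-].
have [->|/set0P[x0 Cx0]] := eqVneq C set0; first by rewrite phi0 mul0e lee_fin.
(* Take the least i with C inside [K i], or n if there is none. By minimality and nesting, one point
   of C avoids all earlier sets; when i = n the infimum is 0. *)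
have [i [iN [Ci [x [Cx xK]]]]] : exists i, (i <= n)%N /\ ((i < n)%N -> C `<=` K i) /\
    exists x, C x /\ forall k, (k < i)%N -> ~ K k x.
  have [exC|nC] := pselect (exists i, (i < n)%N && `[< C `<=` K i >]).
    case: (@ex_minnP (fun i => (i < n)%N && `[< C `<=` K i >]) exC) => i /andP[iN /asboolP Ci] imin.
    exists i; split; [exact: ltnW|split => //].
    case: i => [|i] in iN Ci imin *; first by exists x0.
    have /existsNP[x /not_implyP[Cx nKx]] : ~ C `<=` K i.
      by move=> Ci'; have := imin i; rewrite (ltnW iN) (asboolT Ci') ltnn => /(_ isT).
    by exists x; split => // k; rewrite ltnS => ki Kx; apply: nKx; exact: K_nd ki _ Kx.
  exists n; split => //; split; first by rewrite ltnn.
  case: n @f fE f_ge f_le lb tele vn nC {H f_ge0} => [|n'] f fE f_ge f_le lb tele vn nC; first by exists x0.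
  have /existsNP[x /not_implyP[Cx nKx]] : ~ C `<=` K n'.
    by move=> Cn; apply: nC; exists n'; rewrite ltnSn; exact/asboolP.
  by exists x; split => // k; rewrite ltnS => ki Kx; apply: nKx; exact: K_nd ki _ Kx.
have inf_le : inf (f @` C) <= v i.
  by apply: le_trans (f_le i x iN xK); apply: ge_inf => //; exists x.
have [iN'|ni] := ltnP i n.
  apply: le_trans (H i iN'); rewrite muleC.
  have vi0 : 0 <= v i by rewrite -vn v_ni// ltnW.
  apply: (@le_trans _ _ ((v i)%:E * phi C)%E).
    by apply: lee_wpmul2r => //; rewrite lee_fin.
  by apply: lee_wpmul2l; rewrite ?lee_fin//; apply: phi_mono; exact: Ci.
have vi : v i = 0 by have -> : i = n by apply/eqP; rewrite eqn_leq iN.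
have inf_ge : 0 <= inf (f @` C).
  by apply: lb_le_inf; [exists (f x0), x0|move=> _ [y _ <-]].
have -> : inf (f @` C) = 0 by apply/eqP; rewrite eq_le inf_ge -vi inf_le.
by rewrite mule0 lee_fin.
Qed.

End maxitive.

(** * Laws on chains of compact sets *)

Section crsm_chain.
Context {R : realType} {E : topologicalType}.
Hypotheses (hE : hausdorff_space E) (lcE : locally_compact [set: E])
  (scE : @second_countable E).

Lemma USC_add (f g : E -> R) : USC f -> USC g -> USC (f \+ g).
Proof.
move=> [f0 [M fM] fo fc] [g0 [N gN] go gc]; split.
- by move=> x; rewrite addr_ge0.
- by exists (M + N) => x; rewrite lerD.
- move=> c; rewrite (_ : [set _ | _] = \bigcup_(q in [set: R])
      ([set x | f x < q] `&` [set x | g x < c - q])).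
    by apply: bigcup_open => q _; apply: openI.
  apply/seteqP; split => x /=.
    move=> fgc; exists ((f x + (c - g x)) / 2) => //=; split; first by rewrite /=; lra.
    by rewrite /=; lra.
  by move=> [q _ [/= fq gq]]; lra.
- apply: (@subclosed_compact _ _ (closure [set x | 0 < f x] `|` closure [set x | 0 < g x])).
  + exact: closed_closure.
  + exact: compactU.
  + rewrite -closureU; apply: closure_subset => x /=.
    have := f0 x; rewrite le_eqVlt => /predU1P[<-|]; last by left.
    by rewrite add0r; right.
Qed.

Lemma USC_indic (K : set E) (c : R) : compact K -> 0 <= c -> USC (fun x => c * \1_K x).
Proof.
move=> cK c0; have clK : closed K by exact: compact_closed.
have i1 x : \1_K x <= 1 :> R by rewrite indicE lern1 leq_b1.
split.
- by move=> x; rewrite mulr_ge0// indicE.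
- by exists c => x; rewrite ler_piMr.
- move=> b; have [b0|b0] := leP b 0.
    rewrite (_ : [set _ | _] = set0); first exact: open0.
    apply/seteqP; split => // x /= /lt_le_trans/(_ b0).
    by rewrite ltNge mulr_ge0// indicE.
  have [bc|cb] := leP b c.
    rewrite (_ : [set _ | _] = ~` K); first exact: closed_openC.
    apply/seteqP; split => x /=; rewrite indicE.
      by move=> + Kx; rewrite mem_set// mulr1 ltNge bc.
    by move=> nKx; rewrite memNset// mulr0.
  rewrite (_ : [set _ | _] = setT); first exact: openT.
  by apply/seteqP; split => // x _ /=; apply: le_lt_trans cb; rewrite ler_piMr.
- apply: (@subclosed_compact _ _ K) => //; first exact: closed_closure.
  rewrite [X in _ `<=` X](closure_id K).1//; apply: closure_subset => x /=.
  by rewrite indicE; case: (boolP (x \in K)) => [/set_mem//|]; rewrite mulr0 ltxx.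
Qed.

Context d (Omega : measurableType d) (P : probability Omega R).

Lemma unit_frechet_unique (Y : Omega -> \bar R) (a b : R) :
  unit_frechet P Y a -> unit_frechet P Y b -> a = b.
Proof.
move=> [_ /(_ 1 ltr01)[_ Ha]] [_ /(_ 1 ltr01)[_ Hb]].
by move: Hb; rewrite Ha => -[] /expR_inj; rewrite !divr1 => /oppr_inj.
Qed.

Lemma sup_measure_maxitive (phi : set E -> \bar R) : sup_measure phi -> maxitive phi.
Proof.
move=> sphi; split.
- by move=> A B; exact: sup_measure_mono.
- exact: sup_measure0.
- by move=> K L; exact: sup_measureU.
Qed.

Lemma ext_int_indic (phi : set E -> \bar R) (K : set E) (c t : R) : sup_measure phi ->
  compact K -> 0 <= c -> 0 <= t ->
  (ext_int phi (fun x => c * \1_K x)%R <= t%:E)%E <-> (c%:E * phi K <= t%:E)%E.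
Proof.
move=> sphi cK c0 t0.
pose v (i : nat) := if i == 0%N then c else 0.
have := @ext_int_step R E phi (fun=> K) v 1 t (sup_measure_mono sphi) (sup_measure0 sphi)
  (fun=> cK) (fun _ _ _ => @subset_refl _ K) _ erefl t0.
have -> : step (fun=> K) (fun k => v k - v k.+1) 1 = (fun x => c * \1_K x).
  by apply/funext => x; rewrite /step big_ord_recl big_ord0 addr0 /v/= subr0.
move=> ->; last by move=> [|i] [|j] //= _; rewrite /v.
by split => [/(_ 0%N isT)//|H [|//]].
Qed.

(** The scale is the Choquet integral with respect to [theta] of the step function with values v.
    Measurability is included because the limit arguments need genuine events. *)
Definition chain_law (X : Omega -> set E -> \bar R) (theta : set E -> R) : Prop :=
  forall n (K : nat -> set E) (v : nat -> R),
    (forall i, compact (K i)) -> (forall i j, (i <= j)%N -> K i `<=` K j) ->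
    (forall i j, (i <= j)%N -> v j <= v i) -> v n = 0 ->
    forall t, 0 < t ->
    let A := [set w | forall i, (i < n)%N -> ((v i)%:E * X w (K i) <= t%:E)%E] in
    measurable A /\
    P A = (expR (- (\sum_(i < n) (v i - v i.+1) * theta (K i)) / t))%:E.

Context (X : Omega -> set E -> \bar R) (theta : set E -> R).
Hypothesis rX : random_sup_measure X.

Let sX w : sup_measure (X w).
Proof. by case: rX. Qed.

Lemma unit_frechet_indic (K : set E) (c : R) : compact K -> 0 <= c ->
  ext_coeff P X theta ->
  unit_frechet P (fun w => ext_int (X w) (fun x => c * \1_K x)) (c * theta K).
Proof.
move=> cK c0 /(_ K cK)[th0 thP]; split; first by rewrite mulr_ge0.
move=> t t0; move: c0; rewrite le_eqVlt => /predU1P[<-|c0].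
  rewrite (_ : [set _ | _] = setT).
    by rewrite probability_setT mul0r oppr0 mul0r expR0.
  apply/seteqP; split => // w _ /=; apply/ext_int_indic => //; first exact: ltW.
  by rewrite mul0e lee_fin ltW.
have tc : 0 < t / c by rewrite divr_gt0.
have [m1 p1] := thP _ tc.
rewrite (_ : [set _ | _] = [set w | (ext_int (X w) \1_K <= (t / c)%:E)%E]).
  split => //; rewrite p1; congr (expR _)%:E; field.
  by rewrite !gt_eqF.
have E1 w : ext_int (X w) \1_K = ext_int (X w) (fun x => 1 * \1_K x).
  by congr ext_int; apply/funext => x; rewrite mul1r.
apply/seteqP; split => w /=; rewrite E1 => H.
  apply/ext_int_indic => //; first exact: ltW.
  rewrite mul1e mulrC EFinM lee_pdivlMl//.
  by apply/ext_int_indic => //; exact: ltW.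
apply/ext_int_indic => //; try exact: ltW.
rewrite -lee_pdivlMl// -EFinM mulrC -[X in (X <= _)%E]mul1e.
by apply/ext_int_indic => //; exact: ltW.
Qed.

Lemma CRSM_chain_law : CRSM P X -> ext_coeff P X theta -> chain_law X theta.
Proof.
move=> [_ comono] eX n K v cK K_nd v_ni vn t t0.
pose c k := v k - v k.+1.
have c0 k : 0 <= c k by rewrite subr_ge0 v_ni.
have step_usc m : USC (step K c m).
  elim: m => [|m IH].
    rewrite (_ : step _ _ _ = (fun x => 0 * \1_(set0 : set E) x)).
      by apply: USC_indic => //; exact: compact0.
    by apply/funext => x; rewrite /step big_ord0 mul0r.
  rewrite (_ : step _ _ _ = step K c m \+ (fun x => c m * \1_(K m) x)).
    by apply: USC_add => //; exact: USC_indic.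
  by apply/funext => x; rewrite /step big_ord_recr.
have main m : unit_frechet P (fun w => ext_int (X w) (step K c m)) (\sum_(i < m) c i * theta (K i)).
  elim: m => [|m IH].
    have := unit_frechet_indic (@compact0 E) (lexx 0) eX.
    rewrite mul0r big_ord0; congr (unit_frechet P _ _).
    apply/funext => w; congr ext_int; apply/funext => x.
    by rewrite /step big_ord0 mul0r.
  have fm := unit_frechet_indic (cK m) (c0 m) eX.
  (* On [K m] the new indicator is constant; off [K m] both functions vanish, by nesting. *)
  have com : comonotonic (step K c m) (fun x => c m * \1_(K m) x).
    have s0 x : 0 <= step K c m x.
      by apply: sumr_ge0 => k _; rewrite mulr_ge0// indicE.
    have sN x : ~ K m x -> step K c m x = 0.
      move=> nKx; apply: big1 => k _; rewrite indicE memNset ?mulr0// => Kx.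
      by apply: nKx; apply: K_nd Kx; exact: ltnW.
    move=> x y; rewrite !indicE.
    have [Kx|Kx] := pselect (K m x); have [Ky|Ky] := pselect (K m y).
    - by rewrite !mem_set// subrr mulr0.
    - rewrite (sN y)// mem_set// memNset// mulr0 !subr0 mulr_ge0// mulr1.
      exact: c0.
    - rewrite (sN x)// memNset// mem_set// mulr0 !sub0r mulrNN mulr_ge0// mulr1.
      exact: c0.
    - by rewrite !memNset// !mulr0 subr0 mulr0.
  have [a [b [Ha Hb]]] := comono _ _ (step_usc m) (USC_indic (cK m) (c0 m)) com.
  rewrite (unit_frechet_unique Ha IH) (unit_frechet_unique Hb fm) big_ord_recr/=.
  congr (unit_frechet P _ _).
  by apply/funext => w; congr ext_int; apply/funext => x; rewrite /step big_ord_recr.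
have [_ /(_ t t0)[mA PA]] := main n.
rewrite (_ : [set w | forall i, _ -> _] = [set w | (ext_int (X w) (step K c n) <= t%:E)%E])//.
apply/seteqP; split => w /= H.
  by apply/ext_int_step => //; [move=> A B; exact: sup_measure_mono|exact: sup_measure0|exact: ltW].
by apply/ext_int_step => //; [move=> A B; exact: sup_measure_mono|exact: sup_measure0|exact: ltW].
Qed.

End crsm_chain.

(** * Comonotonic additivity through level sets *)

Section level_counting.
Context {R : realType}.

(** Counting the levels below y computes the integer part of y / del, capped at N. *)
Lemma sum_levels (y del : R) (N : nat) : 0 <= y -> 0 < del ->
  let a := (\sum_(i < N) (i.+1%:R * del <= y)%R)%N in
  a%:R * del <= y /\ (y < a.+1%:R * del \/ a = N).
Proof.
move=> y0 d0; elim: N => [|N [IH1 IH2]] /=.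
  by rewrite big_ord0 mul0r; split => //; right.
rewrite big_ord_recr/=.
have aN : (\sum_(i < N) (i.+1%:R * del <= y)%R <= N)%N.
  by rewrite -[leqRHS]card_ord -sum1_card leq_sum// => i _; exact: leq_b1.
move: (\sum_(i < N) _)%N IH1 IH2 aN => a IH1 IH2 aN.
have [Ny|yN] := leP (N.+1%:R * del) y.
  case: IH2 => [ya|->]; last by rewrite addn1; split => //; right.
  have : a.+1%:R * del <= N.+1%:R * del by rewrite ler_pM2r// ler_nat.
  by move=> /(lt_le_trans ya)/lt_le_trans/(_ Ny); rewrite ltxx.
rewrite addn0; split => //; left; case: IH2 => [//|->//].
Qed.

(** In a chain sorted from the largest set down, a point lies in more than k members exactly when it
    lies in the member of rank k. The level sets of the counting function are therefore the members
    themselves, with multiplicity. *)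
Lemma chain_level_sets (E : Type) (theta : set E -> R) (D : seq (set E)) :
  (forall A B, A \in D -> B \in D -> A `<=` B \/ B `<=` A) ->
  let cnt x := (\sum_(A <- D) (x \in A))%N in
  (forall k, (k < size D)%N -> [set x | (k < cnt x)%N] \in D) /\
  \sum_(A <- D) theta A = \sum_(k < size D) theta [set x | (k < cnt x)%N].
Proof.
move=> Dch cnt.
pose r : rel (set E) := fun A B => `[< B `<=` A >].
have r_tr : transitive r.
  by move=> B A C /asboolP BA /asboolP CB; apply/asboolP; exact: subset_trans BA.
have r_tot : {in mem D &, total r}.
  by move=> A B AD BD; case: (Dch A B AD BD) => h; apply/orP; [right|left]; exact/asboolP.
pose s := sort r D.
have sD : perm_eq s D by rewrite perm_sort.
have s_sorted : sorted r s by apply: (sort_sorted_in r_tot); exact/allP.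
have ss : size s = size D by exact: perm_size.
have dec i j : (i <= j < size D)%N -> nth set0 s j `<=` nth set0 s i.
  move=> /andP[ij jD]; apply/asboolP.
  apply: (sorted_leq_nth r_tr _ _ s_sorted) => //; rewrite ?inE ?ss//.
    by move=> A; apply/asboolP.
  exact: leq_ltn_trans ij jD.
have cntE x : cnt x = (\sum_(0 <= j < size D) (x \in nth set0 s j))%N.
  rewrite /cnt -(perm_big _ sD)/= -ss.
  by rewrite (big_nth set0).
have lev k : (k < size D)%N -> [set x | (k < cnt x)%N] = nth set0 s k.
  move=> kD; apply/seteqP; split => x /=; rewrite cntE.
    apply: contraPP => nx; apply/negP; rewrite -leqNgt.
    rewrite (big_cat_nat (leq0n k) (ltnW kD))/= addnC big_nat_cond big1 ?add0n => [|j /andP[/andP[kj jD] _]].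
      rewrite -[leqRHS]subn0 -[leqRHS]muln1 -sum_nat_const_nat; apply: leq_sum => i _.
      exact: leq_b1.
    by rewrite memNset// => xj; apply: nx; apply: dec xj; rewrite kj.
  move=> xk; rewrite (big_cat_nat (leq0n k.+1) kD)/=.
  apply: leq_trans (leq_addr _ _).
  rewrite -[leqLHS]subn0 -[leqLHS]muln1 -sum_nat_const_nat big_nat_cond [leqRHS]big_nat_cond.
  apply: leq_sum => i /andP[/andP[_ ik] _].
  by rewrite mem_set//; apply: dec xk; rewrite -ltnS ik.
split.
  by move=> k kD; rewrite lev// -(perm_mem sD) mem_nth// ss.
rewrite -(perm_big _ sD)/= (big_nth set0) big_mkord ss; apply: eq_bigr => k _.
by rewrite lev.
Qed.

End level_counting.

Section choquet_additivity.
Context {R : realType} {E : Type} (theta : set E -> R) (Kc : set (set E)).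
Hypothesis theta_mono : forall A B, Kc A -> Kc B -> A `<=` B -> theta A <= theta B.

Let lev (f : E -> R) (c : R) := [set x | c <= f x].

Definition level_sum (f : E -> R) (del : R) (N : nat) :=
  \sum_(i < N) theta [set x | i.+1%:R * del <= f x].

(** The level sets of f and g form one chain, so both sums together equal the sum over the level
    sets [L k] of the rounded f plus the rounded g. Each rounding loses less than one mesh step,
    which places [L k] between the level sets of f + g at ranks k + 1 and k + 2. The sums differ by
    at most one term, bounded by [theta S]. *)
Lemma comonotonic_levels (f g : E -> R) (N : nat) (del : R) (S : set E) :
  (forall x y, 0 <= (f x - f y) * (g x - g y)) ->
  (forall x, 0 <= f x <= N%:R * del) -> (forall x, 0 <= g x <= N%:R * del) ->
  0 < del -> (0 < N)%N -> Kc S ->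
  (forall c, 0 < c -> Kc (lev f c) /\ Kc (lev g c) /\ Kc (lev (f \+ g) c)) ->
  (forall c, 0 < c -> lev (f \+ g) c `<=` S) -> 0 <= theta S ->
  (forall A, Kc A -> 0 <= theta A) ->
  level_sum f del N + level_sum g del N <= level_sum (f \+ g) del N.*2 <=
    level_sum f del N + level_sum g del N + theta S.
Proof.
move=> fg fN gN d0 N0 KS Klev levS thS th0.
pose D := [seq lev f (i.+1%:R * del) | i <- iota 0 N] ++ [seq lev g (i.+1%:R * del) | i <- iota 0 N].
have del_gt0 i : 0 < i.+1%:R * del by rewrite mulr_gt0.
have D_ch A B : A \in D -> B \in D -> A `<=` B \/ B `<=` A.
  have ff (h : E -> R) a b : lev h a `<=` lev h b \/ lev h b `<=` lev h a.
    have [ab|ba] := leP a b; [right|left] => x; first exact: le_trans.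
    by apply: le_trans; exact: ltW.
  (* If f x >= a but g x < b, then any y with g y >= b has g y > g x, hence f y >= f x >= a by
     comonotonicity. *)
  have fgl a b : lev f a `<=` lev g b \/ lev g b `<=` lev f a.
    have [|/existsNP[x /not_implyP[fx gx]]] := pselect (lev f a `<=` lev g b); first by left.
    right => y gy; apply: contrapT => fy.
    have := fg x y; rewrite nmulr_lge0 ?subr_le0.
      by move=> fxy; apply: fy; exact: le_trans fxy.
    by move: gx gy; rewrite /lev /= => /negP; rewrite -ltNge subr_lt0 => gx; exact: lt_le_trans.
  rewrite !mem_cat => /orP[|] /mapP[i _ ->] /orP[|] /mapP[j _ ->].
  - exact: ff.
  - exact: fgl.
  - by rewrite or_comm; exact: fgl.
  - exact: ff.
have size_D : size D = N.*2 by rewrite size_cat !size_map size_iota addnn.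
have [DL DE] := chain_level_sets theta D_ch.
have DK A : A \in D -> Kc A.
  by rewrite mem_cat => /orP[|] /mapP[i _ ->]; have [? [? ?]] := Klev _ (del_gt0 i).
pose a (f : E -> R) x := (\sum_(i < N) (i.+1%:R * del <= f x)%R)%N.
have cntE x : (\sum_(A <- D) (x \in A) = a f x + a g x)%N.
  rewrite /D big_cat/= !big_map -[N]subn0 -/(index_iota 0 N) !big_mkord.
  by congr addn; apply: eq_bigr => i _; congr nat_of_bool; apply/idP/idP; rewrite inE.
have aP (h : E -> R) x : 0 <= h x <= N%:R * del -> (a h x)%:R * del <= h x < (a h x).+1%:R * del.
  move=> /andP[h0 hN]; have [h1 h2] := sum_levels N h0 d0.
  rewrite -/(a h x) in h1 h2; rewrite h1 /=; case: h2 => [//|->].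
  by apply: (le_lt_trans hN); rewrite ltr_pM2r// ltr_nat.
pose L k := [set x | (k < a f x + a g x)%N].
have LE k : L k = [set x | (k < \sum_(A <- D) (x \in A))%N].
  by apply/seteqP; split => x /=; rewrite cntE.
have LU k : L k `<=` lev (f \+ g) (k.+1%:R * del).
  move=> x; rewrite /L /lev /= => kx.
  have /andP[f1 _] := aP f x (fN x); have /andP[g1 _] := aP g x (gN x).
  apply: le_trans (lerD f1 g1); rewrite -mulrDl ler_pM2r// -natrD ler_nat.
  exact: kx.
have UL k : lev (f \+ g) (k.+2%:R * del) `<=` L k.
  move=> x; rewrite /L /lev /= => kx.
  have /andP[_ f2] := aP f x (fN x); have /andP[_ g2] := aP g x (gN x).
  have : k.+2%:R * del < (a f x).+1%:R * del + (a g x).+1%:R * del.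
    by apply: le_lt_trans kx _; exact: ltrD.
  by rewrite -mulrDl ltr_pM2r// -natrD ltr_nat; lia.
have KL k : (k < N.*2)%N -> Kc (L k).
  by move=> kN; rewrite LE; apply/DK/DL; rewrite size_D.
have sum_fg : level_sum f del N + level_sum g del N = \sum_(k < N.*2) theta (L k).
  rewrite (eq_bigr (fun k : 'I__ => theta [set x | (k < \sum_(A <- D) (x \in A))%N])).
    rewrite -size_D -DE /D big_cat/= !big_map -[N]subn0 -/(index_iota 0 N) !big_mkord.
    by rewrite /level_sum subn0.
  by move=> k _; rewrite LE.
rewrite sum_fg; apply/andP; split.
  apply: ler_sum => k _; apply: theta_mono => //; first exact: KL.
  by have [_ [_ ]] := Klev _ (del_gt0 k).
(* Shift the index by one: the lowest level of f + g is bounded by [theta S], and its level of rank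
   k + 2 is compared with [L k]. *)
have [M ME] : exists M, N.*2 = M.+1 by exists N.*2.-1; rewrite prednK// double_gt0.
rewrite /level_sum ME big_ord_recl addrC; rewrite ME in KL.
apply: lerD.
  rewrite [leRHS]big_ord_recr/= -[leLHS]addr0; apply: lerD.
    apply: ler_sum => k _; apply: theta_mono.
    - by have [_ [_ ]] := Klev _ (del_gt0 (bump 0 k)).
    - by apply: KL; rewrite ltnS; exact: ltnW.
    - exact: UL.
  by apply: th0; exact: KL.
apply: theta_mono => //; first by have [_ [_ ]] := Klev _ (del_gt0 0%N).
exact: levS.
Qed.

End choquet_additivity.

Section chain_law_CRSM.
Context {R : realType} {E : topologicalType}.
Hypotheses (hE : hausdorff_space E) (lcE : locally_compact [set: E])
  (scE : @second_countable E).
Context d (Omega : measurableType d) (P : probability Omega R).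
Context (X : Omega -> set E -> \bar R) (theta : set E -> R).
Hypotheses (rX : random_sup_measure X) (cX : chain_law P X theta).

Let sX w : sup_measure (X w).
Proof. by case: rX. Qed.

Lemma chain_law1 K (c t : R) : compact K -> 0 <= c -> 0 < t ->
  measurable [set w | (c%:E * X w K <= t%:E)%E] /\
  P [set w | (c%:E * X w K <= t%:E)%E] = (expR (- (c * theta K) / t))%:E.
Proof.
move=> cK c0 t0; pose v (i : nat) := if i == 0%N then c else 0.
have v_ni i j : (i <= j)%N -> v j <= v i by case: i j => [|i] [|j].
have := cX (fun=> cK) (fun _ _ _ => @subset_refl _ K) v_ni (erefl : v 1%N = 0) t0.
rewrite /= big_ord_recl big_ord0 addr0 /v/= subr0.
rewrite (_ : [set w | forall i, _ -> _] = [set w | (c%:E * X w K <= t%:E)%E])//.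
by apply/seteqP; split => w /= H; [exact: (H 0%N isT)|case].
Qed.

Lemma chain_law_ge0 K : compact K -> 0 <= theta K.
Proof.
move=> cK; have [mA PA] := chain_law1 cK ler01 ltr01.
have := probability_le1 P mA; rewrite PA lee_fin divr1 mul1r.
by rewrite -[leRHS]expR0 ler_expR oppr_le0.
Qed.

Lemma chain_law_mono K L : compact K -> compact L -> K `<=` L -> theta K <= theta L.
Proof.
move=> cK cL KL.
have [mA PA] := chain_law1 cK ler01 ltr01; have [mB PB] := chain_law1 cL ler01 ltr01.
have : (P [set w | (1%:E * X w L <= 1%:E)%E] <= P [set w | (1%:E * X w K <= 1%:E)%E])%E.
  apply: le_measure; rewrite ?inE// => w /=; rewrite !mul1e; apply: le_trans.
  exact: (sup_measure_mono (sX w)).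
by rewrite PA PB lee_fin ler_expR !divr1 !mul1r lerN2.
Qed.

Lemma chain_law_ext_coeff : ext_coeff P X theta.
Proof.
move=> K cK; split; first exact: chain_law_ge0.
move=> t t0; have := chain_law1 cK ler01 t0; rewrite mul1r.
rewrite (_ : [set w | (ext_int _ _ <= _)%E] = [set w | (1%:E * X w K <= t%:E)%E])//.
have E1 w : ext_int (X w) \1_K = ext_int (X w) (fun x => 1 * \1_K x).
  by congr ext_int; apply/funext => x; rewrite mul1r.
by apply/seteqP; split => w /=; rewrite E1 => H; apply/(ext_int_indic _ cK) => //; exact: ltW.
Qed.

Lemma chain_law_max_stable : max_stable P X.
Proof.
move=> n K u cK u0.
have [L [v [cL L_nd v_ni vn LE]]] := nested_reduction cK u0.
exists (\sum_(i < n) (v i - v i.+1) * theta (L i)); split.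
  by apply: sumr_ge0 => i _; rewrite mulr_ge0 ?subr_ge0 ?v_ni// chain_law_ge0.
move=> t t0; have := cX cL L_nd v_ni vn t0 => /=.
rewrite (_ : [set w | forall i, _ -> _] =
  [set w | (\big[Order.max/0%E]_(i < n) ((u i)%:E * X w (K i)) <= t%:E)%E])//.
apply/seteqP; split => w /= H.
  apply/bigmax_leP => /=; split; first by rewrite lee_fin ltW.
  move=> i _; have := (LE (X w) (sup_measure_maxitive hE lcE scE (sX w)) t (ltW t0)).2 H i.
  exact.
apply/(LE (X w) (sup_measure_maxitive hE lcE scE (sX w)) t (ltW t0)) => i.
by move/bigmax_leP : H => /= [_ /(_ i isT)].
Qed.

Section level_law.
Context (f : E -> R) (C : nat).
Hypotheses (uf : USC f) (fC : forall x, f x <= C%:R) (C0 : (0 < C)%N).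

Let lev (c : R) := [set x | c <= f x].
(** With a dyadic mesh the levels of one rank recur at all later ranks, so the events below decrease
    with n. *)
Let N n := (C * 2 ^ n)%N.
Let del n : R := 2^-1 ^+ n.

Let del_gt0 n : 0 < del n.
Proof. by rewrite /del exprn_gt0// invr_gt0. Qed.

Let N_gt0 n : (0 < N n)%N.
Proof. by rewrite muln_gt0 C0 expn_gt0. Qed.

Let Ndel n : (N n)%:R * del n = C%:R.
Proof.
by rewrite /N /del natrM natrX -mulrA -exprMn divff ?expr1n ?mulr1//.
Qed.

Lemma compact_level (c : R) : 0 < c -> compact [set x | c <= f x].
Proof.
move=> c0; case: uf => f0 _ fo fc.
apply: (@subclosed_compact _ _ (closure [set x | 0 < f x])) => //.
  rewrite (_ : [set _ | _] = ~` [set x | f x < c]); first exact: open_closedC.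
  by apply/seteqP; split => x /=; rewrite leNgt => /negP.
apply: subset_trans (@subset_closure _ _) => x /=; exact: lt_le_trans.
Qed.

Let event t n := [set w | forall i, (i < N n)%N ->
  ((i.+1%:R * del n)%:E * X w (lev (i.+1%:R * del n)) <= t%:E)%E].

Let event_law t n : 0 < t -> measurable (event t n) /\
  P (event t n) = (expR (- (del n * level_sum theta f (del n) (N n)) / t))%:E.
Proof.
move=> t0.
(* Levels are numbered from the top down, to form an increasing chain. The cap keeps the height
   positive beyond the last index, since [chain_law] wants every set of the sequence compact. *)
pose q j := (N n - minn j (N n).-1)%N.
have q_gt0 j : (0 < q j)%N by rewrite /q; have := N_gt0 n; lia.
pose K j := lev ((q j)%:R * del n).
pose v j : R := (N n - j)%:R * del n.
have cK j : compact (K j) by apply: compact_level; rewrite mulr_gt0 ?ltr0n.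
have K_nd i j : (i <= j)%N -> K i `<=` K j.
  move=> ij x; apply: le_trans; rewrite ler_pM2r// ler_nat /q; lia.
have v_ni i j : (i <= j)%N -> v j <= v i.
  by move=> ij; rewrite ler_pM2r// ler_nat; lia.
have vn : v (N n) = 0 by rewrite /v subnn mul0r.
have [mA PA] := cX cK K_nd v_ni vn t0.
have eE : event t n = [set w | forall i, (i < N n)%N -> ((v i)%:E * X w (K i) <= t%:E)%E].
  apply/seteqP; split => w /= H i iN.
    have := H (N n - i.+1)%N; rewrite /v /K (_ : (N n - i.+1).+1 = (N n - i)%N); last lia.
    by rewrite (_ : q i = (N n - i)%N); [apply; lia|rewrite /q; lia].
  have := H (N n - i.+1)%N; rewrite /v /K (_ : (N n - (N n - i.+1))%N = i.+1); last lia.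
  by rewrite (_ : q (N n - i.+1) = i.+1)%N; [apply; lia|rewrite /q; lia].
rewrite eE; split => //; rewrite PA; congr (expR (- _ / _))%:E.
rewrite /level_sum mulr_sumr [RHS](reindex_inj rev_ord_inj)/=; apply: eq_bigr => j _.
rewrite /v -mulrBl -natrB; last by have := ltn_ord j; lia.
rewrite (_ : N n - j - (N n - j.+1) = 1)%N ?mul1r; last by have := ltn_ord j; lia.
congr (_ * theta _); rewrite /K /lev (_ : q j = (N n - j.+1).+1)//.
by rewrite /q; have := ltn_ord j; lia.
Qed.

Let f_ge0 x : 0 <= f x. Proof. by case: uf. Qed.

Let event_of_ext_int t n w : 0 < t -> (ext_int (X w) f <= t%:E)%E -> event t n w.
Proof.
move=> t0 H i iN.
have c0 : 0 < i.+1%:R * del n by rewrite mulr_gt0.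
have [->|/set0P[x0 Kx0]] := eqVneq (lev (i.+1%:R * del n)) set0.
  by rewrite (sup_measure0 (sX w)) mule0 lee_fin ltW.
apply: le_trans H; apply: le_trans (ereal_sup_ubound _); last first.
  by exists (lev (i.+1%:R * del n)); first exact: compact_level.
rewrite muleC; apply: lee_wpmul2l; first exact: (sup_measure_ge0 (sX w)).
rewrite lee_fin; apply: lb_le_inf; first by exists (f x0), x0.
by move=> _ [x Kx <-].
Qed.

(** If the integral exceeds t, so does X(K) times the infimum of f for some compact K. Rounding this
    infimum down to the mesh costs at most X(K) [del n], which tends to 0 because X(K) is finite. *)
Let near_event t w : 0 < t ->
  \forall n \near \oo, event t n w <-> [set w | (ext_int (X w) f <= t%:E)%E] w.
Proof.
move=> t0; have [H|H] := pselect (ext_int (X w) f <= t%:E)%E.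
  by apply: nearW => n; split => // _; exact: event_of_ext_int.
suff : \forall n \near \oo, ~ event t n w by apply: filterS => n nE; split.
have [K cK HK] : exists2 K, compact K & (t%:E < X w K * (inf (f @` K))%:E)%E.
  apply: contrapT => nK; apply: H; apply: ge_ereal_sup => _ [K cK <-].
  by rewrite leNgt; apply/negP => h; apply: nK; exists K.
have XK0 := sup_measure_ge0 (sX w) K.
have XKfin : X w K \is a fin_num.
  rewrite ge0_fin_numE//; have [_ _ _ _ [h _]] := sX w; exact: h.
have K0 : K !=set0.
  apply/set0P/negP => /eqP KE; move: HK; rewrite KE (sup_measure0 (sX w)) mul0e lte_fin.
  by rewrite ltNge ltW.
move: HK XK0; rewrite -(fineK XKfin) -EFinM lte_fin lee_fin.
set p := fine _; set s := inf _ => ps p0.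
have pgt0 : 0 < p by rewrite lt_neqAle p0 andbT; apply/eqP => p0'; move: ps; rewrite -p0' mul0r ltNge ltW.
have [x0 Kx0] := K0.
have lbf : has_lbound (f @` K) by exists 0 => _ [x _ <-].
have sf x : K x -> s <= f x by move=> Kx; apply: ge_inf => //; exists x.
have dcv : p * (s - del n) @[n --> \oo] --> p * (s - 0).
  apply: cvgM; first exact: cvg_cst.
  apply: cvgB; first exact: cvg_cst.
  by apply: cvg_expr; rewrite ger0_norm// invf_lt1// ltr1n.
rewrite subr0 in dcv.
near=> n => ev; have tn : t < p * (s - del n) by near: n; exact: (cvgr_gt _ dcv).
have sd : del n < s.
  by rewrite -subr_gt0 -(pmulr_rgt0 _ pgt0); exact: lt_trans tn.
have s0 : 0 <= s by rewrite ltW// (lt_trans (del_gt0 n)).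
have sd0 : 0 <= s / del n by rewrite divr_ge0// ltW.
(* The highest level not above the infimum of f on K. It is at least 1 because the mesh is already
   below that infimum. *)
pose i := Num.truncn (s / del n).
have /andP[i1 i2] : i%:R <= s / del n < i.+1%:R by exact: truncn_itv.
have id : i%:R * del n <= s by rewrite -ler_pdivlMr.
have is1 : s < i.+1%:R * del n by rewrite -ltr_pdivrMr.
have ipos : (0 < i)%N.
  rewrite lt0n; apply/eqP => i0; move: is1; rewrite i0 mul1r ltNge => /negP; apply.
  exact: ltW.
have iN : (i.-1 < N n)%N.
  rewrite prednK// -(ler_nat R) -(ler_pM2r (del_gt0 n)) Ndel.
  by apply: le_trans id _; apply: le_trans (sf _ Kx0) (fC x0).
have := ev i.-1 iN; rewrite prednK//; apply/negP; rewrite -ltNge.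
apply: (@lt_le_trans _ _ (p * (i%:R * del n))%:E).
  rewrite lte_fin; apply: lt_le_trans tn _; rewrite ler_pM2l//.
  by move: is1; rewrite -natr1 mulrDl mul1r; lra.
rewrite EFinM muleC /p fineK//; apply: lee_wpmul2l; first by rewrite lee_fin mulr_ge0// ltW.
by apply: (sup_measure_mono (sX w)) => x Kx; apply: le_trans id (sf _ Kx).
Unshelve. all: by end_near. Qed.

(** The scales of the discretised integrals converge: they are nondecreasing because at t = 1 they
    are minus the logarithms of the probabilities of decreasing events, and [theta] of the support
    times C bounds them. *)
Lemma ext_int_law : exists l : R,
  del n * level_sum theta f (del n) (N n) @[n --> \oo] --> l /\
  unit_frechet P (fun w => ext_int (X w) f) l.
Proof.
pose S n := del n * level_sum theta f (del n) (N n).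
have cS : compact (closure [set x | 0 < f x]) by case: uf.
have lev_sub c : 0 < c -> lev c `<=` closure [set x | 0 < f x].
  by move=> c0; apply: subset_trans (@subset_closure _ _) => x /=; exact: lt_le_trans.
have event_dec n m w : (n <= m)%N -> event 1 m w -> event 1 n w.
  move=> nm ev i iN.
  have E1 : i.+1%:R * del n = (i.+1 * 2 ^ (m - n))%:R * del m.
    rewrite /del -{2}(subnK nm) exprD natrM natrX -!mulrA; congr (_ * _).
    by rewrite mulrA -exprMn divff ?expr1n ?mul1r// pnatr_eq0.
  have i2 : (0 < i.+1 * 2 ^ (m - n))%N by rewrite muln_gt0 expn_gt0.
  have i3 : (i.+1 * 2 ^ (m - n) <= N m)%N.
    rewrite (_ : N m = C * 2 ^ n * 2 ^ (m - n))%N; first by rewrite leq_mul2r iN orbT.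
    by rewrite /N -mulnA -expnD subnKC.
  have := ev (i.+1 * 2 ^ (m - n)).-1; rewrite prednK// E1; apply.
  exact: i3.
have S_nd : {homo S : n m / (n <= m)%N >-> n <= m}.
  move=> n m nm; have [mA PA] := event_law n ltr01; have [mB PB] := event_law m ltr01.
  have : (P (event 1 m) <= P (event 1 n))%E.
    by apply: le_measure; rewrite ?inE// => w; exact: event_dec.
  by rewrite PA PB lee_fin ler_expR !divr1 lerN2.
have S_ub n : S n <= C%:R * theta (closure [set x | 0 < f x]).
  rewrite -(Ndel n) (mulrC (N n)%:R) -mulrA /S ler_pM2l//.
  rewrite mulr_natl -[N n in leRHS]card_ord -sumr_const; apply: ler_sum => i _.
  have c0 : 0 < i.+1%:R * del n by rewrite mulr_gt0.
  by apply: chain_law_mono => //; [exact: compact_level|exact: lev_sub].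
have S_cvg : cvgn S.
  apply: nondecreasing_is_cvgn => //.
  by exists (C%:R * theta (closure [set x | 0 < f x])) => _ [n _ <-].
exists (limn S); split; first exact: S_cvg.
split.
  apply: limr_ge => //; apply: nearW => n; rewrite mulr_ge0 ?(ltW (del_gt0 n))//.
  apply: sumr_ge0 => i _; apply: chain_law_ge0; apply: compact_level.
  by rewrite mulr_gt0.
move=> t t0; have mE n := (event_law n t0).1.
have nE w := near_event w t0.
have mX := measurable_near mE nE; split => //.
have c1 := @probability_cvg _ Omega R P _ _ mE mX nE.
have c2 : P (event t n) @[n --> \oo] --> (expR (- limn S / t))%:E.
  rewrite (_ : (fun n => P (event t n)) = (fun n => (expR (- S n / t))%:E)); last first.
    by apply/funext => n; rewrite (event_law n t0).2.
  apply: cvg_EFin; first exact: nearW.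
  have St : - S n / t @[n --> \oo] --> - limn S / t.
    by apply: cvgM; [exact: cvgN|exact: cvg_cst].
  exact: (cvg_comp _ _ St (@continuous_expR R (- limn S / t))).
exact: (cvg_unique _ c1 c2).
Qed.

End level_law.

Lemma chain_law_CRSM : CRSM P X.
Proof.
split; first exact: chain_law_max_stable.
move=> f g uf ug fg.
have [f0 [M fM] _ cf] := uf; have [g0 [M' gM] _ cg] := ug.
pose C := (Num.truncn (Num.max M M')).+1.
have MC : Num.max M M' <= C%:R.
  by rewrite /C ltW//; exact: truncnS_gt.
have fC x : f x <= C%:R by apply: le_trans (fM x) _; apply: le_trans MC; rewrite le_max lexx.
have gC x : g x <= C%:R by apply: le_trans (gM x) _; apply: le_trans MC; rewrite le_max lexx orbT.
have fgC x : (f \+ g) x <= (C.*2)%:R by rewrite -addnn natrD lerD.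
have ufg := USC_add uf ug.
have [a [ca Ha]] := ext_int_law uf fC isT.
have [b [cb Hb]] := ext_int_law ug gC isT.
have [l [cl Hl]] := ext_int_law ufg fgC isT.
exists a, b; split => //.
suff <- : l = a + b by [].
pose S := closure [set x | 0 < f x] `|` closure [set x | 0 < g x].
have cS : compact S by exact: compactU.
have del0 n : 0 < 2^-1 ^+ n :> R by rewrite exprn_gt0// invr_gt0.
have Ndel n : (C * 2 ^ n)%:R * 2^-1 ^+ n = C%:R :> R.
  by rewrite natrM natrX -mulrA -exprMn divff ?expr1n ?mulr1//.
have bound n := @comonotonic_levels R E theta compact chain_law_mono f g (C * 2 ^ n) (2^-1 ^+ n) S fg.
have {}bound n : level_sum theta f (2^-1 ^+ n) (C * 2 ^ n) + level_sum theta g (2^-1 ^+ n) (C * 2 ^ n) <=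
   level_sum theta (f \+ g) (2^-1 ^+ n) (C.*2 * 2 ^ n) <=
   level_sum theta f (2^-1 ^+ n) (C * 2 ^ n) + level_sum theta g (2^-1 ^+ n) (C * 2 ^ n) + theta S.
  rewrite (_ : (C.*2 * 2 ^ n) = (C * 2 ^ n).*2)%N; last by rewrite -!muln2 mulnAC.
  apply: bound => //.
  - by move=> x; rewrite f0 Ndel fC.
  - by move=> x; rewrite g0 Ndel gC.
  - by rewrite muln_gt0 expn_gt0.
  - by move=> c c0; split; [|split]; exact: compact_level.
  - move=> c c0 x /= cx; have : 0 < f x + g x by exact: lt_le_trans cx.
    have := f0 x; rewrite le_eqVlt => /predU1P[<-|fx _]; last by left; exact: subset_closure.
    by rewrite add0r => gx; right; exact: subset_closure.
  - exact: chain_law_ge0.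
  - by move=> A; exact: chain_law_ge0.
have cab : 2^-1 ^+ n * level_sum theta f (2^-1 ^+ n) (C * 2 ^ n) +
    2^-1 ^+ n * level_sum theta g (2^-1 ^+ n) (C * 2 ^ n) @[n --> \oo] --> a + b.
  exact: cvgD.
have cab' : 2^-1 ^+ n * level_sum theta f (2^-1 ^+ n) (C * 2 ^ n) +
    2^-1 ^+ n * level_sum theta g (2^-1 ^+ n) (C * 2 ^ n) + 2^-1 ^+ n * theta S @[n --> \oo] --> a + b.
  rewrite -[X in _ --> X]addr0; apply: cvgD => //.
  rewrite -(mul0r (theta S)); apply: cvgM; last exact: cvg_cst.
  by apply: cvg_expr; rewrite ger0_norm// invf_lt1// ltr1n.
(* The discretisation error is at most 2^-n times [theta S], so both bounds squeeze to a + b. *)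
apply: (cvg_unique _ cl) => //; apply: (@squeeze_cvgr _ _ _ _ _ _ _ _ _ cab cab').
apply: nearW => n.
by rewrite -!mulrDr !ler_pM2l.
Qed.

End chain_law_CRSM.

(** * The chain law of the Poisson functional *)

Section rep.
Context {R : realType} {E : topologicalType}.
Implicit Types (pts : nat -> option (R * set E)).

Lemma rep_le pts A (c : \bar R) : (forall i p, pts i = Some p -> Dom p) ->
  (0 <= c)%E ->
  (rep pts A <= c)%E <->
  (forall i p, pts i = Some p -> p.2 `&` A !=set0 -> ((p.1^-1)%:E <= c)%E).
Proof.
move=> D c0; split=> [H i p ip pA|H].
  apply: le_trans H; apply: ereal_sup_ubound; exists i => //=.
  by rewrite ip indicE mem_set//= mulr1.
apply: ge_ereal_sup => _ [i _ <-]; case ip : (pts i) => [p|//].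
rewrite indicE; case: (boolP (p.2 \in [set F | F `&` A !=set0])) => [/set_mem pA|_].
  by rewrite mulr1; exact: H ip pA.
by rewrite mulr0.
Qed.

Lemma rep_ge0 pts A : (forall i p, pts i = Some p -> Dom p) -> (0 <= rep pts A)%E.
Proof.
move=> D; apply: (@le_trans _ _ (match pts 0%N with
     | Some p => (p.1^-1 * (\1_[set F : set E | F `&` A !=set0] p.2 : R))%:E
     | None => 0%E end)); last by apply: ereal_sup_ubound; exists 0%N.
case p0 : (pts 0%N) => [p|//]; have [p1 _] := D _ _ p0.
by rewrite lee_fin mulr_ge0 ?invr_ge0 ?(ltW p1)// indicE.
Qed.

Lemma maxitive_rep pts : (forall i p, pts i = Some p -> Dom p) -> maxitive (rep pts).
Proof.
move=> D.
have mono A B : A `<=` B -> (rep pts A <= rep pts B)%E.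
  move=> AB; apply/rep_le => //; first exact: rep_ge0.
  move=> i p ip [x [px Ax]]; have := (rep_le B D (rep_ge0 B D)).1 (lexx _) i p ip; apply.
  by exists x; split => //; exact: AB.
split => //.
  apply/eqP; rewrite eq_le rep_ge0// andbT; apply/rep_le => //.
  by move=> i p _ [x []].
move=> A B _ _; apply/eqP; rewrite eq_le ge_max !mono ?andbT//.
apply/rep_le => //; first by rewrite le_max rep_ge0.
move=> i p ip [x [px [Ax|Bx]]]; rewrite le_max.
  by rewrite ((rep_le A D (rep_ge0 A D)).1 (lexx _) i p ip)//; exists x.
by rewrite ((rep_le B D (rep_ge0 B D)).1 (lexx _) i p ip) ?orbT//; exists x.
Qed.

Lemma Fsigma_hit (K : set E) : compact K -> Fsigma (hit K).
Proof. by move=> cK; apply: sub_gen_smallest; exists K. Qed.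

Lemma ProdSigma_setX (I : set (measurableTypeR R)) (C : set (set E)) :
  measurable I -> I `<=` [set t | 0 < t] -> Fsigma C -> ProdSigma (I `*` C).
Proof. by move=> mI I0 FC; apply: sub_gen_smallest; exists I, C. Qed.

Lemma count_eq0 pts (B : set (R * set E)) :
  Defs.count pts B = 0%E <-> forall i p, pts i = Some p -> ~ B p.
Proof.
split=> [c0 i p ip Bp|H].
  have : (1%E <= Defs.count pts B)%E.
    rewrite /Defs.count; apply: le_trans (nneseries_lim_ge i.+1 _); last first.
      by move=> j _; case: (pts j) => // q; rewrite lee_fin indicE.
    rewrite big_nat_recr//= ip indicE mem_set//= leeDr//.
    by apply: sume_ge0 => j _; case: (pts j) => // q; rewrite lee_fin indicE.
  by rewrite c0 lee_fin ler10.
rewrite /Defs.count; apply: eseries0 => i _ _; case ip : (pts i) => [p|//].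
by rewrite indicE memNset//; exact: H ip.
Qed.

(** The event says that no point (s, F) has s < a i and F hitting [K i] for some i. At a height s in
    [a (i+1), a i[ the largest constraint in force is [K i], so the forbidden region is a disjoint
    union of the rectangles [I i] times [hit (K i)], whose intensity is the required exponent. *)
Lemma rep_chain_law d (Omega : measurableType d) (P : probability Omega R)
    (pts : Omega -> nat -> option (R * set E)) (nu : set (set E) -> \bar R)
    (mu : set (R * set E) -> \bar R) (theta : set E -> R) :
  (forall K, compact K -> nu (hit K) = (theta K)%:E) ->
  is_product_intensity nu mu -> poisson_process P pts mu ->
  chain_law P (fun w => rep (pts w)) theta.
Proof.
move=> nuE [[mu0 _ mu_add] muX] [ptsD ptsm ptsP] n K v cK K_nd v_ni vn t t0 A.
pose a i := v i / t.
have a_ni i j : (i <= j)%N -> a j <= a i.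
  by move=> ij; rewrite ler_pM2r ?invr_gt0// v_ni.
have an : a n = 0 by rewrite /a vn mul0r.
(* Positivity is imposed separately, since the last slice would otherwise contain 0, outside the
   domain of the process. *)
pose I i : set (measurableTypeR R) := [set s | 0 < s /\ a i.+1 <= s < a i].
have IE i : I i = if 0 < a i.+1 then `[a i.+1, a i[%classic else `]0, a i[%classic `&` [set s | a i.+1 <= s].
  apply/seteqP; split => s; rewrite /I /=; case: ifPn => ai; rewrite /= in_itv/=.
  - by move=> [].
  - by move=> [-> /andP[? ->]].
  - by move=> /andP[h1 h2]; rewrite h1 h2 (lt_le_trans ai h1).
  - by move=> [/andP[-> ->] ->].
have a_ge0 i : (i <= n)%N -> 0 <= a i by move=> iN; rewrite -an a_ni.
have IE' i : (i < n)%N -> I i = if 0 < a i.+1 then `[a i.+1, a i[%classic else `]0, a i[%classic.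
  move=> iN; rewrite IE; case: ifPn => //; rewrite -leNgt => ai.
  apply/seteqP; split => s /=; first by move=> [].
  by rewrite in_itv/= => /andP[s0 sa]; rewrite s0 sa; split => //; exact: le_trans (ltW s0).
have mI i : (i < n)%N -> measurable (I i).
  by move=> iN; rewrite IE'//; case: ifPn => _; exact: measurable_itv.
have I0 i : I i `<=` [set s | 0 < s] by move=> s [].
have lI i : (i < n)%N -> lebesgue_measure (I i) = (a i - a i.+1)%:E.
  move=> iN; have aii := a_ni i i.+1 (leqnSn i).
  rewrite IE'//; case: ifPn => [ai|]; rewrite ?lebesgue_measure_itv/= ?lte_fin.
    have [_|ia] := ltP; first by rewrite EFinB.
    by congr EFin; lra.
  rewrite -leNgt => ai; have ai0 : a i.+1 = 0 by apply/eqP; rewrite eq_le ai a_ge0.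
  rewrite ai0 subr0; have [_|ia] := ltP; first by rewrite oppr0 adde0.
  by congr EFin; have := a_ge0 i (ltnW iN); lra.
pose F k := if (k < n)%N then I k `*` hit (K k) else set0.
have FS k : ProdSigma (F k).
  rewrite /F; case: ifPn => [kn|_].
    by apply: ProdSigma_setX; [exact: mI|exact: I0|exact: Fsigma_hit].
  by have [] := smallest_sigma_algebra (@Dom R E) rects.
have tF : trivIset setT F.
  apply/trivIsetP => i j _ _; wlog ij : i j / (i < j)%N.
    move=> H; rewrite neq_ltn => /orP[ij|ji]; first by rewrite H// ltn_eqF.
    by rewrite setIC H// ltn_eqF.
  move=> _; apply/seteqP; split => // p []; rewrite /F; case: ifPn => [iN|_ []].
  move=> [[_ /andP[h1 _]] _]; case: ifPn => [jN|_ []] [[_ /andP[_ h2]] _].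
  by have := a_ni _ _ ij; move: h1 h2; lra.
have US : ProdSigma (\bigcup_k F k).
  by have [_ _] := smallest_sigma_algebra (@Dom R E) rects; exact.
pose s := \sum_(i < n) (v i - v i.+1) * theta (K i).
have muB : mu (\bigcup_k F k) = (s / t)%:E.
  have := mu_add F FS tF US.
  have : (\sum_(0 <= k < m) mu (F k))%E @[m --> \oo] --> (s / t)%:E.
    apply: cvg_near_cst; exists n => // m /= nm.
    rewrite (big_cat_nat (leq0n n) nm)/= [X in (_ + X)%E](_ : _ = 0%E) ?adde0; last first.
      rewrite big_nat_cond big1// => k /andP[/andP[nk _] _].
      by rewrite /F ltnNge nk/= mu0.
    rewrite big_mkord /s mulr_suml -sumEFin; apply: eq_bigr => k _.
    rewrite /F ltn_ord muX; [|exact: mI|exact: I0|exact: Fsigma_hit].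
    rewrite lI// nuE// -EFinM; congr EFin; rewrite /a; field.
    by rewrite gt_eqF.
  by move=> h1 h2; exact: cvg_unique h2 h1.
have AE : A = [set w | Defs.count (pts w) (\bigcup_k F k) = 0%E].
  have vE i p : 0 < p.1 -> ((v i)%:E * (p.1^-1)%:E <= t%:E)%E = (a i <= p.1).
    by move=> p0; rewrite -EFinM lee_fin /a ler_pdivrMr// ler_pdivrMr// mulrC.
  have vR i w : (i < n)%N -> ((v i)%:E * rep (pts w) (K i) <= t%:E)%E <->
      forall j p, pts w j = Some p -> p.2 `&` K i !=set0 -> a i <= p.1.
    move=> iN; have vi0 : 0 <= v i by rewrite -vn v_ni// ltnW.
    move: vi0; rewrite le_eqVlt => /predU1P[vi0|vi0].
      rewrite -vi0 mul0e; split => [_ j p jp _|_]; last by rewrite lee_fin ltW.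
      by rewrite /a -vi0 mul0r; have [/ltW] := ptsD _ _ _ jp.
    rewrite -lee_pdivlMl// -EFinM; split => [H j p jp pK|H].
      have [p0 _] := ptsD _ _ _ jp.
      have := (rep_le (K i) (ptsD w) (le_trans (rep_ge0 _ (ptsD w)) H)).1 H j p jp pK.
      by rewrite EFinM lee_pdivlMl// vE.
    apply/(rep_le _ (ptsD w)); first by rewrite lee_fin mulr_ge0 ?invr_ge0// ltW.
    move=> j p jp pK; have [p0 _] := ptsD _ _ _ jp.
    by rewrite EFinM lee_pdivlMl// vE//; exact: H jp pK.
  apply/seteqP; split => w /=.
    move=> H; apply/count_eq0 => j p jp [k _]; rewrite /F; case: ifPn => // kn.
    move=> [/= [_ /andP[_ pa]] [_ pK]].
    by have := (vR k w kn).1 (H k kn) j p jp pK; rewrite leNgt pa.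
  move=> /count_eq0 H i iN; apply/vR => // j p jp pK.
  rewrite leNgt; apply/negP => pa; apply: (H j p jp).
  have [p0 pF] := ptsD _ _ _ jp.
  have n0 : (0 < n)%N := leq_ltn_trans (leq0n i) iN.
  (* The least such k is the slice that contains the point. As k >= i, a set hitting [K i] also hits
     [K k]. *)
  have ex : exists k, (i <= k)%N && (a k.+1 <= p.1).
    exists n.-1; rewrite prednK//.
    by rewrite an (ltW p0) andbT -ltnS prednK.
  case: (ex_minnP ex) => k /andP[ik ak] kmin.
  have kn : (k < n)%N.
    rewrite -[X in (_ < X)%N]prednK// ltnS.
    apply: kmin; rewrite prednK// an (ltW p0) andbT.
    by rewrite -ltnS prednK.
  exists k => //; rewrite /F kn; split => /=.
    split => //; rewrite ak /=; move: ik; rewrite leq_eqVlt => /predU1P[<-//|ik].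
    case: k ak kmin kn ik => // k ak kmin kn; rewrite ltnS => ik.
    rewrite ltNge; apply/negP => pk; have := kmin k; rewrite ik pk ltnn.
    by move=> /(_ isT).
  split => //; case: pK => x [px Kx]; exists x; split => //; exact: K_nd Kx.
have mufin : (mu (\bigcup_k F k) < +oo)%E by rewrite muB ltry.
split; first by rewrite AE; exact: (ptsm _ 0%N US mufin).
have Bd (i j : 'I_1) : i != j -> (\bigcup_k F k) `&` (\bigcup_k F k) = set0 by rewrite !ord1.
have := ptsP 1%N (fun=> \bigcup_k F k) (fun=> 0%N) (fun=> US) (fun=> mufin) Bd.
rewrite big_ord_recl big_ord0 mulr1 muB /= /poisson_pmf' expr0 fact0 divr1 mul1r => PE.
rewrite AE -/s mulNr -PE; congr (P _).
by apply/seteqP; split => w; [move=> H j _; exact: H|move=> H; exact: (H ord0 Logic.I)].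
Qed.

End rep.

(** * Finite-dimensional laws against chain laws *)

Section fidi.
Context {R : realType} {E : topologicalType}.
Context d1 (O1 : measurableType d1) (P1 : probability O1 R) (Y1 : O1 -> set E -> \bar R).
Context d2 (O2 : measurableType d2) (P2 : probability O2 R) (Y2 : O2 -> set E -> \bar R).
Context (theta : set E -> R).
Hypotheses (mY1 : forall w, maxitive (Y1 w)) (mY2 : forall w, maxitive (Y2 w)).

Lemma chain_law_event d (O : measurableType d) (P : probability O R)
    (Y : O -> set E -> \bar R) n (K : 'I_n -> set E) (v : 'I_n -> R) (L : nat -> set E)
    (u : nat -> R) : (forall w, maxitive (Y w)) -> chain_law P Y theta ->
  (forall i, compact (L i)) -> (forall i j, (i <= j)%N -> L i `<=` L j) ->
  (forall i j, (i <= j)%N -> u j <= u i) -> u n = 0 ->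
  (forall phi, maxitive phi -> forall t, 0 <= t ->
    (forall j, ((v j)%:E * phi (K j) <= t%:E)%E) <->
    (forall i, (i < n)%N -> ((u i)%:E * phi (L i) <= t%:E)%E)) ->
  measurable [set w | forall j, ((v j)%:E * Y w (K j) <= 1%:E)%E] /\
  P [set w | forall j, ((v j)%:E * Y w (K j) <= 1%:E)%E] =
    (expR (- (\sum_(i < n) (u i - u i.+1) * theta (L i)) / 1))%:E.
Proof.
move=> mY cY cL L_nd u_ni un LE.
have := cY n L u cL L_nd u_ni un 1 ltr01 => /=.
rewrite (_ : [set w | forall i, _ -> _] =
  [set w | forall j, ((v j)%:E * Y w (K j) <= 1%:E)%E])//.
by apply/seteqP; split => w /= H; apply/(LE _ (mY w) _ ler01).
Qed.

Lemma near_le_add (x : \bar R) (c : R) :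
  (0 <= x)%E -> \forall m \near \oo, (x <= (c + m.+1%:R^-1)%:E)%E <-> (x <= c%:E)%E.
Proof.
move=> x0; have [xc|xc] := pselect (x <= c%:E)%E.
  apply: nearW => m; split => // _; apply: le_trans xc _.
  by rewrite lee_fin lerDl invr_ge0.
have [e e0 xe] : exists2 e : R, 0 < e & ~ (x <= c%:E + e%:E)%E.
  apply: contrapT => H; apply: xc; apply/lee_addgt0Pr => e e0.
  by apply: contrapT => xe; apply: H; exists e.
near=> m; split => // xm; exfalso; apply: xe; apply: le_trans xm _.
rewrite -EFinD lee_fin lerD2l ltW//.
by near: m; exact: (near_infty_natSinv_lt (PosNum e0)).
Unshelve. all: by end_near. Qed.

Lemma chain_law_same_fidi : chain_law P1 Y1 theta -> chain_law P2 Y2 theta ->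
  same_fidi P1 Y1 P2 Y2.
Proof.
move=> cY1 cY2 n K x cK.
have [[j xj]|x0'] := pselect (exists j, x j < 0).
  have E0 d (O : measurableType d) (Y : O -> set E -> \bar R) : (forall w, maxitive (Y w)) ->
      \bigcap_j [set w | (Y w (K j) <= (x j)%:E)%E] = set0.
    move=> mY; apply/seteqP; split => // w /(_ j Logic.I) /= h.
    have := le_trans (maxitive_ge0 (K j) (mY w)) h.
    by rewrite lee_fin leNgt xj.
  by rewrite !E0// !measure0.
have x0 j : 0 <= x j by rewrite leNgt; apply/negP => xj; apply: x0'; exists j.
(* A threshold may be 0 and then corresponds to no finite weight. It is raised by 1 / (m + 1), which
   changes the event at a given w only for finitely many m. *)
pose v m j := (x j + m.+1%:R^-1)^-1.
have xm m j : 0 < x j + m.+1%:R^-1 by rewrite ltr_wpDl// invr_gt0.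
have v0 m j : 0 <= v m j by rewrite invr_ge0 ltW.
pose A d (O : measurableType d) (Y : O -> set E -> \bar R) m :=
  [set w | forall j, ((v m j)%:E * Y w (K j) <= 1%:E)%E].
have AE d (O : measurableType d) (Y : O -> set E -> \bar R) w : (forall w, maxitive (Y w)) ->
    \forall m \near \oo, A d O Y m w <-> (\bigcap_j [set w | (Y w (K j) <= (x j)%:E)%E]) w.
  move=> mY.
  have : \forall m \near \oo, forall j,
      (Y w (K j) <= (x j + m.+1%:R^-1)%:E)%E <-> (Y w (K j) <= (x j)%:E)%E.
    by apply: filter_forall => j; apply: near_le_add; exact: maxitive_ge0.
  apply: filterS => m H; split => [Am j _|Bw j].
    by apply/H; have := Am j; rewrite /v lee_pdivrMl// mule1.
  by rewrite /v lee_pdivrMl// mule1; apply/H; exact: (Bw j Logic.I).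
have [mA1 [mA2 PA]] : (forall m, measurable (A _ _ Y1 m)) /\ (forall m, measurable (A _ _ Y2 m)) /\
    forall m, P1 (A _ _ Y1 m) = P2 (A _ _ Y2 m).
  suff H m : [/\ measurable (A _ _ Y1 m), measurable (A _ _ Y2 m) & P1 (A _ _ Y1 m) = P2 (A _ _ Y2 m)].
    by split; [|split] => m; have [] := H m.
  have [L [u [cL L_nd u_ni un LE]]] := nested_reduction cK (v0 m).
  have [m1 p1] := chain_law_event mY1 cY1 cL L_nd u_ni un LE.
  have [m2 p2] := chain_law_event mY2 cY2 cL L_nd u_ni un LE.
  by split => //; rewrite /A p1 p2.
have n1 w := AE _ _ Y1 w mY1; have n2 w := AE _ _ Y2 w mY2.
have c1 := @probability_cvg _ O1 R P1 _ _ mA1 (measurable_near mA1 n1) n1.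
have c2 := @probability_cvg _ O2 R P2 _ _ mA2 (measurable_near mA2 n2) n2.
rewrite (_ : (fun m => P1 _) = (fun m => P2 (A _ _ Y2 m))) in c1; last first.
  by apply/funext => m; exact: PA.
exact: (cvg_unique _ c1 c2).
Qed.

Lemma same_fidi_chain_law :
  (forall K (x : R), compact K -> measurable [set w | (Y1 w K <= x%:E)%E]) ->
  same_fidi P1 Y1 P2 Y2 -> chain_law P2 Y2 theta -> chain_law P1 Y1 theta.
Proof.
move=> mY fidi cY2 n K v cK K_nd v_ni vn t t0 A.
have v0 i : (i < n)%N -> 0 <= v i by move=> iN; rewrite -vn v_ni// ltnW.
(* A zero weight imposes no condition; it is encoded by the empty set with threshold 0. *)
pose L (i : 'I_n) := if 0 < v i then K i else set0.
pose x (i : 'I_n) := if 0 < v i then t / v i else 0.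
have cL i : compact (L i) by rewrite /L; case: ifP => // _; exact: compact0.
have evE O (Y : O -> set E -> \bar R) : (forall w, maxitive (Y w)) ->
    [set w | forall i, (i < n)%N -> ((v i)%:E * Y w (K i) <= t%:E)%E] =
    \bigcap_j [set w | (Y w (L j) <= (x j)%:E)%E].
  move=> mYY; apply/seteqP; split => w /= H.
    move=> j _ /=; rewrite /L /x; case: ifPn => [vj|_].
      by have := H j (ltn_ord j); rewrite -lee_pdivlMl// mulrC.
    by have [_ -> _] := mYY w.
  move=> i iN; have := H (Ordinal iN) Logic.I; rewrite /= /L /x /=.
  case: ifPn => [vi|].
    by rewrite -lee_pdivlMl// mulrC.
  rewrite -leNgt => vi _; have -> : v i = 0 by apply/eqP; rewrite eq_le vi v0.
  by rewrite mul0e lee_fin ltW.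
rewrite /A evE//; split.
  by apply: countType_bigcap_measurable => j _; exact: mY.
rewrite fidi//; have [_ <-] := cY2 n K v cK K_nd v_ni vn t t0.
by rewrite evE.
Qed.

End fidi.

Lemma random_sup_measure_measurable_le (R : realType) (E : topologicalType)
    d (O : measurableType d) (X : O -> set E -> \bar R) K (x : R) :
  random_sup_measure X -> compact K -> measurable [set w | (X w K <= x%:E)%E].
Proof.
move=> [sX mX _] cK.
pose A m := [set w | (X w K < (x + m.+1%:R^-1)%:E)%E].
rewrite (_ : [set _ | _] = \bigcap_m A m).
  by apply: bigcap_measurableType => m _; exact: mX.
apply/seteqP; split => w /=.
  move=> Xx m _; apply: le_lt_trans Xx _.
  by rewrite lte_fin ltrDl invr_gt0.
move=> H; apply/lee_addgt0Pr => e e0.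
have [m _ /(_ m (leqnn m)) me] := near_infty_natSinv_lt (PosNum e0).
apply: (le_trans (ltW (H m Logic.I))).
by rewrite -EFinD lee_fin lerD2l ltW.
Qed.

(** * Exceedance patterns and the intensity measure *)
Arguments compact_basis_closed {E B} Bc I F _ _ : rename.

Section tail_coefficient.
Context {R : realType} {E : topologicalType}.
Hypotheses (hE : hausdorff_space E) (lcE : locally_compact [set: E])
  (scE : @second_countable E).
Context (B : nat -> set E).
Hypotheses (Bo : forall n, open (B n)) (Bc : forall n, compact (closure (B n)))
  (Bb : forall x U, nbhs x U -> exists n, B n x /\ closure (B n) `<=` U).
Context d (Omega : measurableType d) (P : probability Omega R).
Context (X : Omega -> set E -> \bar R) (theta : set E -> R).
Hypotheses (rX : random_sup_measure X) (cX : chain_law P X theta).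

Let sX w : sup_measure (X w).
Proof. by case: rX. Qed.

Let law1 K (t : R) : compact K -> 0 < t ->
  measurable [set w | (X w K <= t%:E)%E] /\
  P [set w | (X w K <= t%:E)%E] = (expR (- theta K / t))%:E.
Proof.
move=> cK t0; have := chain_law1 cX cK ler01 t0; rewrite mul1r.
by rewrite (_ : [set w | (1%:E * X w K <= t%:E)%E] = [set w | (X w K <= t%:E)%E])//;
  apply/seteqP; split => w /=; rewrite mul1e.
Qed.

Let theta_ge0 K : compact K -> 0 <= theta K.
Proof. exact: chain_law_ge0 cX K. Qed.

Let theta_mono K L : compact K -> compact L -> K `<=` L -> theta K <= theta L.
Proof. exact: chain_law_mono rX cX K L. Qed.

(** If [theta] stayed above theta(K) + e along compacts C n decreasing to K, the events X(C n) <= 1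
    would have probability at most exp(- (theta(K) + e)). Their union contains X(K) <= s for s < 1,
    which is more likely when s is close to 1. *)
Lemma theta_outer K (e : R) : compact K -> 0 < e ->
  exists I, K `<=` basis_open B I /\ theta (basis_closed B I) < theta K + e.
Proof.
move=> cK e0; have [C [G [cC Cnd CK GP]]] := compact_outer_seq hE Bo Bc Bb cK.
suff [n Cn] : exists n, theta (C n) < theta K + e.
  have [Go KG GC] := GP n.
  have [I [KI IG]] := basis_interpolation Bo Bb cK Go KG.
  exists I; split => //; apply: le_lt_trans Cn; apply: theta_mono => //.
  - exact: compact_basis_closed.
  - exact: subset_trans IG GC.
apply: contrapT => nC; have {}nC n : theta K + e <= theta (C n).
  by rewrite leNgt; apply/negP => h; apply: nC; exists n.
have K0 := theta_ge0 cK.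
(* Chosen so that s < 1 and theta(K) / s < theta(K) + e. Strictness is needed because X(C n) > 1 for
   all n only gives X(K) >= 1 in the limit. *)
pose s := (theta K + e / 2) / (theta K + e).
have de : 0 < theta K + e by lra.
have s0 : 0 < s by rewrite divr_gt0//; lra.
have s1 : s < 1 by rewrite ltr_pdivrMr//; lra.
pose A n := [set w | (X w (C n) <= 1%:E)%E].
have mA n : measurable (A n) := (law1 (cC n) ltr01).1.
have nd : nondecreasing_seq A.
  move=> n m nm; apply/subsetPset => w; apply: le_trans.
  by apply: (sup_measure_mono (sX w)); exact: Cnd.
have mU : measurable (\bigcup_n A n) by exact: bigcupT_measurable.
have c1 : P (A n) @[n --> \oo] --> P (\bigcup_n A n) by exact: nondecreasing_cvg_mu.
have UP : (P (\bigcup_n A n) <= (expR (- (theta K + e)))%:E)%E.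
  rewrite -(cvg_lim _ c1)//; apply: lime_le; first exact: cvgP c1.
  apply: nearW => n; rewrite /A (law1 (cC n) ltr01).2 lee_fin divr1 ler_expR lerN2.
  exact: nC.
have [mK PK] := law1 cK s0.
have : (P [set w | (X w K <= s%:E)%E] <= P (\bigcup_n A n))%E.
  apply: le_measure; rewrite ?inE// => w /= Ks.
  apply: contrapT => nA.
  have Cw n : (1%:E <= X w (C n))%E.
    by apply: ltW; rewrite ltNge; apply/negP => h; apply: nA; exists n.
  have cv := sup_measure_cvg (sX w) cC Cnd; rewrite CK in cv.
  have : (1%:E <= X w K)%E.
    rewrite -(cvg_lim _ cv)//; apply: lime_ge; first exact: cvgP cv.
    exact: nearW.
  by move=> /le_trans/(_ Ks); rewrite lee_fin leNgt s1.
move=> /le_trans/(_ UP); rewrite PK lee_fin ler_expR mulNr lerN2 leNgt => /negP; apply.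
rewrite /s invf_div mulrA ltr_pdivrMr; last lra.
by rewrite mulrC ltr_pM2l//; lra.
Qed.

Let exceed (t : R) (i : nat) (w : Omega) : bool := (t%:E < X w (closure (B i)))%E.

Fixpoint exceedances (t : R) (w : Omega) (n : nat) : seq bool :=
  if n is n'.+1 then exceed t n' w :: exceedances t w n' else [::].

Let size_exceedances t w n : size (exceedances t w n) = n.
Proof. by elim: n => //= n ->. Qed.

Let nth_exceedances t w n i : (i < n)%N ->
  nth false (exceedances t w n) (n - i.+1) = exceed t i w.
Proof.
elim: n => // n IH; rewrite ltnS leq_eqVlt => /predU1P[->|iN].
  by rewrite subnn.
by rewrite -(IH iN) subSS -(subnSK iN).
Qed.

Let event t s := [set w | exceedances t w (size s) = s].

Let measurable_exceed t i b : 0 < t -> measurable [set w | exceed t i w = b].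
Proof.
move=> t0; have [mA _] := law1 (@Bc i) t0.
case: b.
  rewrite (_ : mkset _ = ~` [set w | (X w (closure (B i)) <= t%:E)%E]).
    exact: measurableC.
  by apply/seteqP; split => w /=; rewrite /exceed ltNge; [move/negP|move=> h; apply/negP].
rewrite (_ : mkset _ = [set w | (X w (closure (B i)) <= t%:E)%E])//.
by apply/seteqP; split => w /=; rewrite /exceed leNgt => /negP; [move=> h; apply/negP|move=> /negP/negbTE].
Qed.

Let event_cons t b s : event t (b :: s) = [set w | exceed t (size s) w = b] `&` event t s.
Proof.
by apply/seteqP; split => w; rewrite /event /= => -[-> ->].
Qed.

Let measurable_event t s : 0 < t -> measurable (event t s).
Proof.
move=> t0; elim: s => [|b s IH].
  by rewrite (_ : event t [::] = setT)//; apply/seteqP.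
rewrite event_cons; apply: measurableI => //; exact: measurable_exceed.
Qed.

Let none t (Z : seq nat) := [set w | (X w (basis_closed B Z) <= t%:E)%E].
Let joint t (A Z : seq nat) := [set w | forall a, a \in A -> exceed t a w] `&` none t Z.

Let noneE t Z w : 0 < t -> none t Z w <-> forall z, z \in Z -> ~~ exceed t z w.
Proof.
move=> t0; have := maxitive_bigU Z (sup_measure_maxitive hE lcE scE (sX w))
  Bc (ltW t0) ler01.
rewrite -bigcup_seq mul1e => H; rewrite /none /=; split.
  by move=> /H h z /h; rewrite mul1e /exceed -leNgt.
by move=> h; apply/H => z /h; rewrite mul1e /exceed -leNgt.
Qed.

Let measurable_none t Z : 0 < t -> measurable (none t Z).
Proof. by move=> t0; have [] := law1 (compact_basis_closed Bc Z) t0. Qed.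

Let measurable_joint t A Z : 0 < t -> measurable (joint t A Z).
Proof.
move=> t0; apply: measurableI; last exact: measurable_none.
rewrite (_ : mkset _ = \bigcap_(a in [set` A]) [set w | exceed t a w = true])//.
by apply: bigcap_measurableType => a _; exact: measurable_exceed.
Qed.

Let scaled_none (Z : seq nat) (n : nat) : R :=
  n.+1%:R * (1 - fine (P (none n.+1%:R Z))).

Let cvg_scaled_none Z : scaled_none Z n @[n --> \oo] --> theta (basis_closed B Z).
Proof.
have cZ := compact_basis_closed Bc Z.
have th0 := theta_ge0 cZ; set th := theta _ in th0 *.
have E1 n : scaled_none Z n = n.+1%:R * (1 - expR (- th / n.+1%:R)).
  by rewrite /scaled_none (law1 cZ (ltr0Sn R n)).2.
have lim0 : th / n.+1%:R @[n --> \oo] --> (0 : R).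
  rewrite -(mulr0 th); apply: cvgM; first exact: cvg_cst.
  exact: cvg_harmonic.
(* This lower bound comes from exp(- x) <= 1 / (1 + x) at x = th / n, and the upper bound from exp(-
   x) >= 1 - x. *)
have lo : th / (1 + th / n.+1%:R) @[n --> \oo] --> th.
  rewrite -[X in _ --> X]divr1; apply: cvgM; first exact: cvg_cst.
  apply: cvgV; first exact: oner_neq0.
  rewrite -[X in _ --> X]addr0; apply: cvgD => //; exact: cvg_cst.
apply: (squeeze_cvgr _ lo (cvg_cst th)); apply: nearW => n; rewrite E1.
have n0 : 0 < n.+1%:R :> R by rewrite ltr0Sn.
set x := th / n.+1%:R; have x0 : 0 <= x by rewrite divr_ge0// ltW.
have thE : th = n.+1%:R * x by rewrite /x mulrC divfK// gt_eqF.
have -> : - th / n.+1%:R = - x by rewrite mulNr.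
clearbody x; rewrite thE -mulrA !ler_pM2l//; apply/andP; split; last first.
  by have := expR_ge1Dx (- x); lra.
have ex : expR (- x) <= (1 + x)^-1.
  by rewrite expRN lef_pV2 ?posrE ?expR_gt0//; [exact: expR_ge1Dx|lra].
have -> : x / (1 + x) = 1 - (1 + x)^-1 by field; lra.
by lra.
Qed.

(** Inclusion-exclusion: requiring an exceedance at a means removing the event that a joins the sets
    without exceedance. For a single exceedance this is a difference of two terms [scaled_none],
    where the divergent parts cancel; hence A must be nonempty. *)
Let cvg_joint A Z : A != [::] ->
  cvgn (fun n : nat => n.+1%:R * fine (P (joint n.+1%:R A Z)) : R).
Proof.
elim: A Z => // a A IH Z _; have [A0|A0] := eqVneq A [::].
  have E1 : (fun n : nat => n.+1%:R * fine (P (joint n.+1%:R [:: a] Z)) : R) =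
      (fun n => scaled_none (a :: Z) n - scaled_none Z n).
    apply/funext => n; rewrite /scaled_none -mulrBr; congr (_ * _).
    have n0 := ltr0Sn R n.
    have -> : joint n.+1%:R [:: a] Z = none n.+1%:R Z `\` none n.+1%:R (a :: Z).
      apply/seteqP; split => w; rewrite /joint /=.
        move=> [h hZ]; split => // /noneE/(_ a) => /(_ n0); rewrite mem_head => /(_ isT).
        by rewrite h ?mem_head.
      move=> [hZ haZ]; split => // b; rewrite inE => /eqP ->.
      apply: contrapT => /negP na; apply: haZ; apply/noneE => // z.
      by rewrite inE => /predU1P[->//|]; move/noneE : hZ => /(_ n0); exact.
    have m1 := measurable_none Z n0; have m2 := measurable_none (a :: Z) n0.
    have sub : none n.+1%:R (a :: Z) `<=` none n.+1%:R Z.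
      by move=> w /noneE h; apply/noneE => // z zZ; apply: h => //; rewrite inE zZ orbT.
    have D : P (none n.+1%:R Z `\` none n.+1%:R (a :: Z)) =
        (P (none n.+1%:R Z) - P (none n.+1%:R Z `&` none n.+1%:R (a :: Z)))%E.
      by apply: measureD => //; apply: le_lt_trans (probability_le1 _ _) (ltry _).
    rewrite D setIidr// fineB ?fin_num_measure//.
    by ring.
  rewrite A0 E1; apply: cvgP; apply: cvgB; exact: cvg_scaled_none.
have E1 : (fun n : nat => n.+1%:R * fine (P (joint n.+1%:R (a :: A) Z)) : R) =
    (fun n => n.+1%:R * fine (P (joint n.+1%:R A Z)) -
              n.+1%:R * fine (P (joint n.+1%:R A (a :: Z)))).
  apply/funext => n; rewrite -mulrBr; congr (_ * _).
  have n0 := ltr0Sn R n.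
  have -> : joint n.+1%:R (a :: A) Z = joint n.+1%:R A Z `\` joint n.+1%:R A (a :: Z).
    apply/seteqP; split => w; rewrite /joint /=.
      move=> [h hZ]; split.
        by split => // b bA; apply: h; rewrite inE bA orbT.
      move=> [_ /noneE/(_ a)] => /(_ n0); rewrite mem_head => /(_ isT).
      by rewrite h ?mem_head.
    move=> [[hA hZ] haZ]; split => // b; rewrite inE => /predU1P[->|]; last exact: hA.
    apply: contrapT => /negP na; apply: haZ; split => //; apply/noneE => // z.
    by rewrite inE => /predU1P[->//|]; move/noneE : hZ => /(_ n0); exact.
  have m1 := measurable_joint A Z n0; have m2 := measurable_joint A (a :: Z) n0.
  have sub : joint n.+1%:R A (a :: Z) `<=` joint n.+1%:R A Z.
    move=> w [hA /noneE h]; split => //; apply/noneE => // z zZ; apply: h => //.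
    by rewrite inE zZ orbT.
  have D : P (joint n.+1%:R A Z `\` joint n.+1%:R A (a :: Z)) =
      (P (joint n.+1%:R A Z) - P (joint n.+1%:R A Z `&` joint n.+1%:R A (a :: Z)))%E.
    by apply: measureD => //; apply: le_lt_trans (probability_le1 _ _) (ltry _).
  by rewrite D setIidr// fineB ?fin_num_measure.
rewrite E1; apply: is_cvgB; exact: IH.
Qed.

Let ones := fix ones (s : seq bool) : seq nat :=
  if s is b :: s' then if b then size s' :: ones s' else ones s' else [::].
Let zeros := fix zeros (s : seq bool) : seq nat :=
  if s is b :: s' then if b then zeros s' else size s' :: zeros s' else [::].

Let event_joint t s : 0 < t -> event t s = joint t (ones s) (zeros s).
Proof.
move=> t0; elim: s => [|b s IH].
  apply/seteqP; split => w // _; split => //=.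
  by apply/noneE.
rewrite event_cons IH; case: b => /=; apply/seteqP; split => w.
- move=> [ws [h1 h2]]; split => // i; rewrite inE => /predU1P[->//|]; exact: h1.
- move=> [h1 h2]; split; first by apply: h1; rewrite mem_head.
  by split => // i si; apply: h1; rewrite inE si orbT.
- move=> [ws [h1 h2]]; split => //; apply/noneE => // i.
  by rewrite inE => /predU1P[->|]; [rewrite ws|move/noneE : h2 => /(_ t0); exact].
- move=> [h1 /noneE h2]; split; first by apply/negbTE/h2; rewrite ?mem_head.
  split => //; apply/noneE => // z zs; apply: h2 => //.
  by rewrite inE zs orbT.
Qed.

Let mass_seq (s : seq bool) (n : nat) : R := n.+1%:R * fine (P (event n.+1%:R s)).

(* [limn] is junk when s has no [true] entry: the normalised probability that no
   exceedance occurs diverges. *)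
Definition tail_mass (s : seq bool) : R := limn (mass_seq s).

Let cvg_mass s : has id s -> mass_seq s n @[n --> \oo] --> tail_mass s.
Proof.
move=> hs; have := @cvg_joint (ones s) (zeros s).
rewrite (_ : (fun n : nat => _) = mass_seq s).
  apply; move: hs; elim: s => //= b s IH; case: b => //=; exact: IH.
by apply/funext => n; rewrite /mass_seq event_joint.
Qed.

Lemma tail_mass_ge0 s : has id s -> 0 <= tail_mass s.
Proof.
move=> hs; apply: limr_ge; first exact: cvg_mass.
by apply: nearW => n; rewrite mulr_ge0// fine_ge0.
Qed.

Lemma tail_mass_split s : has id s ->
  tail_mass s = tail_mass (true :: s) + tail_mass (false :: s).
Proof.
move=> hs; have h1 : has id (true :: s) by [].
have h2 : has id (false :: s) by [].
apply: (cvg_unique _ (cvg_mass hs)) => //.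
rewrite (_ : mass_seq s = fun n => mass_seq (true :: s) n + mass_seq (false :: s) n).
  by apply: cvgD; exact: cvg_mass.
apply/funext => n; rewrite /mass_seq -mulrDr; congr (_ * _).
have n0 := ltr0Sn R n.
have m1 := measurable_event (true :: s) n0; have m2 := measurable_event (false :: s) n0.
have D : event n.+1%:R (true :: s) `&` event n.+1%:R (false :: s) = set0.
  by rewrite !event_cons -subset0 => w [[/= -> _] []].
have U : P (event n.+1%:R (true :: s) `|` event n.+1%:R (false :: s)) =
  (P (event n.+1%:R (true :: s)) + P (event n.+1%:R (false :: s)))%E.
  by apply: measureU.
rewrite -fineD ?fin_num_measure// -U.
congr (fine (P _)); rewrite !event_cons; apply/seteqP; split => w.
  by move=> ws; case e : (exceed n.+1%:R (size s) w); [left|right].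
by move=> [[]|[]].
Qed.

(** The patterns meeting I partition the event that some closure indexed by I is exceeded. Before
    the limit their masses add up to [scaled_none I], whose limit is known from the law of X on one
    compact set. *)
Lemma lebesgue_tree_hits (I : seq nat) :
  lebesgue_measure ([set v | 0 <= v /\ has (fun i => tree_bit tail_mass i v) I] : set R) =
  (theta (basis_closed B I))%:E.
Proof.
have [n In] : exists n, forall i, i \in I -> (i < n)%N.
  by exists (\max_(i <- I) i).+1 => i iI; rewrite ltnS; apply: leq_bigmax_seq.
pose Q (s : n.-tuple bool) := has (fun i => nth false s (n - i.+1)) I.
have Qh (s : n.-tuple bool) : Q s -> has id s.
  move=> /hasP[i iI si]; apply/hasP; exists (nth false s (n - i.+1)) => //.
  by apply: mem_nth; rewrite size_tuple ltn_subrL (leq_ltn_trans _ (In i iI)).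
transitivity (lebesgue_measure ([set v | 0 <= v /\
    exists2 s : n.-tuple bool, Q s & tree_path tail_mass v n = s] : set R)).
  congr lebesgue_measure; apply/seteqP; split => v /= [v0].
    move=> /hasP[i iI vi]; split => //.
    have sz : size (tree_path tail_mass v n) == n by rewrite size_tree_path.
    exists (Tuple sz) => //; apply/hasP; exists i => //=.
    by rewrite nth_tree_path// In.
  move=> [s /hasP[i iI si] vs]; split => //; apply/hasP; exists i => //.
  by rewrite -(nth_tree_path tail_mass v (In i iI)) vs.
rewrite (lebesgue_tree_path tail_mass_ge0 tail_mass_split Qh); congr EFin.
have c1 : \sum_(s | Q s) mass_seq s n @[n --> \oo] --> \sum_(s | Q s) tail_mass s.
  apply: cvg_big => [|s Qs]; [exact: add_continuous|exact: cvg_mass (Qh s Qs)].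
have c2 := @cvg_scaled_none I.
apply: (cvg_unique _ c1) => //.
rewrite (_ : (fun n => \sum_(s | Q s) mass_seq s n) = scaled_none I)//.
apply/funext => k; rewrite /mass_seq -mulr_sumr /scaled_none; congr (_ * _).
have k0 := ltr0Sn R k.
have m1 := measurable_none I k0.
have -> : 1 - fine (P (none k.+1%:R I)) = fine (P (~` none k.+1%:R I)).
  by rewrite probability_setC// fineB ?fin_num_measure.
have -> : ~` none k.+1%:R I = [set w | exists2 s : n.-tuple bool, Q s & event k.+1%:R s w].
  apply/seteqP; split => w.
    move=> nI.
    have sz : size (exceedances k.+1%:R w n) == n by rewrite size_exceedances.
    exists (Tuple sz); last by rewrite /event /= size_exceedances.
    apply: contrapT => /negP /hasPn nQ; apply: nI; apply/noneE => // i iI.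
    by have := nQ i iI; rewrite /= nth_exceedances// In.
  move=> [s /hasP[i iI si]]; rewrite /event /= size_tuple => ws /noneE => /(_ k0)/(_ i iI).
  by rewrite -(nth_exceedances k.+1%:R w (In i iI)) ws si.
rewrite (@probability_fibers _ Omega R P _ Q (fun s : n.-tuple bool => event k.+1%:R s)).
- rewrite (eq_bigr (fun s : n.-tuple bool => (fine (P (event k.+1%:R s)))%:E)) ?sumEFin//.
  by move=> s _; rewrite fineK// fin_num_measure//; exact: measurable_event.
- by move=> s _; exact: measurable_event.
- move=> s s' w _ _; rewrite /event /= !size_tuple => -> ss; exact: val_inj.
Qed.

End tail_coefficient.

(** * The closed set coded by a point of the half-line *)

Section random_closed_set.
Context {R : realType} {E : topologicalType}.
Context (B : nat -> set E).
Hypotheses (Bo : forall n, open (B n)) (Bc : forall n, compact (closure (B n)))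
  (Bb : forall x U, nbhs x U -> exists n, B n x /\ closure (B n) `<=` U).
Context (m : seq bool -> R) (theta : set E -> R).
Hypothesis m_ge0 : forall s, has id s -> 0 <= m s.
Hypothesis m_split : forall s, has id s -> m s = m (true :: s) + m (false :: s).
Local Notation lam := (@lebesgue_measure R).

Definition hits_basis (I : seq nat) : set R :=
  [set v | 0 <= v /\ has (fun i => tree_bit m i v) I].

Definition carrier (v : R) : set E := [set x | forall i, B i x -> tree_bit m i v].

Lemma measurable_hits_basis I : measurable (hits_basis I : set R).
Proof.
elim: I => [|i I IH].
  by rewrite (_ : hits_basis [::] = set0)// -subset0 => v [].
rewrite (_ : hits_basis (i :: I) =
  [set v | 0 <= v /\ tree_bit m i v = true] `|` hits_basis I).
  by apply: measurableU => //; exact: measurable_tree_bit.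
apply/seteqP; split => v; rewrite /hits_basis /=.
  by move=> [v0 /orP[vi|vI]]; [left|right].
by move=> [|] [v0 ->]; rewrite ?orbT.
Qed.

Lemma carrier_closed v : closed (carrier v).
Proof.
rewrite (_ : carrier v = ~` \bigcup_(i in [set i | ~~ tree_bit m i v]) B i).
  by apply: open_closedC; apply: bigcup_open => i _; exact: Bo.
apply/seteqP; split => x.
  by move=> cx [i /= /negP vi Bx]; apply: vi; exact: cx.
by move=> nx i Bx; apply: contrapT => /negP vi; apply: nx; exists i.
Qed.

(** If the closed set misses K, each point of K lies in a basic set with bit 0, and compactness
    extracts a finite cover all of whose bits are 0. *)
Lemma carrier_hitP K v : compact K ->
  carrier v `&` K !=set0 <->
  forall I, K `<=` basis_open B I -> has (fun i => tree_bit m i v) I.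
Proof.
move=> cK; split.
  move=> [x [cx Kx]] I /(_ x Kx)[i iI Bx]; apply/hasP; exists i => //.
  exact: cx.
move=> H; apply: contrapT => nK.
have [x Kx|I [ID KI]] := compact_basis_subcover Bo (D := [set i | ~~ tree_bit m i v]) cK.
  apply: contrapT => nx; apply: nK; exists x; split => // i Bx.
  by apply: contrapT => /negP vi; apply: nx; exists i.
have /hasP[i iI vi] := H I KI.
by have /= := ID i iI; rewrite vi.
Qed.

Let hits (K : set E) : set R := [set v | 0 <= v /\ carrier v `&` K !=set0].

Let cover_enum K : compact K -> exists J : nat -> seq nat,
  [/\ forall n, K `<=` basis_open B (J n) &
      forall I, K `<=` basis_open B I -> exists n, J n = I].
Proof.
move=> cK; have [I0 [KI0 _]] := basis_interpolation Bo Bb cK openT (@subsetT _ _).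
pose J k := if (unpickle k : option (seq nat)) is Some L then
  if `[< K `<=` basis_open B L >] then L else I0 else I0.
exists J; split => [n|I KI].
  by rewrite /J; case: unpickle => // I; case: asboolP.
by exists (pickle I); rewrite /J pickleK; case: asboolP.
Qed.

Let hitsE K (J : nat -> seq nat) : compact K -> (forall n, K `<=` basis_open B (J n)) ->
  (forall I, K `<=` basis_open B I -> exists n, J n = I) ->
  hits K = \bigcap_n hits_basis (J n).
Proof.
move=> cK KJ Jex; apply/seteqP; split => v.
  by move=> [v0 /carrier_hitP H] n _; split => //; exact: H.
move=> H; have [v0 _] := H 0%N Logic.I; split => //; apply/carrier_hitP => // I KI.
by have [n <-] := Jex I KI; have [] := H n Logic.I.
Qed.

Let measurable_hits K : compact K -> measurable (hits K).
Proof.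
move=> cK; have [J [KJ Jex]] := cover_enum cK; rewrite (hitsE cK KJ Jex).
by apply: bigcap_measurableType => n _; exact: measurable_hits_basis.
Qed.

Lemma measurable_carrier C : Fsigma C ->
  measurable ([set v | 0 <= v /\ C (carrier v)] : set R).
Proof.
apply: (@smallest_sub _ _ _
    [set C | measurable ([set v | 0 <= v /\ C (carrier v)] : set R)]); last first.
  move=> _ [K cK <-] /=; have := measurable_hits cK.
  rewrite (_ : hits K = [set v | 0 <= v /\ hit K (carrier v)])//.
  apply/seteqP; split => v [v0 h]; split => //; last by case: h.
  split => //; split; first exact: carrier_closed.
  by case: h => x []; exists x.
split => /=.
- by rewrite (_ : mkset _ = set0)// -subset0 => v [].
(* Complements are relative to [Fprime], so the set of v with nonempty [carrier] is needed. It is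
   measurable because the closures of the basic sets cover E. *)
- move=> A mA; rewrite (_ : mkset _ =
    (\bigcup_n hits (closure (B n))) `\` [set v | 0 <= v /\ A (carrier v)]).
    apply: measurableD => //; apply: bigcupT_measurable => n.
    by apply: measurable_hits; exact: Bc.
  apply/seteqP; split => v /=.
    move=> [v0 [[_ [x cx]] nA]]; split; last by case.
    have [n [Bx _]] := Bb (@filterT _ (nbhs x) _).
    by exists n => //; split => //; exists x; split => //; exact: subset_closure.
  move=> [[n _ [v0 [x [cx _]]]] nA]; split => //; split; last by move=> h; apply: nA.
  by split; [exact: carrier_closed|exists x].
- move=> F mF; rewrite (_ : mkset _ =
    \bigcup_n [set v | 0 <= v /\ F n (carrier v)]).
    exact: bigcupT_measurable.
  apply/seteqP; split => v /=; first by move=> [v0 [n _ Fn]]; exists n.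
  by move=> [n _ [v0 Fn]]; split => //; exists n.
Qed.

Definition carrier_law (C : set (set E)) : \bar R :=
  lam [set v | 0 <= v /\ C (carrier v)].

Lemma measure_on_carrier_law : measure_on (@Fsigma E) carrier_law.
Proof.
split.
- by rewrite /carrier_law (_ : mkset _ = set0) ?measure0// -subset0 => v [].
- by move=> C _; exact: measure_ge0.
- move=> F mF tF mU; rewrite /carrier_law.
  have E1 : [set v | 0 <= v /\ (\bigcup_n F n) (carrier v)] =
      \bigcup_n [set v | 0 <= v /\ F n (carrier v)].
    apply/seteqP; split => v /=; first by move=> [v0 [n _ Fn]]; exists n.
    by move=> [n _ [v0 Fn]]; split => //; exists n.
  rewrite E1; apply: (@measure_sigma_additive _ _ _ lam
      (fun n => [set v | 0 <= v /\ F n (carrier v)] : set R)).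
    by move=> n; apply: measurable_carrier; exact: mF.
  apply/trivIsetP => i j _ _ ij; rewrite -subset0 => v [[_ Fi] [_ Fj]].
  by have := (trivIsetP.1 tF) i j Logic.I Logic.I ij; rewrite -subset0 => /(_ (carrier v)); apply.
Qed.

Hypothesis hits_theta : forall I, lam (hits_basis I) = (theta (basis_closed B I))%:E.
Hypothesis theta_mono : forall K L, compact K -> compact L -> K `<=` L ->
  theta K <= theta L.
Hypothesis theta_outer : forall K e, compact K -> 0 < e ->
  exists I, K `<=` basis_open B I /\ theta (basis_closed B I) < theta K + e.

(** Adding the indices of I to J does not enlarge the union of closures, so the sets hit by I ++ J
    and by J have the same finite measure. Nothing in the tree forces the inclusion at every v. *)
Let hits_ae I J : basis_closed B I `<=` basis_open B J ->
  lam.-negligible (hits_basis I `\` hits_basis J).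
Proof.
move=> IJ; have mI := measurable_hits_basis I; have mJ := measurable_hits_basis J.
have mD : measurable (hits_basis I `\` hits_basis J) by exact: measurableD.
apply/negligibleP => //.
have E1 : hits_basis (I ++ J) = hits_basis J `|` (hits_basis I `\` hits_basis J).
  apply/seteqP; split => v; rewrite /hits_basis /= has_cat.
    move=> [v0 /orP[vI|vJ]]; last by left.
    by case h : (has (tree_bit m ^~ v) J); [left|right; split => // -[]].
  by move=> [[v0 ->]|[[v0 ->] _]]; rewrite ?orbT.
have : lam (hits_basis (I ++ J)) = lam (hits_basis J).
  rewrite !hits_theta; congr (theta _)%:E; apply/seteqP; split.
    move=> x [i /=]; rewrite mem_cat => /orP[iI|iJ] Bx; last by exists i.
    by apply: basis_open_closed; apply: IJ; exists i.
  by move=> x [i /= iJ Bx]; exists i => //=; rewrite mem_cat iJ orbT.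
have U : lam (hits_basis J `|` (hits_basis I `\` hits_basis J)) =
    (lam (hits_basis J) + lam (hits_basis I `\` hits_basis J))%E.
  by apply: measureU => //; rewrite -subset0 => v [h []].
have cancel (a : R) (y : \bar R) : (a%:E + y = a%:E)%E -> y = 0%E.
  by move: y => [r|//|//] [] /eqP; rewrite -subr_eq0 addrAC subrr add0r => /eqP ->.
by rewrite E1 U hits_theta => /cancel.
Qed.

(** Upper bound: a hit of K is a hit of every basic cover, and [theta_outer] supplies nearly optimal
    ones. Lower bound: finitely many covers admit a common closed basic refinement still covering K,
    whose hits are almost surely hits of each of them; continuity from above concludes. *)
Lemma carrier_law_hit K : compact K -> carrier_law (hit K) = (theta K)%:E.
Proof.
move=> cK; rewrite /carrier_law (_ : mkset _ = hits K); last first.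
  apply/seteqP; split => v [v0 h]; split => //; first by case: h.
  split => //; split; first exact: carrier_closed.
  by case: h => x []; exists x.
have mK := measurable_hits cK.
apply/eqP; rewrite eq_le; apply/andP; split.
  apply/lee_addgt0Pr => e e0; have [I [KI Ie]] := theta_outer cK e0.
  apply: (@le_trans _ _ (lam (hits_basis I))).
    apply: le_measure; rewrite ?inE//; first exact: measurable_hits_basis.
    by move=> v [v0 /carrier_hitP h]; split => //; exact: h.
  by rewrite hits_theta -EFinD lee_fin ltW.
have [J [KJ Jex]] := cover_enum cK; rewrite (hitsE cK KJ Jex).
pose H n := \bigcap_(k in [set k | (k <= n)%N]) hits_basis (J k).
have mH n : measurable (H n).
  by apply: bigcap_measurableType => k _; exact: measurable_hits_basis.
have Hnd : nonincreasing_seq H.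
  by move=> n n' nn'; apply/subsetPset => v Hv k /= kn; apply: Hv; exact: leq_trans nn'.
have HE : \bigcap_n hits_basis (J n) = \bigcap_n H n.
  apply/seteqP; split => v h n _; first by move=> k _; exact: h.
  exact: (h n Logic.I n (leqnn n)).
have H_theta n : ((theta K)%:E <= lam (H n))%E.
  have oU : open (\bigcap_(k in [set k | (k <= n)%N]) basis_open B (J k)).
    rewrite (_ : mkset _ = `I_n.+1)// bigcap_mkord.
    elim/big_ind : _ => //; first exact: openT.
      by move=> ? ?; exact: openI.
    by move=> i _; exact: open_basis_open.
  have KU : K `<=` \bigcap_(k in [set k | (k <= n)%N]) basis_open B (J k).
    by move=> x Kx k _; exact: KJ.
  have [I [KI IU]] := basis_interpolation Bo Bb cK oU KU.
  apply: (@le_trans _ _ (lam (hits_basis I))).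
    rewrite hits_theta lee_fin; apply: theta_mono => //.
      by apply: compact_basis_closed; exact: Bc.
    by move=> x /KI; exact: basis_open_closed.
  have N : lam.-negligible (hits_basis I `\` H n).
    apply: (@negligibleS _ _ _ lam (\bigcup_(k in `I_n.+1) (hits_basis I `\` hits_basis (J k)))).
      move=> v [Iv /existsNP[k /not_implyP[kn nk]]]; exists k => //.
    rewrite bigcup_mkord; elim/big_ind : _ => //; first exact: negligible_set0.
      by move=> ? ?; exact: negligibleU.
    by move=> k _; apply: hits_ae => x /IU h; apply: (h (nat_of_ord k)); rewrite /= -ltnS.
  have mI := measurable_hits_basis I.
  have mD : measurable (hits_basis I `\` H n) by exact: measurableD.
  have D0 : lam (hits_basis I `\` H n) = 0%E by apply/negligibleP.
  apply: (@le_trans _ _ (lam (H n `|` (hits_basis I `\` H n)))).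
    apply: le_measure; [exact/mem_set|apply/mem_set; exact: measurableU (mH n) mD|].
    by move=> v Iv; have [Hv|Hv] := pselect (H n v); [left|right].
  apply: le_trans (measureU2 lam (mH n) mD) _.
  by rewrite [X in (_ + X)%E](_ : _ = 0%E) ?adde0.
rewrite HE; have c : lam (H n) @[n --> \oo] --> lam (\bigcap_n H n).
  apply: nonincreasing_cvg_mu => //.
    apply: (@le_lt_trans _ _ (lam (hits_basis (J 0%N)))).
      have m0 := mH 0%N; have mJ := measurable_hits_basis (J 0%N).
      apply: le_measure; [exact/mem_set|exact/mem_set|].
      by move=> v h; exact: h 0%N isT.
    by rewrite hits_theta ltry.
  exact: bigcapT_measurable.
rewrite -(cvg_lim _ c)//; apply: lime_ge; first exact: cvgP c.
exact: nearW.
Qed.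

End random_closed_set.

Lemma measure_bigcupT d (T : measurableType d) (R : realType)
    (mu : {measure set T -> \bar R}) (F : nat -> set T) :
  (forall n, measurable (F n)) -> trivIset setT F ->
  mu (\bigcup_n F n) = (\sum_(0 <= n <oo) mu (F n))%E.
Proof.
move=> mF tF; rewrite measure_bigcup//.
by apply: eq_eseriesl => n; rewrite in_setT.
Qed.

(** The factor y may be +oo, as nu of a measurable class can be infinite; the convention 0 * +oo = 0
    makes the identity survive. *)
Lemma nneseriesM (R : realType) (f : nat -> \bar R) (y : \bar R) :
  (forall i, (0 <= f i)%E) -> (0 <= y)%E ->
  (\sum_(0 <= i <oo) (f i * y) = (\sum_(0 <= i <oo) f i) * y)%E.
Proof.
move=> f0; case: y => [r|_|//].
  by move=> _; rewrite muleC -nneseriesZl//; apply: eq_eseriesr => i _; rewrite muleC.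
have fy0 i : (0 <= f i * +oo)%E by rewrite mule_ge0.
have [f_eq0|] := pselect (forall i, f i = 0%E).
  rewrite [X in (X * _)%E]eseries0 ?mul0e; last by move=> i _ _; rewrite f_eq0.
  by apply: eseries0 => i _ _; rewrite f_eq0 mul0e.
move=> /existsNP[i /eqP fi]; have {}fi : (0 < f i)%E by rewrite lt_neqAle eq_sym fi f0.
have le1 (g : nat -> \bar R) : (forall i, (0 <= g i)%E) -> (g i <= \sum_(0 <= i <oo) g i)%E.
  move=> g0; apply: le_trans (nneseries_lim_ge i.+1 (fun k _ _ => g0 k)).
  by rewrite big_nat_recr//= leeDr// sume_ge0.
have := le1 _ fy0; rewrite gt0_muley// leye_eq => /eqP ->.
by rewrite gt0_muley//; apply: lt_le_trans fi (le1 _ f0).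
Qed.

Section translation.
Context {R : realType}.
Local Notation lam := (@lebesgue_measure R).
Local Notation T := (measurableTypeR R).

Lemma measurable_translate (c : R) : measurable_fun setT ((fun x => c + x) : T -> T).
Proof.
apply: continuous_measurable_fun => x; apply: cvgD; [exact: cvg_cst|exact: cvg_id].
Qed.

Lemma lebesgue_measure_translate (c : R) (A : set T) : measurable A ->
  lam ((fun x => c + x) @^-1` A) = lam A.
Proof.
have mc := measurable_translate c.
move=> mA; rewrite -[LHS]/(pushforward lam ((fun x => c + x) : T -> T) A).
apply/esym/lebesgue_measure_unique => //= _ [[a b]] _ <-; rewrite /pushforward.
rewrite (_ : _ @^-1` _ = `]a - c, b - c]%classic).
  rewrite !lebesgue_measure_itv/= !lte_fin ltrD2r; case: ifP => // _.
  by rewrite -!EFinB; congr EFin; ring.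
by apply/seteqP; split => x /=; rewrite !in_itv/= => /andP[h1 h2]; apply/andP; split; lra.
Qed.

Lemma nneseries_prob01_translate (A : set T) : measurable A -> (forall x, A x -> 0 <= x) ->
  (\sum_(0 <= k <oo) prob01 ((fun x => k%:R + x)%R @^-1` A))%E = lam A.
Proof.
move=> mA A0; pose I (k : nat) : set R := `[k%:R, k%:R + 1[%classic.
have mAI k : measurable (A `&` I k) by apply: measurableI => //; exact: measurable_itv.
have -> : A = \bigcup_k (A `&` I k).
  apply/seteqP; split => x; last by move=> [k _ []].
  move=> Ax; exists (Num.truncn x) => //; split => //=.
  rewrite /I/= in_itv/=; apply/andP; split.
    by rewrite truncn_le ?A0.
  by rewrite natr1 truncnS_gt.
rewrite measure_bigcupT//.
- apply: eq_eseriesr => k _; rewrite prob01E.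
  rewrite -[RHS](lebesgue_measure_translate k%:R); last exact: mAI.
  congr (lam _); apply/seteqP; split => x /= [].
    move=> [j _ [Aj jx]]; rewrite in_itv/= => x1; split => //.
    by rewrite /I/= in_itv/=; lra.
  rewrite /I/= !in_itv/= => Ax x1; split; last by lra.
  by exists k => //; split => //; rewrite /I/= in_itv/=; lra.
- apply/trivIsetP => i j _ _ ij; rewrite -subset0 => x [[_ ix] [_ jx]].
  move: ix jx ij; rewrite /I/= !in_itv/= => /andP[i1 i2] /andP[j1 j2] /eqP; apply.
  have ij : i%:R < j%:R + 1 :> R by lra.
  have ji : j%:R < i%:R + 1 :> R by lra.
  by move: ij ji; rewrite !natr1 !ltr_nat; lia.
Qed.

End translation.

(** * The Poisson process on the half-plane of marked points *)

Section product_intensity.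
Context {R : realType} {E : topologicalType}.
Local Notation lam := (@lebesgue_measure R).
Local Notation T := (measurableTypeR R).
Local Notation P := (@prob01 R).
Context (F : R -> set E).
Hypothesis mF : forall C, Fsigma C -> measurable (F @^-1` C : set R).
Hypothesis F_ge0 : forall v, Fprime (F v) -> 0 <= v.

Lemma Fsigma_Fprime : Fsigma (@Fprime E).
Proof.
rewrite -(@setD0 _ (@Fprime E)); apply: sigma_algebraCD.
exact: sigma_algebra0.
Qed.

(** Cell (k, l) is the unit square with lower corner (k, l), its uniform point being (k + g1 u, l +
    g2 u). Applying F to the second coordinate and summing over the squares gives the product of
    Lebesgue measure and its image under F. *)
Lemma product_poisson_process : exists (mu : set (R * set E) -> \bar R)
    (pts : T -> nat -> option (R * set E)),
  is_product_intensity (fun C => lam (F @^-1` C)) mu /\ poisson_process P pts mu.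
Proof.
have [g1 [g2 [mg1 mg2 g_indep]]] := @prob01_pairing R.
(* Unused indices are sent to (-1, set0), which is not in [Dom]. *)
pose phi (i : nat) (u : T) : R * set E :=
  if @pickle_inv (nat * nat)%type i is Some (k, l) then (k%:R + g1 u, F (l%:R + g2 u))
  else (-1, set0).
have m1 k (I : set T) : measurable I -> measurable ((fun x => k%:R + x)%R @^-1` I : set T).
  by move=> mI; exact: measurable_fun_preimage (measurable_translate _) mI.
have m2 l C : Fsigma C -> measurable ((fun x => l%:R + x)%R @^-1` (F @^-1` C) : set T).
  by move=> sC; apply: m1; exact: mF.
have mphi i B : ProdSigma B -> measurable (phi i @^-1` B).
  apply: (@smallest_sub _ _ _ [set B | measurable (phi i @^-1` B)]); last first.
    move=> _ [I [C [mI I0 sC ->]]] /=; rewrite /phi.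
    case: pickle_inv => [[k l]|].
      apply: measurableI (measurable_fun_preimage mg1 (m1 k I mI))
        (measurable_fun_preimage mg2 (m2 l C sC)).
    rewrite (_ : _ @^-1` _ = set0)// -subset0 => u [/= /I0/=]; lra.
  have mD : measurable (phi i @^-1` Dom).
    rewrite /phi; case: pickle_inv => [[k l]|].
      apply: measurableI (measurable_fun_preimage mg1 (m1 k [set x | 0 < x] _))
        (measurable_fun_preimage mg2 (m2 l _ Fsigma_Fprime)).
      by rewrite (_ : mkset _ = `]0, +oo[%classic)//; apply/seteqP; split => x /=; rewrite in_itv/= andbT.
    by rewrite (_ : _ @^-1` _ = set0)// -subset0 => u [/=]; lra.
  split => /=; first by rewrite preimage_set0.
    by move=> A mA; exact: measurableD.
  by move=> G mG; rewrite preimage_bigcup; exact: bigcupT_measurable.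
pose mu B := (\sum_(0 <= i <oo) P (phi i @^-1` B))%E.
have [pts pp] := poisson_process_exists mphi (fun B _ => erefl (mu B)).
exists mu, pts; split => //; split.
  split.
  - by rewrite /mu; apply: eseries0 => i _ _; rewrite preimage_set0 measure0.
  - by move=> B _; apply: nneseries_ge0 => i _ _; exact: measure_ge0.
  - move=> B sB tB sU.
    have -> : mu (\bigcup_n B n) = (\sum_(0 <= k <oo) mu (B k))%E.
      rewrite nneseries_interchange; last by move=> k i; exact: measure_ge0.
      apply: eq_eseriesr => i _; rewrite preimage_bigcup measure_bigcupT//.
        by move=> k; exact: mphi.
      apply/trivIsetP => k l _ _ kl; rewrite -preimage_setI.
      by rewrite (trivIsetP.1 tB)// preimage_set0.
    apply: is_cvg_nneseries => n _ _; apply: nneseries_ge0 => i _ _; exact: measure_ge0.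
move=> I C mI I0 sC.
pose a k := P ((fun x => k%:R + x)%R @^-1` I).
pose b l := P ((fun x => l%:R + x)%R @^-1` (F @^-1` C)).
have a0 k : (0 <= a k)%E by exact: measure_ge0.
have b0 l : (0 <= b l)%E by exact: measure_ge0.
have ab0 k l : (0 <= a k * b l)%E by exact: mule_ge0.
have aE : (\sum_(0 <= k <oo) a k = lam I)%E.
  by apply: nneseries_prob01_translate => // x /I0 /ltW.
have bE : (\sum_(0 <= l <oo) b l = lam (F @^-1` C))%E.
  apply: nneseries_prob01_translate; first exact: mF.
  by move=> v Cv; apply: F_ge0; exact: Fsigma_sub Cv.
pose f i : \bar R := if @pickle_inv (nat * nat)%type i is Some (k, l) then (a k * b l)%E else 0%E.
have f0 n : (0 <= f n)%E by rewrite /f; case: pickle_inv => // -[].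
transitivity (\sum_(0 <= n <oo) f n)%E.
  apply: eq_eseriesr => n _; rewrite /f /phi; case: pickle_inv => [[k l]|].
    exact: g_indep (m1 k I mI) (m2 l C sC).
  by rewrite (_ : _ @^-1` _ = set0) ?measure0// -subset0 => u [/= /I0/=]; lra.
transitivity (\sum_(0 <= k <oo) \sum_(0 <= l <oo) a k * b l)%E; last first.
  rewrite -aE -bE -nneseriesM//; last exact: nneseries_ge0.
  apply: eq_eseriesr => k _.
  by rewrite /a (fin_probability P (m1 k I mI)) nneseriesZl.
rewrite nneseries_esumT//.
transitivity (\esum_(n in range (pickle : nat * nat -> nat)) f n)%E.
  rewrite [RHS]esum_mkcond; apply: eq_esum => n _; case: ifPn => //.
  rewrite notin_setE => nr; rewrite /f; case En : pickle_inv => [[i c]|//].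
  by case: nr; exists (i, c) => //; have := @pickle_invK (nat * nat)%type n; rewrite En.
rewrite esum_image; last by move=> p q _ _; exact: (pcan_inj pickleK).
transitivity (\esum_(k in setT `*`` (fun=> setT)) (a k.1 * b k.2))%E.
  rewrite (_ : _ `*`` _ = setT); last exact/seteqP.
  by apply: eq_esum => -[i c] _; rewrite /f pickleK_inv.
rewrite -(esum_esum (fun i j _ _ => ab0 i j)) [RHS]nneseries_esumT//; last first.
  by move=> k; apply: nneseries_ge0 => l _ _; exact: ab0.
by apply: eq_esum => i _; rewrite [RHS]nneseries_esumT.
Qed.

End product_intensity.

Theorem mainTheorem7 (R : realType) (E : topologicalType)
  (d : measure_display) (Omega : measurableType d) (P : probability Omega R)
  (X : Omega -> set E -> \bar R) (theta : set E -> R) :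
  hausdorff_space E -> locally_compact [set: E] -> @second_countable E ->
  random_sup_measure X ->
  (CRSM P X /\ ext_coeff P X theta) <->
  exists nu : set (set E) -> \bar R,
    [/\ measure_on (@Fsigma E) nu, locally_finite nu,
        (forall K, compact K -> nu (hit K) = (theta K)%:E) &
        exists (d' : measure_display) (Omega' : measurableType d')
               (P' : probability Omega' R)
               (pts : Omega' -> nat -> option (R * set E))
               (mu : set (R * set E) -> \bar R),
          [/\ is_product_intensity nu mu, poisson_process P' pts mu &
              same_fidi P X P' (fun w => rep (pts w))]].
Proof.
move=> hE lcE scE rX.
have Xmax w : maxitive (X w) by apply: sup_measure_maxitive => //; case: rX.
split; last first.
  move=> [nu [_ _ nuE [d' [ Omega' [P' [pts [mu [muE pp fidi]]]]]]]].
  have cX : chain_law P X theta.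
    have repmax w : maxitive (rep (pts w)) by apply: maxitive_rep; case: pp => /(_ w).
    (* Equality of finite-dimensional laws yields no measurability, which [chain_law] includes; it
       comes from X being a random sup-measure. *)
    have mX K x (cK : compact K) := random_sup_measure_measurable_le x rX cK.
    have cr : chain_law P' (fun w => rep (pts w)) theta := rep_chain_law nuE muE pp.
    exact: (same_fidi_chain_law Xmax repmax mX fidi cr).
  split; last exact: chain_law_ext_coeff rX cX.
  exact: (chain_law_CRSM hE lcE scE rX cX).
move=> [crsm ec]; have cX := CRSM_chain_law hE rX crsm ec.
have [B [Bo Bc Bb]] := relatively_compact_basis hE lcE scE.
pose m := tail_mass B P X.
have m_ge0 : forall s, has id s -> 0 <= m s.
  exact: (tail_mass_ge0 hE lcE scE Bc rX cX).
have m_split : forall s, has id s -> m s = m (true :: s) + m (false :: s).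
  exact: (tail_mass_split hE lcE scE Bc rX cX).
(* The empty set is not in [Fprime], so negative v carry no mass. *)
pose F v := if 0 <= v then carrier B m v else set0.
have FE (C : set (set E)) : Fsigma C ->
    F @^-1` C = [set v | 0 <= v /\ C (carrier B m v)].
  move=> sC; apply/seteqP; split => v; rewrite /F /=; last by case=> ->.
  by case: ifP => // _ /(Fsigma_sub sC)[_ [x []]].
have mF C : Fsigma C -> measurable (F @^-1` C : set R).
  move=> sC; rewrite FE//; exact: (measurable_carrier Bo Bc Bb m_ge0 m_split).
have F_ge0 v : Fprime (F v) -> 0 <= v.
  by rewrite /F; case: ifP => // _ [_ [x []]].
have [mu [pts [muE pp]]] := product_poisson_process mF F_ge0.
have nuE K : compact K -> lebesgue_measure (F @^-1` hit K) = (theta K)%:E.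
  move=> cK; rewrite FE; last exact: Fsigma_hit.
  apply: (carrier_law_hit Bo Bc Bb m_ge0 m_split) => //.
  - exact: (lebesgue_tree_hits hE lcE scE Bc rX cX).
  - by move=> A C; exact: (chain_law_mono rX cX).
  - by move=> A e; exact: (theta_outer hE Bo Bc Bb rX cX).
exists (fun C => lebesgue_measure (F @^-1` C)); split => //.
- have [h0 hge hadd] := measure_on_carrier_law Bo Bc Bb m_ge0 m_split.
  split; first by rewrite preimage_set0 measure0.
    by move=> C _; exact: measure_ge0.
  move=> G sG tG sU; have := hadd G sG tG sU; rewrite /carrier_law -FE//.
  under eq_fun do under eq_bigr do rewrite -FE//; exact.
- by move=> K cK; rewrite nuE// ltry.
exists _, (measurableTypeR R), prob01, pts, mu; split => //.
have repmax w : maxitive (rep (pts w)) by apply: maxitive_rep; case: pp => /(_ w).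
have cr : chain_law prob01 (fun w => rep (pts w)) theta := rep_chain_law nuE muE pp.
exact: (chain_law_same_fidi Xmax repmax cX cr).
Qed.
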